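(* (a) Every $\mathfrak{g}$-module in category $\mathcal{J}$ is a polynomial module. (b) There is a one-to-one correspondence between indecomposable $\mathfrak{g}$-modules in category $\mathcal{J}$ and pairs $(\lambda,U)$, where $\lambda\in\mathbb{C}^n/\mathbb{Z}^n$ and $U$ is a finite-dimensional indecomposable module (with representation $\rho$) for the Lie algebra $\mathfrak{g}^+$. To the pair $(\lambda,U)$ corresponds $J=\mathcal{F}(\mathbb{T}^n)\otimes U$, where $\mathcal{F}(\mathbb{T}^n)$ acts by multiplication on the first factor and $$d_j(s)(e_m\otimes v)=(m_j+\lambda_j)\,e_{m+s}\otimes v+\sum_{\beta\in\mathbb{Z}_+^n\setminus\{0\}}\frac{s^\beta}{\beta!}\,e_{m+s}\otimes\rho\Big(z^\beta\frac{\partial}{\partial z_j}\Big)v,$$ $$(e_s\otimes g)(e_m\otimes v)=\sum_{\beta\in\mathbb{Z}_+^n}\frac{s^\beta}{\beta!}\,e_{m+s}\otimes\rho(z^\beta g)v,$$ for $g\in\dot{\mathfrak{g}}$ and $v\in U$. In both sums only finitely many terms are nonzero. (c) Irreducible $\mathfrak{g}$-modules in category $\mathcal{J}$ are in one-to-one correspondence with pairs $(\lambda,V)$, where $\lambda\in\mathbb{C}^n/\mathbb{Z}^n$ and $V$ is a finite-dimensional irreducible $\mathfrak{gl}_n(\mathbb{C})\oplus\dot{\mathfrak{g}}$-module. The corresponding module is $J=\mathcal{F}(\mathbb{T}^n)\otimes V$, where $\mathcal{F}(\mathbb{T}^n)$ acts by multiplication on the first factor and $$d_j(s)(e_m\otimes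 v)=(m_j+\lambda_j)\,e_{m+s}\otimes v+\sum_{p=1}^ns_p\,e_{m+s}\otimes E^p_jv,$$ $$(e_s\otimes g)(e_m\otimes v)=e_{m+s}\otimes gv\qquad(g\in\dot{\mathfrak{g}},\ v\in V).$$
   Context: Let $n\ge 1$. Let $\mathcal{F}(\mathbb{T}^n)$ be the commutative algebra with $\mathbb{C}$-basis $e_m=e^{2\pi i m\cdot x}$, $m\in\mathbb{Z}^n$, and $e_me_k=e_{m+k}$. Let $W_n$ be the Lie algebra with $\mathbb{C}$-basis $d_j(s)=\frac{1}{2\pi i}e^{2\pi i s\cdot x}\frac{\partial}{\partial x^j}$, for $j=1,\dots,n$ and $s\in\mathbb{Z}^n$, and bracket $$[d_j(s),d_k(m)]=m_jd_k(s+m)-s_kd_j(s+m).$$ $W_n$ acts on $\mathcal{F}(\mathbb{T}^n)$ by derivations via $d_j(s)e_m=m_je_{m+s}$. Write $d_j=d_j(0)$. Let $\dot{\mathfrak{g}}$ be a finite-dimensional complex Lie algebra. Let $\tilde{\mathfrak{g}}=\mathcal{F}(\mathbb{T}^n)\otimes\dot{\mathfrak{g}}$ with bracket $[f\otimes a,h\otimes b]=fh\otimes[a,b]$. Let $\mathfrak{g}=W_n\oplus\tilde{\mathfrak{g}}$ be the semidirect product with $[u,f\otimes a]=(uf)\otimes a$. Category $\mathcal{J}$ (for $\mathfrak{g}$) consists of $\mathfrak{g}$-modules $J$ that are also $\mathcal{F}(\mathbb{T}^n)$-modules and satisfy: (J1) each $d_j$ acts diagonalizably; (J2) $J$ is a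 free $\mathcal{F}(\mathbb{T}^n)$-module of finite rank; (J3) $u(fw)=(uf)w+f(uw)$ for $u\in W_n$, $f\in\mathcal{F}(\mathbb{T}^n)$, $w\in J$; (J4) $\tilde g(fw)=f(\tilde gw)$ for $\tilde g\in\tilde{\mathfrak{g}}$, $f\in\mathcal{F}(\mathbb{T}^n)$, $w\in J$. Submodules are invariant under $\mathfrak{g}$ and $\mathcal{F}(\mathbb{T}^n)$. Indecomposable modules are nonzero. Correspondences are up to isomorphism, and $\lambda$ denotes any representative of its class. A module $J$ in $\mathcal{J}$ is a polynomial module if there is an $\mathcal{F}(\mathbb{T}^n)$-basis $v_1,\dots,v_k$ of $J$ such that, for all $s,m\in\mathbb{Z}^n$, $$d_j(s)(e_mv_r)=\sum_\ell f_{jr\ell}(s,m)\,e_{m+s}v_\ell,\qquad (e_s\otimes a)(e_mv_r)=\sum_\ell h_{ar\ell}(s,m)\,e_{m+s}v_\ell,$$ with all structure constants $f_{jr\ell}$ and $h_{ar\ell}$ polynomial in $s,m$, for each $a\in\dot{\mathfrak{g}}$. Notation: $\mathbb{Z}_+$ denotes the nonnegative integers, $\epsilon_j$ the standard basis of $\mathbb{Z}^n$, $s^\beta=\prod_i s_i^{\beta_i}$ and $\beta!=\prod_i\beta_i!$. $W_n^+$ is the Lie algebra spanned by $z^\alpha\frac{\partial}{\partial z_j}$ with $\alpha\in\mathbb{Z}_+^n\setminus\{0\}$, acting as derivations of $\mathbb{C}[z_1,\dots,z_n]$. $\mathfrak{g}^+=W_n^+\oplus\mathbb{C}[z_1,\dots,z_n]\otimes\dot{\mathfrak{g}}$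 is the semidirect product with brackets $$\Big[z^\alpha\frac{\partial}{\partial z_j},z^\beta a\Big]=\beta_jz^{\alpha+\beta-\epsilon_j}a,\qquad [z^\alpha a,z^\beta b]=z^{\alpha+\beta}[a,b].$$ $E^p_q\in\mathfrak{gl}_n(\mathbb{C})$ is the matrix with $1$ in position $(p,q)$ and $0$ elsewhere. *)

(* Defs.v *)
From HB Require Import structures.
From mathcomp Require Import all_boot all_order all_algebra all_field.
From mathcomp Require Import complex Rstruct boolp functions.
Set Implicit Arguments. Unset Strict Implicit. Unset Printing Implicit Defensive.
Import Order.TTheory GRing.Theory Num.Theory.
Local Open Scope ring_scope.

Definition C := complex Rdefinitions.R.
Notation Zn n := 'rV[int]_n.
Notation mi n := 'rV[nat]_n.

Section Tens.
Variables (n : nat) (U : lmodType C).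
Definition fsupp (f : Zn n -> U) : Prop :=
  exists s : seq (Zn n), forall m, m \notin s -> f m = 0.
Definition fsuppP : {pred Zn n -> U} := fun f => `[< fsupp f >].
Lemma fsuppP_closed : submod_closed fsuppP.
Proof.
split.
  by apply/asboolP; exists [::] => m _.
move=> a u v /asboolP [s1 h1] /asboolP [s2 h2]; apply/asboolP.
exists (s1 ++ s2) => m; rewrite mem_cat negb_or => /andP [m1 m2].
have e1 := h1 m m1; have e2 := h2 m m2.
rewrite !fctE e1 e2 scaler0 addr0 //.
Qed.
HB.instance Definition _ := GRing.isSubmodClosed.Build _ _ fsuppP fsuppP_closed.
Record tens := Tens { tval : Zn n -> U; tvalP : tval \in fsuppP }.
HB.instance Definition _ := [isSub for tval].
HB.instance Definition _ := [Choice of tens by <:].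
HB.instance Definition _ := [SubChoice_isSubLmodule of tens by <:].
End Tens.

(* A module is a C-vector space X with a family ops : I -> X -> X of  *)
(* operators (the images of a basis of the acting algebra).           *)

Definition lin (X Y : lmodType C) (f : X -> Y) : Prop :=
  forall (k : C) (x y : X), f (k *: x + y) = k *: f x + f y.

Definition invariant (X : lmodType C) (I : Type) (ops : I -> X -> X)
  (S : X -> Prop) : Prop :=
  [/\ S 0, (forall (k : C) x y, S x -> S y -> S (k *: x + y))
    & (forall i x, S x -> S (ops i x))].

Definition zero_sub (X : lmodType C) (S : X -> Prop) := forall x, S x -> x = 0.
Definition nonzero (X : lmodType C) := exists x : X, x <> 0.

Definition indecomposable (X : lmodType C) (I : Type) (ops : I -> X -> X) :=
  nonzero X /\
  forall S1 S2 : X -> Prop, invariant ops S1 -> invariant ops S2 ->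
    (forall x, exists x1 x2, [/\ S1 x1, S2 x2 & x = x1 + x2]) ->
    (forall x, S1 x -> S2 x -> x = 0) ->
    zero_sub S1 \/ zero_sub S2.

Definition irreducible (X : lmodType C) (I : Type) (ops : I -> X -> X) :=
  nonzero X /\
  forall S : X -> Prop, invariant ops S -> zero_sub S \/ (forall x, S x).

Definition isomorphic (X Y : lmodType C) (I : Type)
  (opsX : I -> X -> X) (opsY : I -> Y -> Y) :=
  exists phi : X -> Y,
    [/\ lin phi, bijective phi & forall i x, phi (opsX i x) = opsY i (phi x)].

Definition is_lie (L : vectType C) (br : L -> L -> L) : Prop :=
  [/\ (forall a, lin (br a)), (forall b, lin (br^~ b)),
      (forall x, br x x = 0)
    & (forall x y z, br x (br y z) + br y (br z x) + br z (br x y) = 0)].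

(* Modules for g = W_n ⋉ (F(T^n) ⊗ gdot), together with the action of *)
(* F(T^n):  gE m = action of e_m,  gD j s = action of d_j(s),         *)
(*          gG s a = action of e_s ⊗ a.                               *)

Record gmod (n : nat) (L : vectType C) := GMod {
  gcar : lmodType C;
  gE : Zn n -> gcar -> gcar;
  gD : 'I_n -> Zn n -> gcar -> gcar;
  gG : Zn n -> L -> gcar -> gcar }.
Arguments GMod {n L} gcar gE gD gG.
Arguments gcar {n L} g.
Arguments gE {n L} g.
Arguments gD {n L} g.
Arguments gG {n L} g.

Definition gops n L (M : gmod n L) :
  (Zn n + ('I_n * Zn n) + (Zn n * L)) -> gcar M -> gcar M :=
  fun i => match i with
  | inl (inl m) => gE M m
  | inl (inr (j, s)) => gD M j s
  | inr (s, a) => gG M s a end.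
Arguments gops {n L} M.

Definition zc n (m : Zn n) (j : 'I_n) : C := (m 0 j)%:~R.

Definition spans (X : lmodType C) (I : Type) (f : I -> X) : Prop :=
  forall w : X, exists s : seq (I * C), w = \sum_(t <- s) t.2 *: f t.1.

Definition indep (X : lmodType C) (I : eqType) (f : I -> X) : Prop :=
  forall s : seq (I * C), uniq (map fst s) ->
    \sum_(t <- s) t.2 *: f t.1 = 0 -> forall t, t \in s -> t.2 = 0.

(* v is an F(T^n)-basis of M, i.e. (e_m v_i)_{m,i} is a C-basis *)
Definition Fbasis n L (M : gmod n L) k (v : 'I_k -> gcar M) : Prop :=
  spans (fun p : Zn n * 'I_k => gE M p.1 (v p.2)) /\
  indep (fun p : Zn n * 'I_k => gE M p.1 (v p.2)).

(* M is simultaneously an F(T^n)-module and a g-module (written out on *)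
(* the bases e_m of F(T^n) and d_j(s), e_s ⊗ a of g).                  *)
Definition is_gmod n (L : vectType C) (br : L -> L -> L) (M : gmod n L) : Prop :=
  let E := gE M in let D := gD M in let G := gG M in
  (forall m, lin (E m)) /\ (forall j s, lin (D j s)) /\ (forall s a, lin (G s a)) /\
  (forall s (k : C) a b w, G s (k *: a + b) w = k *: G s a w + G s b w) /\
  (forall w, E 0 w = w) /\ (forall m k w, E m (E k w) = E (m + k) w) /\
  (forall j k s m w, D j s (D k m w) - D k m (D j s w)
                     = zc m j *: D k (s + m) w - zc s k *: D j (s + m) w) /\
  (forall j s m a w, D j s (G m a w) - G m a (D j s w) = zc m j *: G (s + m) a w) /\
  (forall s m a b w, G s a (G m b w) - G m b (G s a w) = G (s + m) (br a b) w).

Definition catJ n (L : vectType C) (br : L -> L -> L) (M : gmod n L) : Prop :=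
  is_gmod br M /\
  (forall j w, exists s : seq (C * gcar M),
      w = \sum_(t <- s) t.2 /\ forall t, t \in s -> gD M j 0 t.2 = t.1 *: t.2) /\
  (exists k (v : 'I_k -> gcar M), Fbasis v) /\
  (forall j s m w, gD M j s (gE M m w) = zc m j *: gE M (m + s) w + gE M m (gD M j s w)) /\
  (forall s a m w, gG M s a (gE M m w) = gE M m (gG M s a w)).

Definition g_indec n L (M : gmod n L) := indecomposable (gops M).
Definition g_irr n L (M : gmod n L) := irreducible (gops M).
Definition g_iso n L (M M' : gmod n L) := isomorphic (gops M) (gops M').

Definition mono n (s : Zn n) (b : mi n) : C := \prod_(i < n) (zc s i) ^+ (b 0 i).
Definition poly_fun n (f : Zn n -> Zn n -> C) : Prop :=
  exists c : seq ((mi n * mi n) * C),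
    forall s m, f s m = \sum_(t <- c) t.2 * mono s t.1.1 * mono m t.1.2.

Definition polynomial_module n L (M : gmod n L) : Prop :=
  exists k (v : 'I_k -> gcar M)
    (f : 'I_n -> 'I_k -> 'I_k -> Zn n -> Zn n -> C)
    (h : L -> 'I_k -> 'I_k -> Zn n -> Zn n -> C),
  [/\ Fbasis v,
      (forall j r l, poly_fun (f j r l)), (forall a r l, poly_fun (h a r l)),
      (forall j s m r, gD M j s (gE M m (v r))
                       = \sum_(l < k) f j r l s m *: gE M (m + s) (v l))
    & (forall a s m r, gG M s a (gE M m (v r))
                       = \sum_(l < k) h a r l s m *: gE M (m + s) (v l))].

(* finite-dimensional modules for g^+ = W_n^+ ⋉ (C[z] ⊗ gdot):       *)
(* gpP a j = rho(z^a d/dz_j) (a <> 0), gpQ b x = rho(z^b x).          *)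

Record gpmod (n : nat) (L : vectType C) := GPMod {
  gpcar : vectType C;
  gpP : mi n -> 'I_n -> 'End(gpcar);
  gpQ : mi n -> L -> 'End(gpcar) }.
Arguments gpcar {n L} g.
Arguments gpP {n L} g.
Arguments gpQ {n L} g.

Definition mshift n (a b : mi n) (j : 'I_n) : mi n :=
  \row_i (a ord0 i + b ord0 i - (i == j))%N.

Definition is_gpmod n (L : vectType C) (br : L -> L -> L) (U : gpmod n L) : Prop :=
  let P := gpP U in let Q := gpQ U in
  [/\ (forall b (k : C) x y, Q b (k *: x + y) = k *: Q b x + Q b y),
      (forall a b j k v, a != 0 -> b != 0 ->
         P a j (P b k v) - P b k (P a j v)
         = (b 0 j)%:R *: P (mshift a b j) k v - (a 0 k)%:R *: P (mshift a b k) j v),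
      (forall a b j x v, a != 0 ->
         P a j (Q b x v) - Q b x (P a j v) = (b 0 j)%:R *: Q (mshift a b j) x v)
    & (forall a b x y v, Q a x (Q b y v) - Q b y (Q a x v) = Q (a + b) (br x y) v)].

Definition gpops n L (U : gpmod n L) :
  ({a : mi n | a != 0} * 'I_n + mi n * L) -> gpcar U -> gpcar U :=
  fun i => match i with
  | inl (a, j) => gpP U (val a) j
  | inr (b, x) => gpQ U b x end.
Arguments gpops {n L} U.

Definition gp_indec n L (U : gpmod n L) := indecomposable (gpops U).
Definition gp_iso n L (U U' : gpmod n L) := isomorphic (gpops U) (gpops U').

Definition gp_vanish n L (U : gpmod n L) (N : nat) : Prop :=
  (forall (a : mi n) j, (exists i, (N <= a ord0 i)%N) -> gpP U a j = 0) /\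
  (forall (b : mi n) x, (exists i, (N <= b ord0 i)%N) -> gpQ U b x = 0).

(* finite-dimensional modules for gl_n ⊕ gdot:                        *)
(* glA p q = action of E^p_q, glB x = action of x.                    *)

Record glmod (n : nat) (L : vectType C) := GLMod {
  glcar : vectType C;
  glA : 'I_n -> 'I_n -> 'End(glcar);
  glB : L -> 'End(glcar) }.
Arguments glcar {n L} g.
Arguments glA {n L} g.
Arguments glB {n L} g.

Definition is_glmod n (L : vectType C) (br : L -> L -> L) (V : glmod n L) : Prop :=
  let A := glA V in let B := glB V in
  [/\ (forall (k : C) x y, B (k *: x + y) = k *: B x + B y),
      (forall p q r t v, A p q (A r t v) - A r t (A p q v)
                         = (q == r)%:R *: A p t v - (t == p)%:R *: A r q v),
      (forall p q x v, A p q (B x v) - B x (A p q v) = 0)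
    & (forall x y v, B x (B y v) - B y (B x v) = B (br x y) v)].

Definition glops n L (V : glmod n L) :
  ('I_n * 'I_n + L) -> glcar V -> glcar V :=
  fun i => match i with inl (p, q) => glA V p q | inr x => glB V x end.
Arguments glops {n L} V.

Definition gl_irr n L (V : glmod n L) := irreducible (glops V).
Definition gl_iso n L (V V' : glmod n L) := isomorphic (glops V) (glops V').

(* The module F(T^n) ⊗ U, realised as finitely supported functions   *)
(* Z^n -> U (f <-> sum_m e_m ⊗ f m), with                             *)
(*   e_k (e_m ⊗ v)    = e_(m+k) ⊗ v                                   *)
(*   d_j(s)(e_m ⊗ v)  = (m_j + lam_j) e_(m+s) ⊗ v + e_(m+s) ⊗ Dc j s v *)
(*   (e_s⊗a)(e_m ⊗ v) = e_(m+s) ⊗ Gc s a v                             *)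

Section Model.
Variables (n : nat) (L : vectType C) (U : vectType C).

Definition tshift_fun (s : Zn n) (h : Zn n -> U -> U) (f : tens n U) : Zn n -> U :=
  fun m => h m (tval f (m - s)).

Lemma tshift_proof s h (h0 : forall m, h m 0 = 0) f :
  tshift_fun s h f \in @fsuppP n U.
Proof.
move: (tvalP f) => /asboolP [S hS]; apply/asboolP.
exists (map (fun m => m + s) S) => m hm; rewrite /tshift_fun /=.
rewrite hS ?h0 //; apply: contra hm => hin.
by apply/mapP; exists (m - s) => //; rewrite subrK.
Qed.

Definition tshift s h h0 f : tens n U := Tens (@tshift_proof s h h0 f).

Variables (lam : 'rV[C]_n) (Dc : 'I_n -> Zn n -> 'End(U))
          (Gc : Zn n -> L -> 'End(U)).

Definition tE_fun (k : Zn n) (m : Zn n) (v : U) := v.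
Lemma tE_0 k m : tE_fun k m 0 = 0. Proof. by []. Qed.
Definition tE (k : Zn n) := tshift k (@tE_0 k).

Definition tD_fun j s (m : Zn n) (v : U) :=
  (zc (m - s) j + lam 0 j) *: v + Dc j s v.
Lemma tD_0 j s m : tD_fun j s m 0 = 0.
Proof. by rewrite /tD_fun scaler0 linear0 addr0. Qed.
Definition tD j s := tshift s (@tD_0 j s).

Definition tG_fun s a (m : Zn n) (v : U) := Gc s a v.
Lemma tG_0 s a m : tG_fun s a m 0 = 0.
Proof. by rewrite /tG_fun linear0. Qed.
Definition tG s a := tshift s (@tG_0 s a).

Definition tmodel : gmod n L := GMod (tens n U) tE tD tG.
End Model.

Definition coefsb n (s : Zn n) (b : mi n) : C :=
  mono s b / \prod_(i < n) ((b 0 i)`!)%:R.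

Definition bx n N (b : {ffun 'I_n -> 'I_N}) : mi n := \row_i (b i : nat).

Definition jetD n L (U : gpmod n L) N (j : 'I_n) (s : Zn n) : 'End(gpcar U) :=
  \sum_(b : {ffun 'I_n -> 'I_N} | bx b != 0) coefsb s (bx b) *: gpP U (bx b) j.
Definition jetG n L (U : gpmod n L) N (s : Zn n) (x : L) : 'End(gpcar U) :=
  \sum_(b : {ffun 'I_n -> 'I_N}) coefsb s (bx b) *: gpQ U (bx b) x.
Definition Jjet n L (lam : 'rV[C]_n) (U : gpmod n L) N : gmod n L :=
  tmodel lam (jetD U N) (jetG U N).

Definition glD n L (V : glmod n L) (j : 'I_n) (s : Zn n) : 'End(glcar V) :=
  \sum_(p < n) zc s p *: glA V p j.
Definition Jgl n L (lam : 'rV[C]_n) (V : glmod n L) : gmod n L :=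
  tmodel lam (glD V) (fun _ x => glB V x).

Definition lam_equiv n (lam lam' : 'rV[C]_n) : Prop :=
  exists k : Zn n, forall i, lam 0 i - lam' 0 i = zc k i.

(* Main.v *)
(* On a weight space U of M, the operators e_(-s) d_j(s) and e_(-s) (e_s a) represent the Lie algebra
   of vector fields on the torus vanishing at 1, extended by currents, and M = F(T^n) (x) U.  Write
   t = x_i - 1.  The field t d/dx_i acts by the eigenvalue k - 1 on t^k d/dx_i, and End(U) has finite
   dimension, so t^k d/dx_i acts by 0 for large k; bracketing with t g and t^2 g then kills every
   field and current divisible by t^(k+1).  Hence e_(-s) d_j(s) and e_(-s) (e_s a) are annihilated by
   powers of the difference operators in s, i.e. are polynomial in s, and comparing coefficients of
   s^a m^b / (a! b!) turns their commutation relations into those of g^+.  Submodules of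
   F(T^n) (x) U are the F(T^n) (x) T with T invariant in U, because they contain the weight components
   of their elements.  Finally, on an irreducible g^+-module the vectors killed by all elements of
   positive degree form a submodule, which contains a top eigenvector of the Euler field. *)
Require Import Defs.
From HB Require Import structures.
From mathcomp Require Import all_boot all_order all_algebra all_field.
From mathcomp Require Import complex Rstruct boolp functions.
From mathcomp Require Import ring.
Set Implicit Arguments. Unset Strict Implicit. Unset Printing Implicit Defensive.
Import Order.TTheory GRing.Theory Num.Theory.
Local Open Scope ring_scope.
Import VectorInternalTheory.

(** The weights of a decomposable module may lie in several cosets of Z^n, so (a) cannot start from
    a single weight space: U is the sum of the weight spaces of one chosen weight per coset, and
    d_j(0) acts on it diagonalizably but not by a scalar. The relations between the operators e_(-s)
    d_j(s) and e_(-s) (e_s a) on U make each d_j(0) commute with all of them, so for indecomposable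
    J it is a scalar lambda_j. Adding a scalar to e_(-s) d_j(s) does not change these relations, so
    lambda_j may be subtracted; the result vanishes at s = 0, which is why the sum for d_j(s) has no
    term beta = 0. Truncation at exponents below N is harmless: coefficients are recovered by
    interpolation on the grid [0, N)^n, which makes jets and families of coefficients
    interchangeable, for relations, invariant subspaces and intertwiners alike. Isomorphisms are
    controlled by weights: the weights m + lambda of the fibres e_m (x) U are distinct, so an
    isomorphism can only shift the grading. *)

Local Notation tval := Defs.tval.

(** * Linear identities in modules *)

Section LmodExpr.
Variables (K : comNzRingType) (V : lmodType K).

Inductive lmexpr := LmVar of nat | LmZero | LmAdd of lmexpr & lmexpr
  | LmOpp of lmexpr | LmScale of K & lmexpr.

Fixpoint lmeval (l : seq V) e : V :=
  match e with
  | LmVar i => nth 0 l i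
  | LmZero => 0
  | LmAdd a b => lmeval l a + lmeval l b
  | LmOpp a => - lmeval l a
  | LmScale k a => k *: lmeval l a
  end.

Fixpoint lmcoef e (i : nat) : K :=
  match e with
  | LmVar j => if eqn i j then 1 else 0
  | LmZero => 0
  | LmAdd a b => lmcoef a i + lmcoef b i
  | LmOpp a => - lmcoef a i
  | LmScale k a => k * lmcoef a i
  end.

Lemma lmeval_coef l e : lmeval l e = \sum_(i < size l) lmcoef e i *: l`_i.
Proof.
have eqE i j : lmcoef (LmVar j) i = (i == j)%:R.
  by rewrite /=; case: eqVneq => [->|/eqP/eqnP/negPf]; rewrite ?eqnE ?eqxx // => ->.
elim: e => [j||a ea b eb|a ea|k a ea]; rewrite [LHS]/= ?ea ?eb.
- under eq_bigr do rewrite eqE.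
  have [hj|hj] := ltnP j (size l).
    rewrite (bigD1 (Ordinal hj)) //= eqxx scale1r big1 ?addr0 // => i hi.
    by rewrite -[_ == j]/(i == Ordinal hj) (negPf hi) scale0r.
  rewrite nth_default // big1 // => i _; rewrite ltn_eqF ?scale0r //.
  exact: leq_trans hj.
- by rewrite big1 // => i _; rewrite scale0r.
- by rewrite -big_split; apply: eq_bigr => i _; rewrite scalerDl.
- by rewrite -sumrN; apply: eq_bigr => i _; rewrite scaleNr.
- by rewrite scaler_sumr; apply: eq_bigr => i _; rewrite scalerA.
Qed.

(** The hypothesis is a [foldr] over a concrete list, so that [simpl] turns it into one scalar
    equation per atom, each left to [ring]. *)
Lemma lmeval_eq l e1 e2 :
  foldr (fun i P => lmcoef e1 i = lmcoef e2 i /\ P) True (iota 0 (size l)) ->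
  lmeval l e1 = lmeval l e2.
Proof.
rewrite !lmeval_coef => h; apply: eq_bigr => i _; congr (_ *: _).
have : (i : nat) \in iota 0 (size l) by rewrite mem_iota ltn_ord.
elim: (iota 0 (size l)) h => //= j s IH [e1j h].
by rewrite in_cons => /predU1P[->//|/IH]; apply.
Qed.
End LmodExpr.

(** A syntactic occurrence is preferred; conversion is tried only when there is none, so that
    convertible atoms share one index. *)
Ltac lm_index x l :=
  lazymatch l with
  | x :: _ => constr:(O)
  | ?y :: ?l' => match constr:(tt) with
      | _ => let i := lm_index x l' in constr:(S i)
      | _ => let _ := constr:(erefl y : y = x) in constr:(O)
      end
  end.
Ltac lm_insert e l :=
  match constr:(tt) with
  | _ => let i := lm_index e l in l
  | _ => constr:(e :: l)
  end.
Ltac lm_atoms K e l :=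
  lazymatch e with
  | (?a + ?b)%R => let l1 := lm_atoms K a l in lm_atoms K b l1
  | (- ?a)%R => lm_atoms K a l
  | (?k *: ?a)%R => lm_atoms K a l
  | 0%R => l
  | _ => lm_insert e l
  end.
Ltac lm_quote K e l :=
  lazymatch e with
  | (?a + ?b)%R => let a' := lm_quote K a l in let b' := lm_quote K b l in
                   constr:(@LmAdd K a' b')
  | (- ?a)%R => let a' := lm_quote K a l in constr:(@LmOpp K a')
  | (?k *: ?a)%R => let a' := lm_quote K a l in constr:(@LmScale K k a')
  | 0%R => constr:(@LmZero K)
  | _ => let i := lm_index e l in constr:(@LmVar K i)
  end.
(* Decides linear identities in a module by comparing the coefficients of the atoms with [ring]. *)
Ltac lmod_over K :=
  lazymatch goal with
  | |- @eq ?T ?a ?b =>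
    let l0 := lm_atoms K a (@nil T) in let l := lm_atoms K b l0 in
    let ea := lm_quote K a l in let eb := lm_quote K b l in
    refine (@lmeval_eq K _ l ea eb _); simpl; repeat split; ring
  end.

(** * Finite differences and interpolation on the integers *)

Section Interpolation.
Variables (K : numFieldType) (V : lmodType K).

Definition diff (f : int -> V) : int -> V := fun x => f (x + 1) - f x.

Lemma diff0_const f : (forall x, diff f x = 0) -> forall x, f x = f 0.
Proof.
move=> h; have e x : f (x + 1) = f x by apply/eqP; rewrite -subr_eq0; apply/eqP/h.
elim/int_rect=> [//|k <-|k <-]; first by rewrite -(e k%:Z) -addn1 PoszD.
by rewrite -(e (- (k.+1)%:Z)); congr f; rewrite -addn1 PoszD opprD addrNK.
Qed.

(** Discrete form of the fact that a polynomial of degree < N with N roots is zero: zeros of f at 0,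
    ..., N give zeros of [diff f] at 0, ..., N - 1, so [diff f] vanishes by induction and f is
    constant. *)
Lemma diff_vanish N f : (forall x, iter N diff f x = 0) ->
  (forall a : nat, (a < N)%N -> f a%:Z = 0) -> forall x, f x = 0.
Proof.
elim: N f => [|N IH] f h0 h1 x; first exact: h0.
rewrite (@diff0_const f) ?h1 // => y; apply: (IH (diff f)) => [z|a ha].
  by rewrite -iterSr h0.
by rewrite /diff -PoszD !h1 ?subr0 // ?addn1 // ltnW.
Qed.

Lemma iter_diff0 N : iter N diff (fun=> 0) = (fun=> 0).
Proof. by elim: N => //= N ->; apply/funext => x; rewrite /diff subr0. Qed.

Lemma iter_diff_le N N' f : (N <= N')%N ->
  (forall x, iter N diff f x = 0) -> forall x, iter N' diff f x = 0.
Proof.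
move=> le h x; rewrite -(subnK le) iterD.
have -> : iter N diff f = (fun=> 0) by apply/funext.
by rewrite iter_diff0.
Qed.

Lemma iter_diffB N f g x :
  iter N diff (fun y => f y - g y) x = iter N diff f x - iter N diff g x.
Proof.
elim: N x => //= N IH x.
by rewrite [LHS]/diff !IH /diff; lmod_over K.
Qed.

Lemma iter_diff_sum N (I : finType) (F : I -> int -> V) x :
  iter N diff (fun y => \sum_i F i y) x = \sum_i iter N diff (F i) x.
Proof. by elim: N x => //= N IH x; rewrite /diff !IH sumrB. Qed.

(** q(X + 1) and q have the same size and leading coefficient, so the top terms cancel. *)
Lemma size_diff_poly (q : {poly K}) N :
  (size q <= N.+1)%N -> (size (q \Po ('X + 1%:P) - q)%R <= N)%N.
Proof.
have [->|q0] := eqVneq q 0; first by rewrite comp_poly0 subr0 size_poly0.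
move=> hq.
have s2 : size ('X + 1%:P : {poly K}) = 2%N by rewrite size_XaddC.
have sq : size (q \Po ('X + 1%:P)) = size q by rewrite size_comp_poly2.
have lq : lead_coef (q \Po ('X + 1%:P)) = lead_coef q.
  by rewrite lead_coef_comp ?s2 // lead_coefXaddC expr1n mulr1.
have single : (0 < size q)%N by rewrite size_poly_gt0.
apply: (@leq_trans (size q).-1); last by rewrite -ltnS prednK.
apply/leq_sizeP => i; rewrite leq_eqVlt => /predU1P[<-|hi].
  by rewrite coefB -{1}sq -!lead_coefE lq subrr.
have hi' : (size q <= i)%N by rewrite -(prednK single).
by rewrite coefB !nth_default ?subr0 ?sq.
Qed.

Lemma diff_poly N (q : {poly K}) v : (size q <= N)%N ->
  forall x, iter N diff (fun y => q.[y%:~R] *: v) x = 0.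
Proof.
elim: N q => [|N IH] q hq x /=.
  by move: hq; rewrite leqn0 size_poly_eq0 => /eqP ->; rewrite horner0 scale0r.
rewrite -[diff _]/(iter N.+1 diff _) iterSr.
have -> : diff (fun y => q.[y%:~R] *: v) =
   fun y => (q \Po ('X + 1%:P) - q).[y%:~R] *: v.
  apply/funext => y; rewrite /diff -scalerBl; congr (_ *: _).
  by rewrite !hornerE horner_comp !hornerE intrD.
by apply: IH; apply: size_diff_poly.
Qed.

(** The Lagrange basis polynomials for the nodes 0, ..., N - 1. *)
Definition lag N (a : 'I_N) : {poly K} :=
  \prod_(b < N | b != a) ((a%:R - b%:R)^-1 *: ('X - b%:R%:P)).

Lemma size_lag N (a : 'I_N) : (size (lag a) <= N)%N.
Proof.
apply: leq_trans (size_prod_leq _ _) _.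
have hc : (#|[pred b | b != a]| = N.-1)%N by rewrite cardC1 card_ord.
have hs : (\sum_(b < N | b != a)
   size ((a%:R - b%:R)^-1 *: ('X - b%:R%:P) : {poly K}) <= 2 * N.-1)%N.
  rewrite -hc mulnC -sum_nat_const; apply: leq_sum => b _.
  by apply: leq_trans (size_scale_leq _ _) _; rewrite size_XsubC.
rewrite hc; move: hs; have := ltn_ord a; case: N a {hc} => [[]//|N] a _ /=.
by rewrite mul2n -addnn leq_subLR => h; rewrite addnS ltnS.
Qed.

Lemma lagE N (a c : 'I_N) : (lag a).[c%:R] = (a == c)%:R.
Proof.
rewrite /lag horner_prod; have [<-|nac] := eqVneq a c.
  rewrite big1 // => b hb; rewrite !hornerE mulVf // subr_eq0 eqr_nat.
  by rewrite eq_sym.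
by rewrite (bigD1 c) 1?eq_sym //= !hornerE subrr mulr0 mul0r.
Qed.

(** Both sides have degree below N and agree at the N nodes. *)
Lemma lag_interp N k : (k < N)%N ->
  \sum_(a < N) (a%:R ^+ k) *: lag a = 'X^k.
Proof.
move=> hk; pose p : {poly K} := \sum_(a < N) (a%:R ^+ k) *: lag a - 'X^k.
pose rs : seq K := [seq (nat_of_ord a)%:R | a : 'I_N <- enum 'I_N].
suff h : p = 0 by apply/eqP; rewrite -subr_eq0; apply/eqP.
have h1 : all (root p) rs.
  apply/allP => _ /mapP[c _ ->]; rewrite rootE /p !hornerE horner_sum.
  rewrite (bigD1 c) //= hornerZ lagE eqxx mulr1 big1 ?addr0 ?subrr // => b hb.
  by rewrite hornerZ lagE (negPf hb) mulr0.
have h2 : uniq rs.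
  rewrite map_inj_uniq ?enum_uniq // => a b /eqP; rewrite eqr_nat => /eqP.
  exact: val_inj.
apply: (roots_geq_poly_eq0 h1 h2).
rewrite size_map size_enum_ord.
apply: leq_trans (size_polyD _ _) _; rewrite geq_max size_polyN size_polyXn hk andbT.
apply: leq_trans (size_sum _ _ _) _; apply/bigmax_leqP => a _.
by apply: leq_trans (size_scale_leq _ _) _; apply: size_lag.
Qed.

End Interpolation.

(** * Jets: expansions in s^b / b! *)

Section Weights.
Variable n : nat.
Implicit Types (s m : Zn n) (i j : 'I_n).

Lemma zcD s m j : zc (s + m) j = zc s j + zc m j.
Proof. by rewrite /zc mxE intrD. Qed.
Lemma zcN s j : zc (- s) j = - zc s j.
Proof. by rewrite /zc mxE intrN. Qed.
Lemma zcB s m j : zc (s - m) j = zc s j - zc m j.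
Proof. by rewrite zcD zcN. Qed.
Lemma zc0 j : zc (0 : Zn n) j = 0.
Proof. by rewrite /zc mxE. Qed.
Definition ei (i : 'I_n) : Zn n := delta_mx 0 i.
Lemma zcZei (x : int) i j : zc (x *: ei i) j = x%:~R * (j == i)%:R.
Proof. by rewrite /zc !mxE eqxx /= intrM; case: (j == i). Qed.
Lemma zc_inj s m : (forall j, zc s j = zc m j) -> s = m.
Proof. by move=> h; apply/rowP => j; apply: (@intr_inj C); apply: h. Qed.

End Weights.

Section Box.
Variable n : nat.
Implicit Types (s m : Zn n) (b c : mi n).

Definition inbox N b := [forall i, (b ord0 i < N)%N].

Lemma inboxP N b : reflect (forall i, (b ord0 i < N)%N) (inbox N b).
Proof. exact: forallP. Qed.

Lemma notinboxP N b : ~~ inbox N b -> exists i, (N <= b ord0 i)%N.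
Proof.
move=> h; apply/existsP; move: h; apply: contraR; rewrite negb_exists => /forallP h.
by apply/inboxP => i; rewrite ltnNge.
Qed.

Lemma inbox_bx N (b : {ffun 'I_n -> 'I_N}) : inbox N (bx b).
Proof. by apply/inboxP => i; rewrite mxE. Qed.

Lemma bx_inj N : injective (@bx n N).
Proof. by move=> b c /rowP h; apply/ffunP => i; apply: val_inj; have := h i; rewrite !mxE. Qed.

Lemma bx_surj N b : inbox N b -> exists b' : {ffun 'I_n -> 'I_N}, bx b' = b.
Proof.
move=> /inboxP h; exists [ffun i => Ordinal (h i)].
by apply/rowP => i; rewrite mxE ffunE.
Qed.

Lemma sum_bx (V : nmodType) N (F : mi n -> V) c :
  inbox N c \/ F c = 0 ->
  \sum_(b : {ffun 'I_n -> 'I_N} | bx b == c) F (bx b) = F c.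
Proof.
have [/bx_surj[c' <-] _|hc] := boolP (inbox N c).
  by rewrite (big_pred1 c') // => b; rewrite /= (inj_eq (@bx_inj N)).
case=> // ->; apply: big1 => b /eqP e; by rewrite -e inbox_bx in hc.
Qed.

Lemma coefsbE s b : coefsb s b = \prod_i (zc s i ^+ b 0 i / (b 0 i)`!%:R).
Proof. by rewrite prodf_div. Qed.

Lemma coefsb0 s : coefsb s 0 = 1.
Proof. by rewrite coefsbE big1 // => i _; rewrite mxE expr0 divr1. Qed.

Lemma coefsb_0 b : b != 0 -> coefsb (0 : Zn n) b = 0.
Proof.
move=> b0; have [i bi] : exists i, b 0 i != 0%N.
  apply/existsP; apply: contra_neqT b0; rewrite negb_exists => /forallP h.
  by apply/rowP => i; rewrite mxE; have := h i; rewrite negbK => /eqP.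
by rewrite coefsbE (bigD1 i) //= zc0 expr0n (negPf bi) mul0r mul0r.
Qed.

End Box.

Section Jets.
Variables (n : nat) (V : lmodType C).
Implicit Types (s m : Zn n) (b c : mi n) (F : Zn n -> V) (Y : mi n -> V).

Definition jet N Y s : V :=
  \sum_(b : {ffun 'I_n -> 'I_N}) coefsb s (bx b) *: Y (bx b).

Definition gridpt N (a : {ffun 'I_n -> 'I_N}) : Zn n := \row_i (a i : nat)%:Z.

Lemma zc_gridpt N (a : {ffun 'I_n -> 'I_N}) i : zc (gridpt a) i = (a i : nat)%:R.
Proof. by rewrite /zc mxE. Qed.

(* Recovers the coefficient of [coefsb s b] in a jet from its values on the grid [0, N)^n. *)
Definition jetcoef N F b : V :=
  \sum_(a : {ffun 'I_n -> 'I_N})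
    (\prod_i ((b 0 i)`!%:R * (lag C (a i))`_(b 0 i))) *: F (gridpt a).

Lemma jetcoef_out N F b : ~~ inbox N b -> jetcoef N F b = 0.
Proof.
move=> /notinboxP[i hi].
rewrite /jetcoef big1 // => a _; rewrite (bigD1 i) //=.
by rewrite nth_default ?mulr0 ?mul0r ?scale0r //; apply: leq_trans (size_lag _ _) hi.
Qed.

(** In the auxiliary claim only the coordinates from r on are required to lie in [0, N); going from
    r to r + 1 frees coordinate r by [diff_vanish] along the corresponding line. *)
Lemma vanish_grid N F :
  (forall i s x, iter N (@diff C V) (fun y => F (s + y *: ei i)) x = 0) ->
  (forall a : {ffun 'I_n -> 'I_N}, F (gridpt a) = 0) -> forall s, F s = 0.
Proof.
move=> hd hg s.
suff H r : forall s, (forall i : 'I_n, (r <= i)%N -> exists a : 'I_N, s 0 i = (a : nat)%:Z) -> F s = 0.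
  by apply: (H n) => i; rewrite leqNgt ltn_ord.
elim: r => [|r IH] {}s hs.
  have [u hu] := fin_all_exists (fun i => hs i (leq0n i)).
  rewrite -(hg [ffun i => u i]); congr F; apply/rowP => i.
  by rewrite mxE ffunE hu.
have [ltrn|lenr] := ltnP r n; last first.
  by apply: IH => i hi; have := leq_trans lenr hi; rewrite leqNgt ltn_ord.
pose i0 := Ordinal ltrn; pose s' := s - (s 0 i0) *: ei i0.
have -> : s = s' + (s 0 i0) *: ei i0 by rewrite subrK.
apply: (diff_vanish (hd i0 s')) => a ha.
apply: IH => i; rewrite leq_eqVlt => /predU1P[ri|ri].
  exists (Ordinal ha); rewrite /s' !mxE.
  have -> : i = i0 by apply: val_inj.
  by rewrite !eqxx !mulr1 subrr add0r.
have [b hb] := hs i ri; exists b; rewrite -hb /s' !mxE.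
have -> : (i == i0) = false by apply/negbTE; apply: contraTneq ri => ->; rewrite ltnn.
by rewrite andbF !mulr0 subr0 addr0.
Qed.

Lemma lag_expand N (a : {ffun 'I_n -> 'I_N}) s :
  \prod_i (lag C (a i)).[zc s i] =
  \sum_(b : {ffun 'I_n -> 'I_N}) \prod_i ((lag C (a i))`_(b i) * zc s i ^+ b i).
Proof.
rewrite -(bigA_distr_bigA (fun i (k : 'I_N) => (lag C (a i))`_k * zc s i ^+ k)).
by apply: eq_bigr => i _; rewrite -horner_coef_wide // size_lag.
Qed.

Lemma lag_gridpt N (a c : {ffun 'I_n -> 'I_N}) :
  \prod_i (lag C (a i)).[zc (gridpt c) i] = (a == c)%:R.
Proof.
have [<-|nac] := eqVneq a c.
  by rewrite big1 // => i _; rewrite zc_gridpt lagE eqxx.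
have [i hi] : exists i, a i != c i.
  apply/existsP; apply: contra_neqT nac; rewrite negb_exists => /forallP h.
  by apply/ffunP => i; have := h i; rewrite negbK => /eqP.
by rewrite (bigD1 i) //= zc_gridpt lagE (negPf hi) mul0r.
Qed.

(** Tensor-product Lagrange interpolation: F and its interpolant L both have vanishing N-th
    differences along each axis and agree on the grid. Expanding the Lagrange polynomials into
    monomials then gives the jet. *)
Lemma jet_jetcoef N F :
  (forall i s x, iter N (@diff C V) (fun y => F (s + y *: ei i)) x = 0) ->
  forall s, F s = jet N (jetcoef N F) s.
Proof.
move=> hF s.
pose L s := \sum_(a : {ffun 'I_n -> 'I_N}) \prod_i (lag C (a i)).[zc s i] *: F (gridpt a).
have -> : F s = L s.
  apply/eqP; rewrite -subr_eq0; apply/eqP.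
  apply: (@vanish_grid N (fun s => F s - L s)) => [i {}s x|c]; last first.
    rewrite /L (bigD1 c) //= lag_gridpt eqxx scale1r big1 ?addr0 ?subrr // => a hac.
    by rewrite lag_gridpt (negPf hac) scale0r.
  rewrite iter_diffB hF sub0r iter_diff_sum big1 ?oppr0 // => a _.
  (* The product of Lagrange polynomials restricted to the line through s parallel to axis i, as a
     polynomial in one variable. *)
  pose q : {poly C} := (\prod_(k | k != i) (lag C (a k)).[zc s k])
       *: (lag C (a i) \Po ('X + (zc s i)%:P)).
  rewrite -[RHS](@diff_poly C V N q (F (gridpt a)) _ x).
    congr (iter N _ _ x); apply/funext => y; congr (_ *: _).
    rewrite (bigD1 i) //= mulrC /q !hornerE horner_comp !hornerE.
    rewrite zcD zcZei eqxx mulr1 [y%:~R + _]addrC; congr (_ * _).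
    by apply: eq_bigr => k hk; rewrite zcD zcZei (negPf hk) mulr0 addr0.
  apply: leq_trans (size_scale_leq _ _) _.
  by rewrite size_comp_poly2 ?size_XaddC // size_lag.
rewrite /L /jet /jetcoef.
under eq_bigr do rewrite lag_expand scaler_suml.
rewrite exchange_big /=; apply: eq_bigr => b _.
rewrite scaler_sumr; apply: eq_bigr => a _; rewrite scalerA; congr (_ *: _).
rewrite coefsbE -big_split /=; apply: eq_bigr => i _; rewrite mxE.
have f0 : ((b i)`!%:R : C) != 0 by rewrite pnatr_eq0 -lt0n fact_gt0.
by field.
Qed.

(** The coefficients of the Lagrange polynomials form the inverse of the Vandermonde matrix of the
    nodes. *)
Lemma lag_coef_interp N k l : (l < N)%N ->
  \sum_(a < N) (lag C a)`_k * a%:R ^+ l = (k == l)%:R.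
Proof.
move=> hl; have /(congr1 (fun p : {poly C} => p`_k)) := @lag_interp C N l hl.
rewrite coef_sum coefXn => <-; apply: eq_bigr => a _; by rewrite coefZ mulrC.
Qed.

Lemma jetcoef_jet N Y b : inbox N b -> jetcoef N (jet N Y) b = Y b.
Proof.
move=> hb; rewrite /jetcoef /jet.
under eq_bigr do rewrite scaler_sumr.
rewrite exchange_big /= -(@sum_bx n V N Y b); last by left.
rewrite [RHS]big_mkcond /=; apply: eq_bigr => c _.
under eq_bigr do rewrite scalerA.
rewrite -scaler_suml.
have -> : \sum_(a : {ffun 'I_n -> 'I_N})
     (\prod_i ((b 0 i)`!%:R * (lag C (a i))`_(b 0 i))) * coefsb (gridpt a) (bx c)
   = (bx c == b)%:R.
  under eq_bigr do rewrite coefsbE -big_split /=.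
  transitivity (\prod_i \sum_(a < N) ((b 0 i)`!%:R * (lag C a)`_(b 0 i) *
       (a%:R ^+ (c i) / (c i)`!%:R))).
    rewrite bigA_distr_bigA; apply: eq_bigr => a _; apply: eq_bigr => i _.
    by rewrite zc_gridpt mxE.
  transitivity (\prod_i (b 0 i == c i)%:R : C).
    apply: eq_bigr => i _.
    transitivity ((b 0 i)`!%:R / (c i)`!%:R * \sum_(a < N) (lag C a)`_(b 0 i) * a%:R ^+ c i).
      by rewrite mulr_sumr; apply: eq_bigr => a _; ring.
    rewrite lag_coef_interp //; case: eqP => [->|_]; last by rewrite mulr0.
    by rewrite mulr1 mulfV // pnatr_eq0 -lt0n fact_gt0.
  case: eqVneq => [<-|ne]; first by rewrite big1 // => i _; rewrite mxE eqxx.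
  have [i hi] : exists i, b 0 i != c i.
    apply/existsP; apply: contra_neqT ne; rewrite negb_exists => /forallP h.
    by apply/rowP => i; rewrite mxE; have := h i; rewrite negbK => /eqP.
  by rewrite (bigD1 i) //= (negPf hi) mul0r.
by case: ifP; rewrite ?scale1r ?scale0r.
Qed.

(** The monomials are linearly independent as functions on Z^n; this allows coefficients to be
    compared, also when they are operators. *)
Lemma jet_inj N Y : (forall s, jet N Y s = 0) -> forall b, inbox N b -> Y b = 0.
Proof.
move=> h b hb; rewrite -(jetcoef_jet Y hb) /jetcoef big1 // => a _.
by rewrite h scaler0.
Qed.

Definition supported N Y := forall b, ~~ inbox N b -> Y b = 0.

Lemma supportedP N Y b : supported N Y -> inbox N b \/ Y b = 0.
Proof. by move=> h; case: (boolP (inbox N b)); [left|right; apply: h]. Qed.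

(** Makes the truncation bound immaterial, in particular in [Jjet]. *)
Lemma jet_widen N M Y s : (N <= M)%N -> supported N Y -> jet M Y s = jet N Y s.
Proof.
move=> le h; rewrite /jet.
under eq_bigr => c _ do rewrite -(sum_bx (supportedP (bx c) h)) scaler_sumr big_mkcond /=.
rewrite exchange_big /=; apply: eq_bigr => b _.
rewrite -big_mkcond /= -[RHS](sum_bx (N := M) (c := bx b) (F := fun c => coefsb s c *: Y c)).
  by apply: eq_big => [c|c /eqP ->]; rewrite // eq_sym.
left; apply/inboxP => i; apply: leq_trans le.
by rewrite mxE.
Qed.

(** Binomial theorem for divided powers. The sum over p + q = k is written over a square with a
    delta, so that the product over all coordinates can be expanded. *)
Lemma coefsb_add1 (x y : C) N k : (k < N)%N ->
  (x + y) ^+ k / k`!%:R =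
  \sum_(p < N) \sum_(q < N) (p + q == k)%N%:R * (x ^+ p / p`!%:R * (y ^+ q / q`!%:R)).
Proof.
move=> hk.
transitivity (\sum_(p < N | (p < k.+1)%N) (x ^+ p / p`!%:R * (y ^+ (k - p) / (k - p)`!%:R))).
  rewrite -(big_ord_widen _ (fun p => x ^+ p / p`!%:R * (y ^+ (k - p) / (k - p)`!%:R))) //.
  rewrite addrC exprDn mulr_suml; apply: eq_bigr => p _.
  have hp : (p <= k)%N by rewrite -ltnS.
  rewrite -mulr_natr; have /(congr1 (fun m : nat => m%:R : C)) := bin_fact hp.
  have f0 q : (q`!%:R : C) != 0 by rewrite pnatr_eq0 -lt0n fact_gt0.
  have c0 : ('C(k, p)%:R : C) != 0 by rewrite pnatr_eq0 -lt0n bin_gt0.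
  by rewrite !natrM => <-; field; rewrite c0 !f0.
rewrite big_mkcond /=; apply: eq_bigr => p _; rewrite ltnS.
case: leqP => hp; last first.
  rewrite big1 // => q _; case: eqP => [e|]; last by rewrite mul0r.
  by move: hp; rewrite -e ltnNge leq_addr.
have hq : (k - p < N)%N by apply: leq_ltn_trans hk; rewrite leq_subr.
rewrite (bigD1 (Ordinal hq)) //= subnKC // eqxx mul1r big1 ?addr0 // => q hne.
case: eqP => [e|]; last by rewrite mul0r.
by case/eqP: hne; apply: val_inj; rewrite /= -e addKn.
Qed.

Lemma coefsb_add s m N c : inbox N c ->
  coefsb (s + m) c = \sum_(a : {ffun 'I_n -> 'I_N}) \sum_(b : {ffun 'I_n -> 'I_N})
     (bx a + bx b == c)%:R * (coefsb s (bx a) * coefsb m (bx b)).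
Proof.
move=> /inboxP hc; rewrite coefsbE.
under eq_bigr => i _ do rewrite zcD (coefsb_add1 _ _ (hc i)).
rewrite bigA_distr_bigA; apply: eq_bigr => a _.
rewrite bigA_distr_bigA; apply: eq_bigr => b _.
rewrite !coefsbE big_split /= big_split /=.
congr (_ * (_ * _)); last 2 first.
- by apply: eq_bigr => i _; rewrite !mxE.
- by apply: eq_bigr => i _; rewrite !mxE.
case: eqVneq => [<-|ne]; first by rewrite big1 // => i _; rewrite !mxE eqxx.
have [i hi] : exists i, (a i + b i != c ord0 i)%N.
  apply/existsP; apply: contra_neqT ne; rewrite negb_exists => /forallP h.
  by apply/rowP => i; rewrite !mxE; have := h i; rewrite negbK => /eqP.
by rewrite (bigD1 i) //= (negPf hi) mul0r.
Qed.

(** A jet is an exponential generating function, so adding arguments amounts to adding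
    multi-indices. *)
Lemma jet_add N Y s m : supported N Y ->
  jet N Y (s + m) = jet N (fun a => jet N (fun b => Y (a + b)) m) s.
Proof.
move=> h; rewrite /jet.
under eq_bigr => c _ do rewrite (coefsb_add _ _ (inbox_bx c)) scaler_suml.
rewrite exchange_big; apply: eq_bigr => a _ /=.
rewrite scaler_sumr.
under eq_bigr => c _ do rewrite scaler_suml.
rewrite exchange_big; apply: eq_bigr => b _ /=.
rewrite -(sum_bx (supportedP (bx a + bx b) h)) !scaler_sumr [RHS]big_mkcond /=.
apply: eq_bigr => c _; rewrite eq_sym; case: ifP => _; last by rewrite mul0r scale0r.
by rewrite mul1r scalerA.
Qed.

(** b - epsilon_j with truncated subtraction: it equals b when b_j = 0. In the jet formulas such
    terms carry the factor b_j. *)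
Definition mpred b (j : 'I_n) : mi n := \row_i (b ord0 i - (i == j))%N.
Definition msucc b (j : 'I_n) : mi n := \row_i (b ord0 i + (i == j))%N.

Lemma msuccK b j : mpred (msucc b j) j = b.
Proof. by apply/rowP => i; rewrite !mxE addnK. Qed.
Lemma mpredK b j : b 0 j != 0%N -> msucc (mpred b j) j = b.
Proof.
move=> h; apply/rowP => i; rewrite !mxE subnK //.
by case: eqVneq => [->|]; rewrite ?lt0n.
Qed.

Lemma coefsb_succ s b j : zc s j * coefsb s b = (b 0 j).+1%:R * coefsb s (msucc b j).
Proof.
rewrite !coefsbE (bigD1 j) //= [in RHS](bigD1 j) //= !mxE eqxx addn1.
rewrite !mulrA; congr (_ * _).
  rewrite factS natrM invfM exprS !mulrA.
  have f0 : ((b 0 j).+1%:R : C) != 0 by rewrite pnatr_eq0.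
  have f1 : ((b 0 j)`!%:R : C) != 0 by rewrite pnatr_eq0 -lt0n fact_gt0.
  by field; rewrite f1 nat1r f0.
by apply: eq_bigr => i hi; rewrite mxE (negPf hi) addn0.
Qed.

(** Multiplication by m_j raises the exponent of m_j by one; the first hypothesis keeps the raised
    index inside the box, and this is why brackets are expanded in the box of side N + 1. *)
Lemma jet_shift N Y m j : (forall b, (N <= (b ord0 j).+1)%N -> Y b = 0) -> supported N Y ->
  zc m j *: jet N Y m = jet N (fun b => (b 0 j)%:R *: Y (mpred b j)) m.
Proof.
move=> hj h; rewrite /jet scaler_sumr.
under [RHS]eq_bigr => b _ do
  rewrite -(sum_bx (supportedP (mpred (bx b) j) h)) !scaler_sumr big_mkcond /=.
rewrite exchange_big /=; apply: eq_bigr => c _.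
have [hc|/hj ->] := ltnP (bx c 0 j).+1 N; last first.
  by rewrite !scaler0 big1 // => b _; rewrite !scaler0; case: ifP.
rewrite scalerA coefsb_succ.
have hb : inbox N (msucc (bx c) j).
  apply/inboxP => i; rewrite mxE; case: eqVneq => [->|_]; first by rewrite addn1.
  by rewrite addn0; apply/inboxP: i; apply: inbox_bx.
have [b0 e0] := bx_surj hb.
rewrite -e0 (bigD1 b0) //= e0 msuccK eqxx !scalerA big1 ?addr0.
  by rewrite [msucc _ _ _ _]mxE eqxx addn1 mulrC.
(* [mpred] determines its argument only when the j-th exponent is nonzero; when it is zero, the
   factor b_j kills the term. *)
move=> b hne; case: eqP => // e; rewrite [(bx b) 0 j]lock; case: (eqVneq (bx b 0 j) 0%N) => [|nz].
  by rewrite -lock => ->; rewrite scale0r scaler0.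
case/eqP: hne; apply: (@bx_inj n N); rewrite e0 e mpredK //.
Qed.

End Jets.

(** * Brackets along one coordinate *)

Section LinPred.
Variables X Y : lmodType C.

Definition mklin (f : X -> Y) (h : lin f) : {linear X -> Y} :=
  HB.pack f (GRing.isLinear.Build C X Y *:%R f h).

Lemma lin0 (f : X -> Y) : lin f -> f 0 = 0.
Proof. by move=> h; apply: (linear0 (mklin h)). Qed.
Lemma linD (f : X -> Y) : lin f -> forall x y, f (x + y) = f x + f y.
Proof. by move=> h; apply: (linearD (mklin h)). Qed.
Lemma linB (f : X -> Y) : lin f -> forall x y, f (x - y) = f x - f y.
Proof. by move=> h; apply: (linearB (mklin h)). Qed.
Lemma linN (f : X -> Y) : lin f -> forall x, f (- x) = - f x.
Proof. by move=> h; apply: (linearN (mklin h)). Qed.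
Lemma linZ (f : X -> Y) : lin f -> forall k x, f (k *: x) = k *: f x.
Proof. by move=> h k x; rewrite -[k *: x]addr0 h (lin0 h) addr0. Qed.
Lemma lin_sum (f : X -> Y) : lin f -> forall I (r : seq I) P F,
  f (\sum_(i <- r | P i) F i) = \sum_(i <- r | P i) f (F i).
Proof. by move=> h I r P F; apply: (linear_sum (mklin h)). Qed.
End LinPred.

Lemma natr_shift_notin (r : seq C) (mu : C) :
  exists N, forall k, (N <= k)%N -> mu + k%:R \notin r.
Proof.
elim: r => [|a r [N hN]]; first by exists 0%N.
have [[k0 e]|ne] := pselect (exists k0, mu + k0%:R = a).
  exists (maxn N k0.+1) => k; rewrite geq_max in_cons negb_or => /andP[h1 h2].
  rewrite hN // andbT; apply: contraTneq h2; rewrite -e => /addrI/eqP.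
  by rewrite eqr_nat => /eqP ->; rewrite ltnn.
exists N => k hk; rewrite in_cons negb_or hN // andbT.
by apply/eqP => e; apply: ne; exists k.
Qed.

(** The list consists of the roots of the characteristic polynomial of T in coordinates. C is
    algebraically closed, so this polynomial splits, and it has a root as soon as V is nonzero. *)
Lemma eig_exists (V : vectType C) (T : V -> V) : lin T ->
  exists r : seq C, (forall (a : C) v, v != 0 -> T v = a *: v -> a \in r) /\
                    (forall a, a \in r -> exists2 v, v != 0 & T v = a *: v) /\
                    ((exists v : V, v <> 0) -> r <> [::]).
Proof.
move=> hT; set d := dim V.
have hf : lin (fun u : 'rV[C]_d => v2r (T (@r2v _ V u)) : 'rV[C]_d).
  by move=> k x y; rewrite !(linearP, hT).
pose A := lin1_mx (mklin hf).
have hA u : u *m A = v2r (T (@r2v _ V u)) by rewrite mul_rV_lin1.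
have [r hr] := closed_field_poly_normal (char_poly A).
have hroot a : root (char_poly A) a = (a \in r).
  rewrite hr rootZ; last by rewrite lead_coef_eq0 monic_neq0 ?char_poly_monic.
  by rewrite root_prod_XsubC.
exists r; split; [|split].
- move=> a v v0 e; rewrite -hroot -eigenvalue_root_char.
  apply/eigenvalueP; exists (v2r v); first by rewrite hA v2rK e linearZ.
  by apply: contraNneq v0 => h0; rewrite -[v]v2rK h0 linear0.
- move=> a; rewrite -hroot -eigenvalue_root_char => /eigenvalueP[u e u0].
  exists (@r2v _ V u); first by apply: contraNneq u0 => h; rewrite -[u](@r2vK _ V) h linear0.
  by apply: (can_inj v2rK); rewrite -hA e linearZ /= (@r2vK _ V).
- move=> [v v0] r0; have d0 : (0 < d)%N.
    rewrite lt0n; apply/eqP => d0; apply: v0; rewrite -[v]v2rK.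
    have -> : v2r v = 0 by apply/rowP => -[i hi]; exfalso; move: hi; rewrite -/d d0.
    by rewrite linear0.
  have := size_char_poly A; rewrite hr r0 big_nil.
  rewrite (monicP (char_poly_monic A)) scale1r size_poly1 => -[h].
  by rewrite -h in d0.
Qed.

(** The point where finite dimension enters: a finite spectrum contains mu + k for only finitely
    many k. *)
Lemma fin_eig (V : vectType C) (T : V -> V) (mu : C) : lin T ->
  exists N, forall k, (N <= k)%N -> forall v, T v = (mu + k%:R) *: v -> v = 0.
Proof.
move=> /eig_exists[r [h _]]; have [N hN] := natr_shift_notin r mu.
exists N => k hk v e; apply/eqP; apply: contraT => v0.
by have := hN k hk; rewrite (h _ v v0 e).
Qed.

Section Phi.
Variable V : lmodType C.
Implicit Types (f : int -> V) (p q : {poly C}).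

(** The linear map sending X^l to f l. Multiplication by X becomes the shift of f, and hence
    multiplication by X - 1 the forward difference. *)
Definition phi f q : V := \sum_(l < size q) q`_l *: f (l : nat)%:Z.

Lemma phi_widen f q N : (size q <= N)%N -> phi f q = \sum_(l < N) q`_l *: f (l : nat)%:Z.
Proof.
move=> h; rewrite /phi (big_ord_widen _ (fun l : nat => q`_l *: f l%:Z) h) big_mkcond.
apply: eq_bigr => l _; case: ltnP => // hl.
by rewrite nth_default // scale0r.
Qed.

Lemma phi_lin f : lin (phi f).
Proof.
move=> k x y; set N := maxn (size x) (maxn (size y) (size (k *: x + y))).
rewrite !(@phi_widen _ _ N) /N ?leq_max ?leqnn ?orbT //.
rewrite scaler_sumr -big_split; apply: eq_bigr => l _ /=.
by rewrite coefD coefZ scalerDl scalerA.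
Qed.

Lemma phi_Xn f k : phi f 'X^k = f k%:Z.
Proof.
rewrite /phi size_polyXn (bigD1 ord_max) //= coefXn eqxx scale1r big1 ?addr0 // => l hl.
by rewrite coefXn -[_ == k]/(l == ord_max) (negPf hl) scale0r.
Qed.

Lemma lin_poly_eq (f g : {poly C} -> V) : lin f -> lin g ->
  (forall k, f 'X^k = g 'X^k) -> forall q, f q = g q.
Proof.
move=> hf hg h q; rewrite -[q]coefK poly_def !(lin_sum hf, lin_sum hg).
by apply: eq_bigr => i _; rewrite (linZ hf) (linZ hg) h.
Qed.

Lemma phi_XM f q : phi f ('X * q) = phi (fun l => f (l + 1)) q.
Proof.
move: q; apply: lin_poly_eq; [|exact: phi_lin|].
  by move=> k x y; rewrite mulrDr -scalerAr phi_lin.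
by move=> k; rewrite -exprS !phi_Xn -addn1 PoszD.
Qed.

Lemma phi_diff f N x : phi (fun l => f (l + x)) (('X - 1) ^+ N) = iter N (@diff C V) f x.
Proof.
elim: N x => [|N IH] x; first by rewrite expr0 -(expr0 ('X : {poly C})) phi_Xn add0r.
rewrite exprS mulrBl mul1r (linB (phi_lin _)) phi_XM.
have -> : (fun l => f (l + 1 + x)) = (fun l => f (l + (x + 1))).
  by apply/funext => l; rewrite -addrA [1 + x]addrC.
by rewrite !IH.
Qed.

End Phi.

Section Bracket.
Variables (n : nat) (V : lmodType C) (B : V -> V -> V).
Hypotheses (Bl : forall a, lin (B a)) (Br : forall b, lin (B^~ b)).
Variables (i : 'I_n) (d : Zn n -> V).

(* The image of q(x_i) x^m under the linear extension of [h]. *)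
Definition along (h : Zn n -> V) (m : Zn n) q := phi (fun l => h (m + l *: ei i)) q.

Lemma along_lin h m : lin (along h m). Proof. exact: phi_lin. Qed.

Lemma along_XM h m q : along h m ('X * q) = along h (m + ei i) q.
Proof.
rewrite /along phi_XM; congr phi; apply/funext => l.
by rewrite scalerDl scale1r addrA addrAC.
Qed.

(* [th] is 1 for [h = d] and 0 for the fields in the other directions and for the currents. *)
Definition brel (h : Zn n -> V) (th : C) := forall (x : int) m,
  B (d (x *: ei i)) (h m) = zc m i *: (h (x *: ei i + m) - h m)
     - (x%:~R * th) *: (d (x *: ei i + m) - d (x *: ei i)).

(* The bracket of the vector fields p(x_i) d/dx_i and q(x_i) x^m x_j d/dx_j, corrected so as to
   vanish at the point 1 of the torus. *)
Lemma bracket_along h th : brel h th -> forall p q m,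
  B (along d (- ei i) p) (along h m q) =
   along h (m - ei i) (p * ((zc m i)%:P * q + 'X * q^`()))
   - p.[1] *: along h m ((zc m i)%:P * q + 'X * q^`())
   - th *: (along d (m - ei i) (q * ('X * p^`() - p))
            - q.[1] *: along d (- ei i) ('X * p^`() - p)).
Proof.
(* Both sides are linear in p and in q, so it is enough to treat the monomials X^a and X^b, where
   the identity is [brel] itself. *)
move=> R p q m; move: p.
apply: lin_poly_eq => [k x y|k x y|a].
- by rewrite along_lin Br.
- have -> : 'X * (k *: x + y)^`() - (k *: x + y) =
      k *: ('X * x^`() - x) + ('X * y^`() - y).
    by rewrite derivD derivZ -!mul_polyC; ring.
  move: (_ * q + _) ('X * x^`() - x) ('X * y^`() - y) => A x1 y1.
  rewrite mulrDl mulrDr -scalerAl -scalerAr hornerD hornerZ !along_lin.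
  move: (along h _ (x * A)) (along h _ (y * A)) (along d _ (q * x1)) (along d _ (q * y1)) => ????.
  by lmod_over C.
move: q; apply: lin_poly_eq => [k x y|k x y|b].
- by rewrite along_lin Bl.
- have -> : (zc m i)%:P * (k *: x + y) + 'X * (k *: x + y)^`() =
     k *: ((zc m i)%:P * x + 'X * x^`()) + ((zc m i)%:P * y + 'X * y^`()).
    by rewrite derivD derivZ -!mul_polyC; ring.
  move: ((zc m i)%:P * x + _) ((zc m i)%:P * y + _) (_ - 'X^a) => x1 y1 A.
  rewrite mulrDl mulrDr -scalerAl -scalerAr hornerD hornerZ !along_lin.
  move: (along h _ ('X^a * x1)) (along h _ ('X^a * y1)) (along d _ (x * A)) (along d _ (y * A)) => ????.
  by lmod_over C.
have XD k : 'X * ('X^k)^`() = k%:R *: 'X^k :> {poly C}.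
  by rewrite derivXn; case: k => [|k]; rewrite ?mulr0n ?mulr0 ?scale0r // scaler_nat mulrnAr -exprS.
have -> : (zc m i)%:P * 'X^b + 'X * ('X^b)^`() = (zc m i + b%:R) *: 'X^b.
  by rewrite XD mul_polyC scalerDl.
have -> : 'X * ('X^a)^`() - 'X^a = (a%:R - 1) *: 'X^a :> {poly C}.
  by rewrite XD scalerBl scale1r.
rewrite -!scalerAr -!exprD !(linZ (along_lin _ _)) !hornerXn !expr1n.
rewrite /along !phi_Xn.
(* The base point [- ei i] makes X^a stand for x_i^a d/dx_i, which is x_i^(a-1) times x_i d/dx_i. *)
have -> : - ei i + a%:Z *: ei i = (a%:Z - 1) *: ei i by rewrite scalerBl scale1r addrC.
rewrite R zcD zcZei eqxx mulr1 intrD.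
have -> : (a%:Z - 1) *: ei i + (m + b%:Z *: ei i) = m - ei i + (a + b)%N%:Z *: ei i.
  by rewrite PoszD !scalerDl scaleN1r; lmod_over int.
rewrite [(b + a)%N]addnC mulrN1z -!pmulrn.
by lmod_over C.
Qed.

(** With p(1) = q(1) = 0 the correction terms drop out and the plain bracket of vector fields
    remains. *)
Lemma bracket_along0 h th : brel h th -> forall p q m, p.[1] = 0 -> q.[1] = 0 ->
  B (along d (- ei i) p) (along h m q) =
   along h (m - ei i) (p * ((zc m i)%:P * q + 'X * q^`()))
   - th *: along d (m - ei i) (q * ('X * p^`() - p)).
Proof.
move=> R p q m hp hq; rewrite (bracket_along R) hp hq.
move: (along _ _ _) (along _ _ _) (along _ _ _) (along _ _ _) => a1 a2 a3 a4.
by rewrite !scale0r !subr0.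
Qed.

Local Notation t := ('X - 1 : {poly C}).

Lemma horner_expXB1 k : (0 < k)%N -> (t ^+ k).[1] = 0.
Proof. by case: k => // k _; rewrite exprS hornerM hornerD hornerN hornerX hornerC subrr mul0r. Qed.

Lemma deriv_expXB1 k : (t ^+ k)^`() = k%:R * t ^+ k.-1.
Proof. by rewrite deriv_exp derivB derivX derivC subr0 mul1r mulr_natl. Qed.

Lemma deriv_XB1 : t^`() = 1.
Proof. by rewrite derivB derivX derivC subr0. Qed.

(** The two products are the [h]-components of the brackets for the pairs (t^N, t^2) and (t^(N+1),
    t); the terms with c cancel, so the difference does not depend on the base point. *)
Lemma shift_identity_l N c : 'X * t ^+ N.+1 =
  t ^+ N * (c * t ^+ 2 + 'X * (t ^+ 2)^`()) - t ^+ N.+1 * (c * t + 'X * t^`()).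
Proof. by rewrite deriv_expXB1 deriv_XB1 /=; move: t => u; rewrite exprS; ring. Qed.

(** The same two pairs in the [d]-component. Both components give X t^(N+1), so that a single
    unknown vector is left when h = d. *)
Lemma shift_identity_r N : (0 < N)%N -> 'X * t ^+ N.+1 =
  t * ('X * (t ^+ N.+1)^`() - t ^+ N.+1) - t ^+ 2 * ('X * (t ^+ N)^`() - t ^+ N).
Proof.
case: N => // N _; rewrite !deriv_expXB1 /= -[N.+2%:R]natr1 !exprS expr0.
by move: t (N.+1%:R) => u c; move: (u ^+ N) => w; ring.
Qed.

(** The bracket of t d/dx and t^k d/dx is (k - 1) t^k d/dx. The factor X on the right compensates
    the base point -2 e_i produced by [bracket_along0]. *)
Lemma eigen_identity k : (0 < k)%N ->
  t * ((-1)%:P * t ^+ k + 'X * (t ^+ k)^`()) - t ^+ k * ('X * t^`() - t)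
  = 'X * ((-1 + k%:R) *: t ^+ k).
Proof.
case: k => // k _; rewrite deriv_expXB1 deriv_XB1 /= -mul_polyC polyCD polyCN polyCMn polyC1 exprS.
by move: t (k.+1%:R) => u c; move: (u ^+ k) => w; ring.
Qed.

Lemma eigen_along k : brel d 1 -> (0 < k)%N ->
  B (along d (- ei i) t) (along d (- ei i) (t ^+ k)) = (-1 + k%:R) *: along d (- ei i) (t ^+ k).
Proof.
move=> R k0; rewrite (bracket_along0 R _ (horner_expXB1 (isT : 0 < 1)%N) (horner_expXB1 k0)) scale1r.
rewrite -(linB (along_lin _ _)) -(linZ (along_lin _ _)).
have -> : zc (- ei i) i = -1.
  by rewrite zcN -[ei i]scale1r zcZei eqxx mulr1.
by rewrite eigen_identity // along_XM addrNK.
Qed.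

(* For p = t^k, q = t^2 and p = t^(k+1), q = t, the difference of the two brackets is 1 + th times
   the image of X t^(k+1). *)
Lemma along_vanish h th N : brel d 1 -> brel h th -> th = 0 \/ (h = d /\ th = 1) -> (0 < N)%N ->
  (forall k, (N <= k)%N -> along d (- ei i) (t ^+ k) = 0) ->
  forall m, along h m (t ^+ N.+1) = 0.
Proof.
move=> Rd R th0 N0 hN m.
have B0 x : B 0 x = 0 by exact: (lin0 (Br x)).
have e1 := bracket_along0 R m (horner_expXB1 N0) (horner_expXB1 (isT : 0 < 2)%N).
have e2 := bracket_along0 R m (horner_expXB1 (ltn0Sn N)) (horner_expXB1 (isT : 0 < 1)%N).
rewrite hN // B0 in e1; rewrite hN // B0 in e2.
pose p : {poly C} := 'X * t ^+ N.+1.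
have {e1 e2} e : along h (m - ei i) p + th *: along d (m - ei i) p = 0.
  rewrite {1}/p (shift_identity_l N (zc m i)%:P) (linB (along_lin _ _)) /p (shift_identity_r N0) (linB (along_lin _ _)).
  move: e1 e2; move: (along h _ _) (along h _ _) (along d _ _) (along d _ _) => a1 a2 a3 a4 e1 e2.
  have -> : a2 - a1 + th *: (a3 - a4) = (a2 - th *: a4) - (a1 - th *: a3) by lmod_over C.
  by rewrite -e1 -e2 subrr.
have {}e : along h (m - ei i) p = 0.
  case: th0 => [z|[hd z]]; move: e; rewrite z ?hd; first by rewrite scale0r addr0.
  rewrite scale1r -mulr2n -scaler_nat => /eqP; rewrite scaler_eq0 pnatr_eq0 /= => /eqP //.
by rewrite -[m](subrK (ei i)) -along_XM.
Qed.

End Bracket.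

(** * Polynomiality in s and the relations of g^+ *)

Section Com.
Variable U : vectType C.
Implicit Types A B : 'End(U).

Definition com A B : 'End(U) := (A \o B)%VF - (B \o A)%VF.

Lemma comE A B v : com A B v = A (B v) - B (A v).
Proof. by rewrite /com add_lfunE opp_lfunE !comp_lfunE. Qed.

Lemma com_linr A : lin (com A).
Proof.
move=> k x y; apply/lfunP => v.
rewrite !(comE, add_lfunE, scale_lfunE) linearD linearZ /=; lmod_over C.
Qed.

Lemma com_linl B : lin (com^~ B).
Proof.
move=> k x y; apply/lfunP => v.
rewrite !(comE, add_lfunE, scale_lfunE) linearD linearZ /=; lmod_over C.
Qed.

End Com.

Section JetRel.
Variables (n : nat) (L : vectType C) (br : L -> L -> L) (U : vectType C).
Implicit Types (Dc : 'I_n -> Zn n -> 'End(U)) (Gc : Zn n -> L -> 'End(U)).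

(* The relations satisfied on a weight space by the operators e_(-s) d_j(s) and e_(-s) (e_s a). *)
Definition jetrel Dc Gc : Prop :=
  [/\ forall s k a b, Gc s (k *: a + b) = k *: Gc s a + Gc s b,
      forall j k s m, com (Dc j s) (Dc k m) =
        zc m j *: (Dc k (s + m) - Dc k m) - zc s k *: (Dc j (s + m) - Dc j s),
      forall j s m a, com (Dc j s) (Gc m a) = zc m j *: (Gc (s + m) a - Gc m a)
    & forall s m a b, com (Gc s a) (Gc m b) = Gc (s + m) (br a b)].

Definition finite_order N (V : lmodType C) (F : Zn n -> V) :=
  forall i s x, iter N (@diff C V) (fun y => F (s + y *: ei i)) x = 0.

Lemma jetrel_finite_order Dc Gc : jetrel Dc Gc ->
  exists2 N, (0 < N)%N & (forall j, finite_order N (Dc j)) /\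
                         (forall a, finite_order N (Gc^~ a)).
Proof.
case=> _ R1 R2 _.
have Hi (i : 'I_n) : exists N, forall s x,
   (forall j, iter N (@diff C _) (fun y => Dc j (s + y *: ei i)) x = 0) /\
   (forall a, iter N (@diff C _) (fun y => Gc (s + y *: ei i) a) x = 0).
  (* Eigenvalues of the form -1 + k, because t d/dx_i acts on t^k d/dx_i by k - 1. *)
  have [N hN] := fin_eig (-1) (com_linr (along i (Dc i) (- ei i) ('X - 1))).
  have RD j : brel (@com U) i (Dc i) (Dc j) (j == i)%:R.
    by move=> x m; rewrite R1 zcZei.
  have RG a : brel (@com U) i (Dc i) (Gc^~ a) 0.
    by move=> x m; rewrite R2 mulr0 scale0r subr0.
  have Rd : brel (@com U) i (Dc i) (Dc i) 1 by have := RD i; rewrite eqxx.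
  have al0 h s x q : along i h (s + x *: ei i) q
      = phi (fun l => h (s + (l + x) *: ei i)) q.
    by congr phi; apply/funext => l; rewrite scalerDl addrA addrAC.
  have hN' k : (maxn N 1 <= k)%N -> along i (Dc i) (- ei i) (('X - 1) ^+ k) = 0.
    rewrite geq_max => /andP[h1 h2]; apply: (hN _ h1).
    exact: (eigen_along (@com_linr U) (@com_linl U) Rd h2).
  have V h th := @along_vanish n _ _ (@com_linr U) (@com_linl U) i (Dc i) h th (maxn N 1) Rd.
  have m1 : (0 < maxn N 1)%N by rewrite leq_max orbT.
  exists (maxn N 1).+1 => s x; split=> [j|a].
    rewrite -(phi_diff (fun y => Dc j (s + y *: ei i))) -al0.
    apply: (V _ _ (RD j)) => //; case: eqP => [->|_]; [by right|by left].
  rewrite -(phi_diff (fun y => Gc (s + y *: ei i) a)) -(al0 _ (Gc^~ a)).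
  by apply: (V _ _ (RG a)) => //; left.
have [f hf] := fin_all_exists Hi.
exists (\max_i f i).+1 => //; split=> [j|a] i s x.
  apply: (iter_diff_le (N := f i)); last by move=> z; have [] := hf i s z.
  by apply: leqW; apply: leq_bigmax.
apply: (iter_diff_le (N := f i)); last by move=> z; have [] := hf i s z.
by apply: leqW; apply: leq_bigmax.
Qed.

End JetRel.

(** * Jets in two variables and comparison of coefficients *)

Section DoubleJets.
Variables (n : nat) (V : lmodType C).
Implicit Types (s m : Zn n) (a b c : mi n) (Y : mi n -> V) (Z : mi n -> mi n -> V).

Definition jet2 K Z s m := jet K (fun a => jet K (Z a) m) s.

Lemma eq_jet K Y Y' s : (forall b, inbox K b -> Y b = Y' b) -> jet K Y s = jet K Y' s.
Proof. by move=> h; apply: eq_bigr => b _; rewrite h // inbox_bx. Qed.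

Lemma eq_jet2 K Z Z' s m : (forall a b, inbox K a -> inbox K b -> Z a b = Z' a b) ->
  jet2 K Z s m = jet2 K Z' s m.
Proof. by move=> h; apply: eq_jet => a ha; apply: eq_jet => b hb; apply: h. Qed.

Lemma jetB K Y Y' s : jet K (fun b => Y b - Y' b) s = jet K Y s - jet K Y' s.
Proof. by rewrite /jet -sumrB; apply: eq_bigr => b _; rewrite scalerBr. Qed.

Lemma jetZ K k Y s : jet K (fun b => k *: Y b) s = k *: jet K Y s.
Proof. by rewrite /jet scaler_sumr; apply: eq_bigr => b _; rewrite !scalerA mulrC. Qed.

Lemma jet2B K Z Z' s m : jet2 K (fun a b => Z a b - Z' a b) s m = jet2 K Z s m - jet2 K Z' s m.
Proof. by rewrite /jet2 -jetB; apply: eq_jet => a _; rewrite jetB. Qed.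

Lemma jet2C K Z s m : jet2 K (fun a b => Z b a) m s = jet2 K Z s m.
Proof.
rewrite /jet2 /jet; under eq_bigr do rewrite scaler_sumr.
rewrite exchange_big; apply: eq_bigr => a _; rewrite scaler_sumr.
by apply: eq_bigr => b _; rewrite !scalerA mulrC.
Qed.

Lemma jet2_inj K Z : (forall s m, jet2 K Z s m = 0) ->
  forall a b, inbox K a -> inbox K b -> Z a b = 0.
Proof.
move=> h a b ha hb; apply: (@jet_inj _ _ K (Z a) _ b hb) => m.
exact: (@jet_inj _ _ K (fun a => jet K (Z a) m) (fun s => h s m) a ha).
Qed.

Lemma jet_at0 K Y : (0 < K)%N -> jet K Y 0 = Y 0.
Proof.
move=> K0; rewrite -[RHS](@sum_bx n V K Y 0); last first.
  by left; apply/inboxP => i; rewrite mxE.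
rewrite [RHS]big_mkcond; apply: eq_bigr => b _.
by case: eqVneq => [->|/coefsb_0 ->]; rewrite ?coefsb0 ?scale1r ?scale0r.
Qed.

Lemma mpred_addr a b j : b 0 j != 0%N -> a + mpred b j = mpred (a + b) j.
Proof.
move=> h; apply/rowP => i; rewrite !mxE; apply: addnBA.
by case: eqVneq => [->|]; rewrite ?lt0n.
Qed.

Lemma supported_add N Y a : supported N Y -> supported N (fun b => Y (a + b)).
Proof.
move=> h b /notinboxP[i hi]; apply: h; apply/negP => /inboxP/(_ i).
by rewrite mxE ltnNge (leq_trans hi (leq_addl _ _)).
Qed.

(** A function of m alone, seen as a double jet concentrated at a = 0. *)
Lemma jet2_const K Y s m : (0 < K)%N ->
  jet2 K (fun a b => (a == 0)%:R *: Y b) s m = jet K Y m.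
Proof.
move=> K0; rewrite /jet2.
under [jet _ _ s]eq_bigr => a _ do rewrite jetZ scalerA.
rewrite -scaler_suml.
have -> : \sum_(i : {ffun 'I_n -> 'I_K}) coefsb s (bx i) * (bx i == 0)%:R = 1.
  transitivity (coefsb s (0 : mi n)); last exact: coefsb0.
  rewrite -(@sum_bx n C K (coefsb s) 0).
    by rewrite [RHS]big_mkcond; apply: eq_bigr => b _ /=; case: eqP => _; rewrite ?mulr1 ?mulr0.
  by left; apply/inboxP => i; rewrite mxE.
by rewrite scale1r.
Qed.

(** Subtracting the value at m removes the terms with a = 0, and the factor m_j lowers an index:
    this is where the condition alpha <> 0 of W_n^+ and the index alpha + beta - epsilon_j come
    from. *)
Lemma jet_shift_add N Y s m j : supported N Y ->
  zc m j *: (jet N Y (s + m) - jet N Y m) =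
  jet2 N.+1 (fun a b => (a != 0)%:R *: ((b 0 j)%:R *: Y (mpred (a + b) j))) s m.
Proof.
move=> h; rewrite -!(jet_widen _ (leqnSn N) h).
have h1 : supported N.+1 Y.
  by move=> b /notinboxP[i hi]; apply: h; apply/negP => /inboxP/(_ i); rewrite ltnNge ltnW.
rewrite jet_add // -/(jet2 _ (fun a b => Y (a + b)) s m) -(@jet2_const _ _ s m (ltn0Sn N)).
rewrite -jet2B -jetZ; apply: eq_jet => a _.
have -> : (fun b => Y (a + b) - (a == 0)%:R *: Y b) = (fun b => (a != 0)%:R *: Y (a + b)).
  apply/funext => b; case: eqVneq => [->|_]; first by rewrite add0r scale1r scale0r subrr.
  by rewrite scale0r scale1r subr0.
rewrite !jetZ scalerA mulrC -scalerA; congr (_ *: _).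
rewrite jet_shift; last 2 first.
- move=> b hb; apply: h; apply/negP => /inboxP/(_ j).
  by rewrite mxE ltnNge (leq_trans _ (leq_addl _ _)).
- exact: supported_add.
apply: eq_jet => b _; have [->|nz] := eqVneq (b 0 j) 0%N; first by rewrite !scale0r.
by rewrite mpred_addr.
Qed.

End DoubleJets.

Lemma jet2_bilin n (V W : lmodType C) (B : V -> V -> W) K (Y Y' : mi n -> V) s m :
  (forall a, lin (B a)) -> (forall b, lin (B^~ b)) ->
  B (jet K Y s) (jet K Y' m) = jet2 K (fun a b => B (Y a) (Y' b)) s m.
Proof.
move=> h1 h2; rewrite {1}/jet (lin_sum (h2 _)); apply: eq_bigr => a _.
rewrite (linZ (h2 _)) {1}/jet (lin_sum (h1 _)); congr (_ *: _); apply: eq_bigr => b _.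
by rewrite (linZ (h1 _)).
Qed.

(** * The relations of g^+ against the relations between jets *)

Section GpJet.
Variables (n : nat) (L : vectType C) (br : L -> L -> L).
Implicit Types (U : gpmod n L).

(* [gpP U 0 j] is not constrained by [is_gpmod]; it is replaced by 0. *)
Definition gpP0 U (j : 'I_n) (b : mi n) : 'End(gpcar U) := if b == 0 then 0 else gpP U b j.

Lemma jetDE U N j s : jetD U N j s = jet N (gpP0 U j) s.
Proof.
rewrite /jetD big_mkcond; apply: eq_bigr => b _; rewrite /gpP0.
by case: eqP => _ //=; rewrite scaler0.
Qed.

Lemma jetGE U N s x : jetG U N s x = jet N (fun b => gpQ U b x) s.
Proof. by []. Qed.

Lemma supp_P U N j : gp_vanish U N -> supported N (gpP0 U j).
Proof. by case=> h _ b /notinboxP hb; rewrite /gpP0 h //; case: ifP. Qed.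

Lemma supp_Q U N x : gp_vanish U N -> supported N (fun b => gpQ U b x).
Proof. by case=> _ h b /notinboxP hb; rewrite h. Qed.

Lemma mshiftE (a b : mi n) j : mshift a b j = mpred (a + b) j.
Proof. by apply/rowP => i; rewrite !mxE. Qed.

(** The degree of a + b is at least 2 and one exponent drops by at most one; hence brackets in W_n^+
    never reach the unconstrained [gpP U 0]. *)
Lemma mshift_neq0 (a b : mi n) j : a != 0 -> b != 0 -> mpred (a + b) j != 0.
Proof.
have nz (c : mi n) : c != 0 -> exists i, c 0 i != 0%N.
  move=> c0; apply/existsP; apply: contra_neqT c0; rewrite negb_exists => /forallP h.
  by apply/rowP => i; rewrite mxE; have := h i; rewrite negbK => /eqP.
move=> /nz[i hi] /nz[i' hi']; apply/eqP => /rowP h.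
have le l : (a ord0 l + b ord0 l <= (l == j))%N.
  by rewrite -subn_eq0; have := h l; rewrite !mxE => ->.
have eij : i = j.
  by apply/eqP; have := le i; case: (i == j) => //; rewrite leqn0 addn_eq0 (negPf hi).
have eij' : i' = j.
  by apply/eqP; have := le i'; case: (i' == j) => //; rewrite leqn0 addn_eq0 (negPf hi') andbF.
have := le j; rewrite eqxx -{1}eij -eij' /=.
move: hi hi'; rewrite eij eij'; case: (a 0 j) => // x _; case: (b 0 j) => // y _.
by rewrite addnS.
Qed.

Lemma com_jet U N j k s m : gp_vanish U N ->
  com (jetD U N j s) (jetD U N k m) =
  jet2 N.+1 (fun a b => com (gpP0 U j a) (gpP0 U k b)) s m.
Proof.
move=> hv; rewrite !jetDE -!(jet_widen _ (leqnSn N) (supp_P _ hv)).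
exact: (jet2_bilin _ _ _ _ _ (@com_linr _) (@com_linl _)).
Qed.

Lemma com_jetDG U N j s m x : gp_vanish U N ->
  com (jetD U N j s) (jetG U N m x) =
  jet2 N.+1 (fun a b => com (gpP0 U j a) (gpQ U b x)) s m.
Proof.
move=> hv; rewrite jetDE jetGE -(jet_widen _ (leqnSn N) (supp_P _ hv)).
rewrite -(jet_widen _ (leqnSn N) (supp_Q _ hv)).
exact: (jet2_bilin _ _ _ _ _ (@com_linr _) (@com_linl _)).
Qed.

Lemma com_jetG U N s m x y : gp_vanish U N ->
  com (jetG U N s x) (jetG U N m y) = jet2 N (fun a b => com (gpQ U a x) (gpQ U b y)) s m.
Proof. by move=> hv; exact: (jet2_bilin _ _ _ _ _ (@com_linr _) (@com_linl _)). Qed.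

(** Lowering one exponent by one leaves an index with an exponent at least N, outside the
    support. *)
Lemma supported_pred (V : lmodType C) N (Y : mi n -> V) a b j : supported N Y ->
  ~~ inbox N.+1 a \/ ~~ inbox N.+1 b -> Y (mpred (a + b) j) = 0.
Proof.
move=> h hab; apply: h; apply/negP => /inboxP h.
case: hab => /notinboxP[i hi]; have := h i; rewrite !mxE ltnNge; move/negP; apply.
  rewrite leq_subRL; last by apply: leq_trans (leq_trans hi (leq_addr _ _)); case: (i == j).
  by apply: leq_trans (leq_trans hi (leq_addr _ _)); case: (i == j) => //=; apply: leqnSn.
rewrite leq_subRL; last by apply: leq_trans (leq_trans hi (leq_addl _ _)); case: (i == j).
by apply: leq_trans (leq_trans hi (leq_addl _ _)); case: (i == j) => //=; apply: leqnSn.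
Qed.

Lemma gpP0_out U N K j a : gp_vanish U N -> (N <= K)%N -> ~~ inbox K a ->
  gpP0 U j a = 0.
Proof.
move=> hv le /notinboxP[i hi]; apply: (supp_P _ hv); apply/negP => /inboxP/(_ i).
by rewrite ltnNge (leq_trans le).
Qed.

(** Both sides of the relation between jets are double jets in (s, m), so inside the enlarged box
    the two relations agree coefficient by coefficient, and outside it all terms vanish. *)
Lemma gp_relDP U N : gp_vanish U N ->
  (forall a b j k v, a != 0 -> b != 0 ->
     gpP U a j (gpP U b k v) - gpP U b k (gpP U a j v)
     = (b 0 j)%:R *: gpP U (mshift a b j) k v - (a 0 k)%:R *: gpP U (mshift a b k) j v) <->
  (forall j k s m, com (jetD U N j s) (jetD U N k m) =
     zc m j *: (jetD U N k (s + m) - jetD U N k m)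
     - zc s k *: (jetD U N j (s + m) - jetD U N j s)).
Proof.
move=> hv.
pose X j k a b := com (gpP0 U j a) (gpP0 U k b).
pose Z j k (a b : mi n) := (a != 0)%:R *: ((b 0 j)%:R *: gpP0 U k (mpred (a + b) j))
     - (b != 0)%:R *: ((a 0 k)%:R *: gpP0 U j (mpred (a + b) k)).
have eZ j k s m : zc m j *: (jetD U N k (s + m) - jetD U N k m)
     - zc s k *: (jetD U N j (s + m) - jetD U N j s) = jet2 N.+1 (Z j k) s m.
  (* The second term is the first with s and m, and j and k, exchanged, whence [jet2C]. *)
  rewrite !jetDE (jet_shift_add _ _ _ (supp_P k hv)) [s + m]addrC.
  rewrite (jet_shift_add _ _ _ (supp_P j hv)) -[X in _ - X]jet2C -jet2B.
  by apply: eq_jet2 => a b _ _; rewrite [b + a]addrC.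
have eX j k s m : com (jetD U N j s) (jetD U N k m) = jet2 N.+1 (X j k) s m.
  exact: com_jet.
have P0 a j : a != 0 -> gpP0 U j a = gpP U a j by rewrite /gpP0 => /negPf ->.
have XZ j k a b : a != 0 -> b != 0 -> (X j k a b = Z j k a b) <->
   forall v, gpP U a j (gpP U b k v) - gpP U b k (gpP U a j v)
     = (b 0 j)%:R *: gpP U (mshift a b j) k v - (a 0 k)%:R *: gpP U (mshift a b k) j v.
  move=> a0 b0; rewrite /X /Z a0 b0 !scale1r !P0 ?mshift_neq0 // !mshiftE.
  split=> [e v|e]; last apply/lfunP => v.
    by rewrite -comE e add_lfunE opp_lfunE !scale_lfunE.
  by rewrite comE e add_lfunE opp_lfunE !scale_lfunE.
split=> h.
  move=> j k s m; rewrite eX eZ; apply: eq_jet2 => a b _ _.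
  (* For a = 0 or b = 0 both sides vanish: [gpP0] on the left, a delta and a zero exponent on the
     right. *)
  have [a0|a0] := eqVneq a 0.
    rewrite /X /Z a0 {1}/gpP0 !eqxx mxE scale0r sub0r scale0r scaler0 oppr0.
    exact: (lin0 (@com_linl _ _)).
  have [b0|b0] := eqVneq b 0.
    rewrite /X /Z b0 {2}/gpP0 !eqxx mxE !scale0r scaler0 subr0.
    exact: (lin0 (@com_linr _ _)).
  by apply/XZ => // v; apply: h.
move=> a b j k v a0 b0; move: v; apply/XZ => //.
have := @jet2_inj _ _ N.+1 (fun a b => X j k a b - Z j k a b).
have hz s m : jet2 N.+1 (fun a b => X j k a b - Z j k a b) s m = 0.
  by rewrite jet2B -eX -eZ h subrr.
move=> /(_ hz) hxz.
have [ha|ha] := boolP (inbox N.+1 a); last first.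
  rewrite /X (gpP0_out _ hv (leqnSn N) ha) (lin0 (@com_linl _ _)) /Z.
  by rewrite !(supported_pred _ (supp_P _ hv)) ?scaler0 ?subr0 //; left.
have [hb|hb] := boolP (inbox N.+1 b); last first.
  rewrite /X (gpP0_out _ hv (leqnSn N) hb) (lin0 (@com_linr _ _)) /Z.
  by rewrite !(supported_pred _ (supp_P _ hv)) ?scaler0 ?subr0 //; right.
by apply/eqP; rewrite -subr_eq0 hxz.
Qed.

Lemma gp_relDGP U N : gp_vanish U N ->
  (forall a b j x v, a != 0 ->
     gpP U a j (gpQ U b x v) - gpQ U b x (gpP U a j v)
     = (b 0 j)%:R *: gpQ U (mshift a b j) x v) <->
  (forall j s m x, com (jetD U N j s) (jetG U N m x) =
     zc m j *: (jetG U N (s + m) x - jetG U N m x)).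
Proof.
move=> hv.
pose X j x a b := com (gpP0 U j a) (gpQ U b x).
pose Z j x (a b : mi n) := (a != 0)%:R *: ((b 0 j)%:R *: gpQ U (mpred (a + b) j) x).
have eZ j x s m : zc m j *: (jetG U N (s + m) x - jetG U N m x) = jet2 N.+1 (Z j x) s m.
  by rewrite !jetGE (jet_shift_add _ _ _ (supp_Q x hv)).
have eX j x s m : com (jetD U N j s) (jetG U N m x) = jet2 N.+1 (X j x) s m.
  exact: com_jetDG.
have P0 a j : a != 0 -> gpP0 U j a = gpP U a j by rewrite /gpP0 => /negPf ->.
have XZ j x a b : a != 0 -> (X j x a b = Z j x a b) <->
   forall v, gpP U a j (gpQ U b x v) - gpQ U b x (gpP U a j v)
     = (b 0 j)%:R *: gpQ U (mshift a b j) x v.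
  move=> a0; rewrite /X /Z a0 scale1r P0 // !mshiftE.
  split=> [e v|e]; last apply/lfunP => v.
    by rewrite -comE e scale_lfunE.
  by rewrite comE e scale_lfunE.
split=> h.
  move=> j k s m; rewrite eX eZ; apply: eq_jet2 => a b _ _.
  have [a0|a0] := eqVneq a 0.
    rewrite /X /Z a0 {1}/gpP0 !eqxx scale0r.
    exact: (lin0 (@com_linl _ _)).
  by apply/XZ => // v; apply: h.
move=> a b j x v a0; move: v; apply/XZ => //.
have := @jet2_inj _ _ N.+1 (fun a b => X j x a b - Z j x a b).
have hz s m : jet2 N.+1 (fun a b => X j x a b - Z j x a b) s m = 0.
  by rewrite jet2B -eX -eZ h subrr.
move=> /(_ hz) hxz.
have [ha|ha] := boolP (inbox N.+1 a); last first.
  rewrite /X (gpP0_out _ hv (leqnSn N) ha) (lin0 (@com_linl _ _)) /Z.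
  by rewrite !(supported_pred _ (supp_Q _ hv)) ?scaler0 ?subr0 //; left.
have [hb|hb] := boolP (inbox N.+1 b); last first.
  rewrite /X [gpQ U b x](supp_Q x hv) ?(lin0 (@com_linr _ _)) /Z; last first.
    by case/notinboxP: hb => i hi; apply/negP => /inboxP/(_ i); rewrite ltnNge ltnW.
  by rewrite !(supported_pred _ (supp_Q _ hv)) ?scaler0 ?subr0 //; right.
by apply/eqP; rewrite -subr_eq0 hxz.
Qed.

(** No exponent is lowered in this relation, so the box of side N suffices. *)
Lemma gp_relGP U N : gp_vanish U N ->
  (forall a b x y v, gpQ U a x (gpQ U b y v) - gpQ U b y (gpQ U a x v) = gpQ U (a + b) (br x y) v) <->
  (forall s m x y, com (jetG U N s x) (jetG U N m y) = jetG U N (s + m) (br x y)).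
Proof.
move=> hv.
have eX x y s m : com (jetG U N s x) (jetG U N m y) = jet2 N (fun a b => com (gpQ U a x) (gpQ U b y)) s m.
  exact: com_jetG.
have eZ x y s m : jetG U N (s + m) (br x y) = jet2 N (fun a b => gpQ U (a + b) (br x y)) s m.
  by rewrite jetGE (jet_add _ _ (supp_Q _ hv)).
have XZ x y a b : (com (gpQ U a x) (gpQ U b y) = gpQ U (a + b) (br x y)) <->
   forall v, gpQ U a x (gpQ U b y v) - gpQ U b y (gpQ U a x v) = gpQ U (a + b) (br x y) v.
  split=> [e v|e]; last apply/lfunP => v; first by rewrite -comE e.
  by rewrite comE e.
split=> h; first by move=> s m x y; rewrite eX eZ; apply: eq_jet2 => a b _ _; apply/XZ => v; apply: h.
move=> a b x y v; move: v; apply/XZ.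
have hz s m : jet2 N (fun a b => com (gpQ U a x) (gpQ U b y) - gpQ U (a + b) (br x y)) s m = 0.
  by rewrite jet2B -eX -eZ h subrr.
have hxz := jet2_inj hz.
have out (c : mi n) z i : (N <= c ord0 i)%N -> gpQ U c z = 0 by move=> hi; case: hv => _ ->; [|exists i].
have [ha|/notinboxP[i hi]] := boolP (inbox N a); last first.
  rewrite (out a x i) // (lin0 (@com_linl _ _)) (out _ _ i) //.
  by rewrite mxE (leq_trans hi) // leq_addr.
have [hb|/notinboxP[i hi]] := boolP (inbox N b); last first.
  rewrite (out b y i) // (lin0 (@com_linr _ _)) (out _ _ i) //.
  by rewrite mxE (leq_trans hi) // leq_addl.
by apply/eqP; rewrite -subr_eq0 hxz.
Qed.

Lemma gp_linP U N : gp_vanish U N ->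
  (forall b (k : C) x y, gpQ U b (k *: x + y) = k *: gpQ U b x + gpQ U b y) <->
  (forall s (k : C) x y, jetG U N s (k *: x + y) = k *: jetG U N s x + jetG U N s y).
Proof.
move=> hv; split=> h.
  move=> s k x y; rewrite /jetG scaler_sumr -big_split; apply: eq_bigr => b _ /=.
  by rewrite h scalerDr !scalerA mulrC.
move=> b k x y; have [hb|/notinboxP hb] := boolP (inbox N b); last first.
  by case: hv => _ hv; rewrite !hv // scaler0 addr0.
apply/eqP; rewrite -subr_eq0 opprD addrA; apply/eqP.
apply: (@jet_inj _ _ N (fun b => gpQ U b (k *: x + y) - k *: gpQ U b x - gpQ U b y)) => // s.
by rewrite !jetB jetZ -!jetGE h; lmod_over C.
Qed.

(** Read one way this makes a model out of a g^+-module; read the other way it makes interpolated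
    coefficients into a g^+-module. *)
Lemma gp_jetrelP U N : gp_vanish U N ->
  is_gpmod br U <-> jetrel br (jetD U N) (jetG U N).
Proof.
move=> hv; split.
  case=> h1 h2 h3 h4; split; [exact/gp_linP|exact/gp_relDP|exact/gp_relDGP|exact/gp_relGP].
case=> h1 h2 h3 h4; split.
- exact/(gp_linP hv).
- by move=> a b j k v; apply: (proj2 (gp_relDP hv)).
- by move=> a b j x v; apply: (proj2 (gp_relDGP hv)).
- exact/(gp_relGP hv).
Qed.

End GpJet.

(** * Weights *)

Section Subspaces.
Variable X : lmodType C.
Implicit Types S : X -> Prop.

Definition subsp S := S 0 /\ forall (k : C) x y, S x -> S y -> S (k *: x + y).

Lemma subspD S x y : subsp S -> S x -> S y -> S (x + y).
Proof. by case=> _ h hx hy; rewrite -[x]scale1r; apply: h. Qed.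
Lemma subspZ S k x : subsp S -> S x -> S (k *: x).
Proof. by case=> h0 h hx; rewrite -[_ *: _]addr0; apply: h. Qed.
Lemma subspB S x y : subsp S -> S x -> S y -> S (x - y).
Proof. by move=> h hx hy; rewrite addrC -scaleN1r; apply: (proj2 h). Qed.
Lemma subsp_sum S (I : eqType) (r : seq I) (P : pred I) (F : I -> X) : subsp S ->
  (forall i, i \in r -> P i -> S (F i)) -> S (\sum_(i <- r | P i) F i).
Proof.
move=> h hF; rewrite big_seq_cond; elim/big_rec: _ => [|i x /andP[ri Pi] hx]; first by case: h.
by apply: subspD => //; apply: hF.
Qed.
Lemma subsp_zero : subsp (fun x : X => x = 0).
Proof. by split=> // k x y -> ->; rewrite scaler0 addr0. Qed.

Lemma invariant_subsp I (ops : I -> X -> X) S : Defs.invariant ops S -> subsp S.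
Proof. by case. Qed.

End Subspaces.

Section Weights.
Variables (X : lmodType C) (n : nat) (T : 'I_n -> X -> X).
Hypothesis Tlin : forall j, lin (T j).
Implicit Types (mu : 'rV[C]_n) (x y : X) (s : seq ('rV[C]_n * X)) (A : 'rV[C]_n -> Prop).

Definition weight mu x := forall j, T j x = mu 0 j *: x.

Lemma weight_subsp mu : subsp (weight mu).
Proof.
split=> [j|k x y hx hy j]; first by rewrite (lin0 (Tlin j)) scaler0.
by rewrite Tlin hx hy scalerDr !scalerA mulrC.
Qed.

Definition stable (S : X -> Prop) := forall j x, S x -> S (T j x).

(* A joint eigenvector is isolated from the others by applying [T j - mu1 j], one weight at a time. *)
Lemma weight_component S s mu x : subsp S -> stable S -> weight mu x ->
  (forall t, t \in s -> weight t.1 t.2 /\ t.1 <> mu) -> S (x + \sum_(t <- s) t.2) -> S x.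
Proof.
move=> hS hT; have [k] := ubnP (size s); elim: k s x => // k IH [|t s] x hk hx hs.
  by rewrite big_nil addr0.
rewrite big_cons => hsum.
have [ht tmu] := hs t (mem_head _ _).
have [j hj] : exists j, t.1 0 j != mu 0 j.
  apply/existsP; apply: contra_notT tmu; rewrite negb_exists => /forallP h.
  by apply/rowP => i; have := h i; rewrite negbK => /eqP.
have d0 : mu 0 j - t.1 0 j != 0 by rewrite subr_eq0 eq_sym.
suff : S ((mu 0 j - t.1 0 j) *: x).
  by move=> /(subspZ (mu 0 j - t.1 0 j)^-1 hS); rewrite scalerA mulVf // scale1r.
pose s' := [seq (u.1, (u.1 0 j - t.1 0 j) *: u.2) | u : 'rV[C]_n * X <- s].
apply: (IH s').
- by rewrite size_map.
- exact: subspZ (weight_subsp mu) hx.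
- move=> _ /mapP[u us ->] /=; have [hu umu] := hs u (mem_behead (s := t :: s) us).
  by split=> //; apply: subspZ (weight_subsp _) hu.
have := subspB hS (hT j _ hsum) (subspZ (t.1 0 j) hS hsum).
rewrite !(linD (Tlin j)) (lin_sum (Tlin j)) hx ht big_map /=.
have -> : \sum_(i <- s) T j i.2 = \sum_(i <- s) i.1 0 j *: i.2.
  apply: eq_big_seq => u us; have [hu _] := hs u (mem_behead (s := t :: s) us); exact: hu.
have -> : \sum_(i <- s) (i.1 0 j - t.1 0 j) *: i.2 = \sum_(i <- s) i.1 0 j *: i.2 - t.1 0 j *: \sum_(i <- s) i.2.
  by rewrite scaler_sumr -sumrB; apply: eq_bigr => u _; rewrite scalerBl.
set a := (\sum_(i <- s) _ *: _); set b := \sum_(i <- s) i.2.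
suff -> : (mu 0 j *: x + (t.1 0 j *: t.2 + a) - t.1 0 j *: (x + (t.2 + b))) =
   (mu 0 j - t.1 0 j) *: x + (a - t.1 0 j *: b) by [].
by lmod_over C.
Qed.

Definition weights_in A x := exists s, (forall t, t \in s -> weight t.1 t.2 /\ A t.1) /\ x = \sum_(t <- s) t.2.

Lemma weights_in_subsp A : subsp (weights_in A).
Proof.
split; first by exists [::]; rewrite big_nil.
move=> k x y [s [hs ->]] [s' [hs' ->]].
exists ([seq (t.1, k *: t.2) | t <- s] ++ s'); split; last first.
  by rewrite big_cat big_map scaler_sumr.
move=> t; rewrite mem_cat => /orP[/mapP[u us ->]|/hs' //] /=.
by have [hu Au] := hs u us; split=> //; apply: subspZ (weight_subsp _) hu.
Qed.

Lemma weight_in A mu x : A mu -> weight mu x -> weights_in A x.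
Proof.
by move=> Am hx; exists [:: (mu, x)]; rewrite big_seq1; split=> // t; rewrite inE => /eqP ->.
Qed.

(** Vectors of equal weight are added up, since [weight_component] separates only different
    weights. *)
Lemma weights_in_group A x : weights_in A x -> exists (u : seq 'rV[C]_n) (c : 'rV[C]_n -> X),
  [/\ uniq u, (forall mu, mu \in u -> A mu /\ weight mu (c mu)) & x = \sum_(mu <- u) c mu].
Proof.
case=> s [hs ->].
exists (undup (map fst s)), (fun mu => \sum_(t <- s | t.1 == mu) t.2).
split; first exact: undup_uniq.
  move=> mu; rewrite mem_undup => /mapP[t ts ->]; split; first by have [] := hs t ts.
  apply: subsp_sum (weight_subsp _) _ => t' t's /eqP <-; by have [] := hs t' t's.
rewrite (exchange_big_dep xpredT) //=; apply: eq_big_seq => t ts.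
rewrite (eq_bigl (pred1 t.1)); last by move=> mu; rewrite /= eq_sym.
by rewrite -big_filter filter_pred1_uniq ?undup_uniq ?mem_undup ?map_f // big_seq1.
Qed.

(** [weight_component] is applied to each weight of x in turn: all other components of x + y have
    other weights, those of y because they lie outside A. *)
Lemma weights_in_stable S A x y : subsp S -> stable S -> weights_in A x ->
  weights_in (fun mu => ~ A mu) y -> S (x + y) ->
  exists s, (forall t, t \in s -> [/\ weight t.1 t.2, A t.1 & S t.2]) /\ x = \sum_(t <- s) t.2.
Proof.
move=> hS hT /weights_in_group[u [c [uu hu ->]]] [s [hs ->]] hsum.
exists [seq (mu, c mu) | mu <- u]; rewrite big_map; split=> // _ /mapP[mu um ->] /=.
have [Am wm] := hu mu um; split=> //.
apply: (@weight_component S ([seq (nu, c nu) | nu <- u & nu != mu] ++ s) mu) => //.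
  move=> t; rewrite mem_cat => /orP[/mapP[nu]|/hs[h1 h2]]; last first.
    by split=> // e; apply: h2; rewrite e.
  by rewrite mem_filter => /andP[/eqP ne un] -> /=; split=> //; have [] := hu nu un.
rewrite big_cat /= addrA big_map big_filter; move: hsum.
by rewrite (bigD1_seq mu).
Qed.

Lemma weights_in_split S A x y : subsp S -> stable S -> weights_in A x -> weights_in (fun mu => ~ A mu) y ->
  S (x + y) -> S x.
Proof.
move=> hS hT hx hy /(weights_in_stable hS hT hx hy)[s [hs ->]].
by apply: subsp_sum => // t ts _; have [] := hs t ts.
Qed.

Lemma weights_in_disjoint A x : weights_in A x -> weights_in (fun mu => ~ A mu) x -> x = 0.
Proof.
(* The zero subspace contains x + (- x), hence its component x. *)
move=> h1 h2; apply: (@weights_in_split (fun x => x = 0) A x (- x)) => //.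
- exact: subsp_zero.
- by move=> j y ->; apply: lin0.
- by rewrite -scaleN1r; apply: subspZ (weights_in_subsp _) h2.
- by rewrite subrr.
Qed.

Lemma weights_in_cases A w : weights_in (fun=> True) w ->
  exists x y, [/\ weights_in A x, weights_in (fun mu => ~ A mu) y & w = x + y].
Proof.
case=> s [hs ->].
exists (\sum_(t <- s | `[< A t.1 >]) t.2), (\sum_(t <- s | ~~ `[< A t.1 >]) t.2).
split; last by rewrite [LHS](bigID (fun t => `[< A t.1 >])).
  apply: subsp_sum (weights_in_subsp _) _ => t ts /asboolP At; apply: weight_in At _.
  by have [] := hs t ts.
apply: subsp_sum (weights_in_subsp _) _ => t ts /asboolP At; apply: (weight_in (mu := t.1)) => //.
by have [] := hs t ts.
Qed.

End Weights.

(** Induction on the number r of operators already diagonalized. The joint eigenspace S of the first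
    r operators is stable under the next one by commutativity, so it contains the components of its
    elements for the next operator, and the weights get a new coordinate. *)
Lemma joint_diag (X : lmodType C) n (T : 'I_n -> X -> X) :
  (forall j, lin (T j)) -> (forall j k x, T j (T k x) = T k (T j x)) ->
  (forall j w, exists s : seq (C * X),
      w = \sum_(t <- s) t.2 /\ forall t, t \in s -> T j t.2 = t.1 *: t.2) ->
  forall w, weights_in T (fun=> True) w.
Proof.
move=> Tl Tc Td.
pose J r x := exists s : seq ('rV[C]_n * X), x = \sum_(t <- s) t.2 /\
  forall t, t \in s -> forall j : 'I_n, (j < r)%N -> T j t.2 = t.1 0 j *: t.2.
suff H r x : J r x.
  move=> w; have [s [e hs]] := H n w; exists s; split=> // t ts; split=> // j.
  by apply: hs.
elim: r x => [|r IH] x; first by exists [:: (0, x)]; rewrite big_seq1.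
have JD y z : J r.+1 y -> J r.+1 z -> J r.+1 (y + z).
  move=> [s [-> hs]] [s' [-> hs']]; exists (s ++ s'); rewrite big_cat; split=> // t.
  by rewrite mem_cat => /orP[/hs|/hs'].
have J0 : J r.+1 0 by exists [::]; rewrite big_nil.
have [s [-> hs]] := IH x; rewrite big_seq; elim/big_rec: _ => // t y ts; apply: JD.
have [rn|nr] := ltnP r n; last first.
  exists [:: t]; rewrite big_seq1; split=> // t'; rewrite inE => /eqP -> j _.
  by apply: hs => //; apply: leq_trans nr.
pose jr := Ordinal rn; pose S y := forall j : 'I_n, (j < r)%N -> T j y = t.1 0 j *: y.
have hS : subsp S.
  split=> [j _|k y1 y2 h1 h2 j hj]; first by rewrite (lin0 (Tl j)) scaler0.
  by rewrite Tl h1 // h2 // scalerDr !scalerA mulrC.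
(* A family with one member, so that the weight lemmas apply to a single operator. *)
pose T1 (j : 'I_1) := T jr.
have hT1 : stable T1 S by move=> j z hz k hk; rewrite /T1 Tc hz // (linZ (Tl jr)).
have [u [e hu]] := Td jr t.2.
have W1 : weights_in T1 (fun=> True) t.2.
  exists [seq (const_mx v.1, v.2) | v <- u]; rewrite big_map; split=> // _ /mapP[v vu ->].
  by split=> // j; rewrite mxE; apply: hu.
have [s1 [hs1 ->]] : exists s1, (forall t, t \in s1 -> [/\ weight T1 t.1 t.2, True & S t.2]) /\
    t.2 = \sum_(t <- s1) t.2.
  apply: (@weights_in_stable X 1 T1 (fun j => Tl jr) S (fun=> True) t.2 0) => //.
    exact: (weights_in_subsp (fun j => Tl jr) _).1.
  by rewrite addr0; apply: hs.
exists [seq (\row_i (if i == jr then v.1 0 0 else t.1 0 i), v.2) | v : 'rV[C]_1 * X <- s1].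
rewrite big_map; split=> // _ /mapP[v vs ->] j hj /=.
have [h1 _ h2] := hs1 v vs; rewrite mxE; case: eqVneq => [->|ne]; first exact: (h1 0).
apply: h2; move: hj; rewrite ltnS leq_eqVlt => /predU1P[e1|//].
by case/eqP: ne; apply: val_inj.
Qed.

(** * The modules F(T^n) (x) U *)

Lemma uniq_map_inj (I J : eqType) (f : I -> J) (s : seq I) x y :
  uniq (map f s) -> x \in s -> y \in s -> f x = f y -> x = y.
Proof.
elim: s => //= z s IH /andP[fz us]; rewrite !in_cons => /predU1P[->|xs] /predU1P[->|ys] // e.
- by rewrite e map_f in fz.
- by rewrite -e map_f in fz.
- exact: IH.
Qed.

Lemma lfun_lin (X Y : vectType C) (A : 'Hom(X, Y)) : lin A.
Proof. by move=> k x y; rewrite linearP. Qed.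

Section Tens.
Variables (n : nat) (U : lmodType C).
Implicit Types (f g : tens n U) (m k : Zn n) (u v : U).

Lemma tens_eq f g : (forall m, tval f m = tval g m) -> f = g.
Proof. by move=> h; apply: val_inj; apply/funext. Qed.

Lemma tvalD f g m : tval (f + g) m = tval f m + tval g m.
Proof. by []. Qed.
Lemma tvalZ c f m : tval (c *: f) m = c *: tval f m.
Proof. by []. Qed.
Lemma tvalN f m : tval (- f) m = - tval f m.
Proof. by []. Qed.
Lemma tval0 m : tval (0 : tens n U) m = 0.
Proof. by []. Qed.
Lemma tval_sum (I : Type) (r : seq I) (P : pred I) (F : I -> tens n U) m :
  tval (\sum_(i <- r | P i) F i) m = \sum_(i <- r | P i) tval (F i) m.
Proof. by elim/big_rec2: _ => [|i x y _ <-]; rewrite ?tval0 ?tvalD. Qed.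

Lemma single_subproof m v : (fun x => if x == m then v else 0) \in @fsuppP n U.
Proof.
apply/asboolP; exists [:: m] => x; rewrite inE => /negPf -> //.
Qed.
(** The element e_m (x) v. *)
Definition single m v : tens n U := Tens (single_subproof m v).

Lemma tval_single m v x : tval (single m v) x = if x == m then v else 0.
Proof. by []. Qed.

Lemma single_lin m : lin (single m).
Proof.
move=> k x y; apply: tens_eq => z; rewrite tvalD tvalZ !tval_single.
by case: ifP => // _; rewrite scaler0 addr0.
Qed.

Lemma tens_sum f : exists2 s : seq (Zn n), uniq s & f = \sum_(m <- s) single m (tval f m).
Proof.
have /asboolP[s hs] := tvalP f.
exists (undup s); first exact: undup_uniq.
apply: tens_eq => x; rewrite tval_sum.
have [xs|xs] := boolP (x \in s).
  rewrite (bigD1_seq x) ?mem_undup ?undup_uniq //= eqxx big1 ?addr0 // => y /negPf.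
  by rewrite eq_sym => ->.
rewrite hs // big1_seq // => y; rewrite mem_undup => /andP[_ ys] /=.
by case: eqP => // e; rewrite e ys in xs.
Qed.

End Tens.

Section Model.
Variables (n : nat) (L : vectType C) (U : vectType C) (lam : 'rV[C]_n).
Variables (Dc : 'I_n -> Zn n -> 'End(U)) (Gc : Zn n -> L -> 'End(U)).
Local Notation M := (tmodel lam Dc Gc).
Implicit Types (f g : tens n U) (m k s : Zn n) (u v : U).

Lemma tval_tE k f x : tval (gE M k f) x = tval f (x - k).
Proof. by []. Qed.
Lemma tval_tD j s f x : tval (gD M j s f) x =
  (zc (x - s) j + lam 0 j) *: tval f (x - s) + Dc j s (tval f (x - s)).
Proof. by []. Qed.
Lemma tval_tG s a f x : tval (gG M s a f) x = Gc s a (tval f (x - s)).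
Proof. by []. Qed.

Lemma tE_single k m v : gE M k (single m v) = single (m + k) v.
Proof. by apply: tens_eq => x; rewrite tval_tE !tval_single subr_eq. Qed.
Lemma tD_single j s m v : gD M j s (single m v) = single (m + s) ((zc m j + lam 0 j) *: v + Dc j s v).
Proof.
apply: tens_eq => x; rewrite tval_tD !tval_single subr_eq.
by case: eqP => [->|_]; rewrite ?addrK // scaler0 linear0 addr0.
Qed.
Lemma tG_single s a m v : gG M s a (single m v) = single (m + s) (Gc s a v).
Proof.
apply: tens_eq => x; rewrite tval_tG !tval_single subr_eq.
by case: eqP => // _; rewrite linear0.
Qed.

Lemma tE_lin k : lin (gE M k). Proof. by move=> c x y; apply: tens_eq. Qed.
Lemma tD_lin j s : lin (gD M j s).
Proof.
move=> c x y; apply: tens_eq => z; rewrite tvalD tvalZ !tval_tD tvalD tvalZ lfun_lin.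
by lmod_over C.
Qed.
Lemma tG_lin s a : lin (gG M s a).
Proof. by move=> c x y; apply: tens_eq => z; rewrite tvalD tvalZ !tval_tG tvalD tvalZ linearD linearZ. Qed.

Definition ubase (i : 'I_(dim U)) : U := @r2v _ U (delta_mx 0 i).

Lemma v2r_ubase i j : v2r (ubase i) 0 j = (j == i)%:R.
Proof. by rewrite /ubase (@r2vK _ U) mxE eqxx. Qed.

Lemma ubase_sum u : u = \sum_i v2r u 0 i *: ubase i.
Proof.
rewrite -[LHS]v2rK [v2r u in LHS]row_sum_delta linear_sum; apply: eq_bigr => i _.
by rewrite linearZ.
Qed.

Lemma tmodel_Fbasis : @Fbasis n L M (dim U) (fun i => single 0 (ubase i)).
Proof.
split=> [w|s us].
  have [s _ ->] := tens_sum w.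
  exists [seq ((m, i), v2r (tval w m) 0 i) | m <- s, i <- enum 'I_(dim U)].
  rewrite big_allpairs_dep; apply: eq_bigr => m _; rewrite big_enum /=.
  rewrite {1}[tval w m]ubase_sum (lin_sum (single_lin m)); apply: eq_bigr => i _.
  by rewrite -[tE m _]/(gE M m _) (linZ (single_lin m)) tE_single add0r.
move=> h t ts.
have ev t' : v2r (tval (t'.2 *: gE M t'.1.1 (single 0 (ubase t'.1.2))) t.1.1) 0 t.1.2 =
    (t.1 == t'.1)%:R * t'.2.
  rewrite tvalZ tE_single add0r tval_single linearZ /= mxE mulrC.
  rewrite -[t.1 == t'.1]/((t.1.1 == t'.1.1) && (t.1.2 == t'.1.2)).
  case: (t.1.1 == t'.1.1); last by rewrite linear0 mxE.
  by rewrite v2r_ubase.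
have : v2r (tval (\sum_(t <- s) t.2 *: gE M t.1.1 (single 0 (ubase t.1.2))) t.1.1) 0 t.1.2
    = v2r (tval (0 : tens n U) t.1.1) 0 t.1.2 by rewrite h.
rewrite tval_sum linear_sum summxE (eq_bigr _ (fun t' _ => ev t')) tval0 linear0 mxE.
have z : \sum_(i <- s | i != t) (t.1 == i.1)%:R * i.2 = 0.
  apply: big1_seq => t' /andP[ne t's].
  case: eqP => [e|]; last by rewrite mul0r.
  by rewrite (uniq_map_inj us ts t's e) eqxx in ne.
by rewrite (bigD1_seq t ts (map_uniq us)) /= eqxx mul1r z addr0.
Qed.

Lemma weight_single m v : (forall j, Dc j 0 = 0) ->
  weight (fun j => gD M j 0) (\row_j (zc m j + lam 0 j)) (single m v).
Proof. by move=> h j; rewrite tD_single addr0 h zero_lfunE addr0 (linZ (single_lin m)) mxE. Qed.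

(** On the fibre at m the operators are m_j + lam_j + [Dc j s]; since m changes along the way, the
    scalar parts produce exactly the differences in [jetrel]. The condition [Dc j 0 = 0] makes
    d_j(0) act on e_m (x) U by the scalar m_j + lam_j. *)
Lemma tmodel_catJ br : (forall j, Dc j 0 = 0) -> jetrel br Dc Gc -> catJ br M.
Proof.
move=> D0 [R4 R1 R2 R3]; split; [|split; [|split; [|split]]].
- split; first exact: tE_lin. split; first exact: tD_lin. split; first exact: tG_lin.
  split; [|split; [|split; [|split; [|split]]]].
  + by move=> s k a b w; apply: tens_eq => x; rewrite tvalD !tvalZ !tval_tG R4 add_lfunE scale_lfunE.
  + by move=> w; apply: tens_eq => x; rewrite tval_tE subr0.
  + by move=> m k w; apply: tens_eq => x; rewrite !tval_tE opprD addrA.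
  + move=> j k s m w; apply: tens_eq => x.
    rewrite !(tvalD, tvalN, tvalZ, tval_tD) !opprD !addrA [x - m - s]addrAC.
    move: (tval w _) => v; have := R1 j k s m => /(congr1 (fun f : 'End(U) => f v)).
    rewrite comE !(add_lfunE, opp_lfunE, scale_lfunE) => e; rewrite !lfun_lin.
    rewrite !zcB; set y := zc x; move: (y j) (y k) => yj yk.
    have -> : Dc j s (Dc k m v) = Dc k m (Dc j s v) + (zc m j *: (Dc k (s + m) v - Dc k m v) -
        zc s k *: (Dc j (s + m) v - Dc j s v)) by rewrite -e addrC subrK.
    by lmod_over C.
  + move=> j s m a w; apply: tens_eq => x.
    rewrite !(tvalD, tvalN, tvalZ, tval_tD, tval_tG) !opprD !addrA [x - m - s]addrAC.
    move: (tval w _) => v; have := R2 j s m a => /(congr1 (fun f : 'End(U) => f v)).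
    rewrite comE !(add_lfunE, opp_lfunE, scale_lfunE) => e; rewrite !lfun_lin.
    rewrite !zcB; set y := zc x; move: (y j) => yj.
    have -> : Dc j s (Gc m a v) = Gc m a (Dc j s v) + zc m j *: (Gc (s + m) a v - Gc m a v).
      by rewrite -e addrC subrK.
    by lmod_over C.
  + move=> s m a b w; apply: tens_eq => x.
    rewrite !(tvalD, tvalN, tvalZ, tval_tG) !opprD !addrA [x - m - s]addrAC.
    by rewrite -R3 comE.
- move=> j w; have [s us e] := tens_sum w.
  exists [seq (zc m j + lam 0 j, single m (tval w m)) | m <- s]; rewrite big_map; split=> // t.
  case/mapP => m _ -> /=.
  by rewrite -[tD _ _ _ _ _]/(gD M j 0 _) (weight_single _ _ D0) mxE.
- by exists (dim U), (fun i => single 0 (ubase i)); apply: tmodel_Fbasis.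
- move=> j s m w; apply: tens_eq => x.
  rewrite !(tvalD, tvalN, tvalZ, tval_tD, tval_tE) !opprD !addrA [x - m - s]addrAC.
  by rewrite !zcB; move: (tval w _) => v; lmod_over C.
- by move=> s a m w; apply: tens_eq => x; rewrite !(tval_tG, tval_tE) addrAC.
Qed.

(** On e_0 (x) U, e_(-s) d_j(s) acts as lam_j + [Dc j s] and e_(-s) (e_s a) as [Gc s a]; the scalar
    lam_j does not affect invariance. *)
Definition uops (i : 'I_n * Zn n + Zn n * L) : U -> U :=
  match i with inl (j, s) => Dc j s | inr (s, a) => Gc s a end.

Lemma comp_stable S f m : (forall j, Dc j 0 = 0) -> Defs.invariant (gops M) S ->
  S f -> S (single m (tval f m)).
Proof.
move=> D0 hS Sf; have [s us e] := tens_sum f.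
have [ms|ms] := boolP (m \in s); last first.
  suff -> : tval f m = 0 by rewrite (lin0 (single_lin m)); case: hS.
  rewrite e tval_sum big1_seq // => k /andP[_ ks]; rewrite tval_single; case: eqP => // mk.
  by rewrite mk ks in ms.
apply: (@weight_component (tens n U) n (fun j => gD M j 0) (fun j => tD_lin j 0) S
  [seq (\row_j (zc k j + lam 0 j), single k (tval f k)) | k <- s & k != m] _ _
  (invariant_subsp hS) _ (weight_single m (tval f m) D0)).
- by move=> j x; case: hS => _ _ /(_ (inl (inr (j, 0)))); apply.
- move=> _ /mapP[k + ->] /=; rewrite mem_filter => /andP[km ks]; split; first exact: weight_single.
  move=> /rowP h; case/eqP: km; apply: zc_inj => j; have := h j; rewrite !mxE.
  exact: addIr.
- by rewrite big_map big_filter; move: Sf; rewrite {1}e (bigD1_seq m).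
Qed.

Definition fiber_of (S : tens n U -> Prop) (v : U) := S (single 0 v).
Definition fiberwise (T : U -> Prop) (f : tens n U) := forall m, T (tval f m).

Lemma gopsE k f : gops M (inl (inl k)) f = gE M k f. Proof. by []. Qed.
Lemma gopsD j s f : gops M (inl (inr (j, s))) f = gD M j s f. Proof. by []. Qed.
Lemma gopsG s a f : gops M (inr (s, a)) f = gG M s a f. Proof. by []. Qed.

Lemma fiber_of_invariant S : Defs.invariant (gops M) S -> Defs.invariant uops (fiber_of S).
Proof.
move=> hS; have sS := invariant_subsp hS; case: hS => S0 SD So; split.
- by rewrite /fiber_of (lin0 (single_lin 0)).
- by move=> k x y; rewrite /fiber_of single_lin; apply: SD.
case=> [[j s]|[s a]] v Sv; rewrite /fiber_of /=.
  have := So (inl (inl (- s))) _ (So (inl (inr (j, s))) _ Sv).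
  rewrite gopsE gopsD tD_single tE_single add0r subrr zc0 add0r.
  rewrite (linD (single_lin 0)) (linZ (single_lin 0)) => h.
  by have := subspB sS h (subspZ (lam 0 j) sS Sv); rewrite addrC addKr.
have := So (inl (inl (- s))) _ (So (inr (s, a)) _ Sv).
by rewrite gopsE gopsG tG_single tE_single add0r subrr.
Qed.

Lemma fiberwise_invariant T : Defs.invariant uops T -> Defs.invariant (gops M) (fiberwise T).
Proof.
move=> hT; have sT := invariant_subsp hT; case: hT => T0 TD To; split.
- by move=> m.
- by move=> k x y hx hy m; rewrite tvalD tvalZ; apply: TD.
case=> [[k|[j s]]|[s a]] f hf m.
- exact: hf.
- rewrite -[gops _ _ _]/(gD M j s f) tval_tD; apply: TD => //; exact: (To (inl (j, s))).
- exact: (To (inr (s, a))).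
Qed.

Lemma fiber_ofP S : (forall j, Dc j 0 = 0) -> Defs.invariant (gops M) S ->
  forall f, S f <-> forall m, fiber_of S (tval f m).
Proof.
move=> D0 hS f; have sS := invariant_subsp hS; split=> h.
  move=> m; have := comp_stable m D0 hS h; case: hS => _ _ /(_ (inl (inl (- m)))) hE /hE.
  by rewrite gopsE tE_single subrr.
have [s _ ->] := tens_sum f; apply: subsp_sum => // m _ _.
have := h m; rewrite /fiber_of; case: hS => _ _ /(_ (inl (inl m))) hE /hE.
by rewrite gopsE tE_single add0r.
Qed.

Lemma tens_nonzero : nonzero (tens n U) <-> nonzero U.
Proof.
split=> [[f f0]|[u u0]].
  apply: contrapT => h; apply: f0; apply: tens_eq => m; apply: contrapT => hm.
  by apply: h; exists (tval f m).
exists (single 0 u) => /(congr1 (fun f => tval f 0)); rewrite tval_single eqxx; exact: u0.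
Qed.

Lemma zero_fiber_of S : (forall j, Dc j 0 = 0) -> Defs.invariant (gops M) S ->
  zero_sub (fiber_of S) -> zero_sub S.
Proof. by move=> D0 hS h f /(fiber_ofP D0 hS) hf; apply: tens_eq => m; apply: h. Qed.

Lemma zero_fiberwise T : T 0 -> zero_sub (fiberwise T) -> zero_sub T.
Proof.
move=> T0 h v Tv; have hl : fiberwise T (single 0 v) by move=> m; rewrite tval_single; case: eqP.
by have /(congr1 (fun f => tval f 0)) := h _ hl; rewrite tval_single eqxx.
Qed.

Lemma tens_indec : (forall j, Dc j 0 = 0) -> indecomposable uops -> indecomposable (gops M).
Proof.
move=> D0 [/tens_nonzero nz h]; split=> // S1 S2 h1 h2 hs hd.
have [] := h _ _ (fiber_of_invariant h1) (fiber_of_invariant h2).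
- move=> v; have [x1 [x2 [hx1 hx2 e]]] := hs (single 0 v).
  exists (tval x1 0), (tval x2 0); split; [exact: (proj1 (fiber_ofP D0 h1 x1))|exact: (proj1 (fiber_ofP D0 h2 x2))|].
  by rewrite -tvalD -e tval_single eqxx.
- move=> v v1 v2; have := hd _ v1 v2 => /(congr1 (fun f => tval f 0)).
  by rewrite tval_single eqxx.
- by left; apply: zero_fiber_of.
- by right; apply: zero_fiber_of.
Qed.

Lemma indec_tens : indecomposable (gops M) -> indecomposable uops.
Proof.
move=> [/tens_nonzero nz h]; split=> // T1 T2 h1 h2 hs hd.
have [] := h _ _ (fiberwise_invariant h1) (fiberwise_invariant h2).
- move=> f; have s1 := invariant_subsp (fiberwise_invariant h1); have s2 := invariant_subsp (fiberwise_invariant h2).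
  have [s _ ->] := tens_sum f.
  elim/big_rec: _ => [|m x _ [x1 [x2 [hx1 hx2 ->]]]].
    by exists 0, 0; split; [case: s1|case: s2|rewrite addr0].
  have [y1 [y2 [hy1 hy2 e]]] := hs (tval f m).
  exists (single m y1 + x1), (single m y2 + x2); split.
  + by apply: (subspD s1 _ hx1) => k; rewrite tval_single; case: eqP => // _; case: h1.
  + by apply: (subspD s2 _ hx2) => k; rewrite tval_single; case: eqP => // _; case: h2.
  + by rewrite e (linD (single_lin m)) addrACA.
- by move=> f f1 f2; apply: tens_eq => m; apply: hd.
- by left; apply: zero_fiberwise => //; case: h1.
- by right; apply: zero_fiberwise => //; case: h2.
Qed.

Lemma tens_irr : (forall j, Dc j 0 = 0) -> irreducible uops -> irreducible (gops M).
Proof.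
move=> D0 [/tens_nonzero nz h]; split=> // S hS.
have [hz|hf] := h _ (fiber_of_invariant hS); first by left; apply: zero_fiber_of.
by right => f; apply/(fiber_ofP D0 hS).
Qed.

Lemma irr_tens : irreducible (gops M) -> irreducible uops.
Proof.
move=> [/tens_nonzero nz h]; split=> // T hT.
have [hz|hf] := h _ (fiberwise_invariant hT); first by left; apply: zero_fiberwise => //; case: hT.
by right => v; have := hf (single 0 v) 0; rewrite tval_single eqxx.
Qed.

End Model.

(** * Transfer of indecomposability and irreducibility *)

Section EqInvariant.
Variables (X : lmodType C) (I J : Type) (ops : I -> X -> X) (ops' : J -> X -> X).
Hypothesis h : forall S, Defs.invariant ops S <-> Defs.invariant ops' S.

(** Only the invariant subspaces matter, so [gpops] may be exchanged for [uops], and [gpops] of an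
    inflated module for [glops]. *)
Lemma eq_indecomposable : indecomposable ops <-> indecomposable ops'.
Proof.
split=> -[nz H]; split=> // S1 S2 h1 h2 hs hd; apply: H => //; exact/h.
Qed.

Lemma eq_irreducible : irreducible ops <-> irreducible ops'.
Proof. by split=> -[nz H]; split=> // S hS; apply: H; apply/h. Qed.

End EqInvariant.

Lemma irreducible_indecomposable (X : lmodType C) (I : Type) (ops : I -> X -> X) :
  irreducible ops -> indecomposable ops.
Proof.
move=> [nz h]; split=> // S1 S2 h1 h2 _ hd; have [z|f] := h S1 h1; first by left.
by right => x hx; apply: hd.
Qed.

Lemma pull_invariant (X Y : lmodType C) (I : Type) (oX : I -> X -> X) (oY : I -> Y -> Y) (psi : Y -> X) S :
  lin psi -> (forall i y, psi (oY i y) = oX i (psi y)) ->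
  Defs.invariant oX S -> Defs.invariant oY (fun y => S (psi y)).
Proof.
move=> pl pi [h1 h2 h3]; split; first by rewrite (lin0 pl).
- by move=> k x y hx hy; rewrite pl; apply: h2.
- by move=> i y hy; rewrite pi; apply: h3.
Qed.

Section IsoTransfer.
Variables (X Y : lmodType C) (I : Type) (oX : I -> X -> X) (oY : I -> Y -> Y).

Lemma iso_sym : isomorphic oX oY -> isomorphic oY oX.
Proof.
case=> phi [pl [psi k1 k2] pi]; exists psi; split; last 1 first.
- by move=> i x; rewrite -{1}[x]k2 -pi k1.
- by move=> k x y; rewrite -{1}[x]k2 -{1}[y]k2 -pl k1.
- by exists phi.
Qed.

Lemma iso_nonzero : isomorphic oX oY -> nonzero X -> nonzero Y.
Proof.
case=> phi [pl /bij_inj inj _] [x x0]; exists (phi x) => e; apply: x0; apply: inj.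
by rewrite e (lin0 pl).
Qed.

Lemma iso_indecomposable : isomorphic oX oY -> indecomposable oX -> indecomposable oY.
Proof.
move=> iso [nz h]; split; first exact: iso_nonzero nz.
case: iso => phi [pl [psi k1 k2] pi] S1 S2 h1 h2 hs hd.
have [] := h _ _ (pull_invariant pl pi h1) (pull_invariant pl pi h2).
- move=> x; have [y1 [y2 [H1 H2 e]]] := hs (phi x).
  exists (psi y1), (psi y2); rewrite !k2; split=> //.
  by apply: (can_inj k1); rewrite (linD pl) !k2.
- by move=> x x1 x2; apply: (can_inj k1); rewrite (lin0 pl); apply: hd.
- by move=> z; left=> y hy; rewrite -[y]k2 (z (psi y)) ?(lin0 pl) ?k2.
- by move=> z; right=> y hy; rewrite -[y]k2 (z (psi y)) ?(lin0 pl) ?k2.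
Qed.

Lemma iso_irreducible : isomorphic oX oY -> irreducible oX -> irreducible oY.
Proof.
move=> iso [nz h]; split; first exact: iso_nonzero nz.
case: iso => phi [pl [psi k1 k2] pi] S hS.
have [z|f] := h _ (pull_invariant pl pi hS).
  by left=> y hy; rewrite -[y]k2 (z (psi y)) ?(lin0 pl) ?k2.
by right=> y; rewrite -[y]k2.
Qed.

End IsoTransfer.

Lemma iso_trans (X Y Z : lmodType C) (I : Type) (oX : I -> X -> X) (oY : I -> Y -> Y)
  (oZ : I -> Z -> Z) : isomorphic oX oY -> isomorphic oY oZ -> isomorphic oX oZ.
Proof.
case=> f [fl fb fi] [g [gl gb gi]]; exists (g \o f); split.
- by move=> k x y; rewrite /= fl gl.
- exact: bij_comp.
- by move=> i x; rewrite /= fi gi.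
Qed.

Section GpInvariant.
Variables (n : nat) (L : vectType C) (U : gpmod n L) (N : nat).
Hypothesis hv : gp_vanish U N.

Lemma subsp_jet (V : lmodType C) (S : V -> Prop) K Y (s : Zn n) :
  subsp S -> (forall b, S (Y b)) -> S (jet K Y s).
Proof. by move=> hS h; apply: subsp_sum => // b _ _; apply: subspZ. Qed.

Lemma subsp_jetcoef (V : lmodType C) (S : V -> Prop) K (F : Zn n -> V) b :
  subsp S -> (forall s, S (F s)) -> S (jetcoef K F b).
Proof. by move=> hS h; apply: subsp_sum => // a _ _; apply: subspZ. Qed.

(** Each operator of one family is a linear combination of operators of the other: the jets by
    definition, their coefficients by interpolation on the grid. *)
Lemma gpops_invariant S : Defs.invariant (gpops U) S <->
  Defs.invariant (uops (jetD U N) (jetG U N)) S.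
Proof.
(* Evaluation at v pulls S back to a subspace of End(U), where the linear combinations are taken. *)
have ev_subsp v : subsp S -> subsp (fun A : 'End(gpcar U) => S (A v)).
  case=> S0 SD; split; first by rewrite zero_lfunE.
  by move=> k x y hx hy; rewrite add_lfunE scale_lfunE; apply: SD.
split=> -[S0 SD So]; have sS : subsp S by []; split=> //.
  case=> [[j s]|[s x]] v Sv /=.
    rewrite jetDE; apply: (@subsp_jet _ (fun A : 'End(gpcar U) => S (A v))); first exact: ev_subsp.
    move=> b; rewrite /gpP0; case: eqVneq => [_|b0]; first by rewrite zero_lfunE.
    exact: (So (inl (Sub b b0, j))).
  rewrite jetGE; apply: (@subsp_jet _ (fun A : 'End(gpcar U) => S (A v))); first exact: ev_subsp.
  by move=> b; exact: (So (inr (b, x))).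
case=> [[[a a0] j]|[b x]] v Sv /=.
  have -> : gpP U a j = gpP0 U j a by rewrite /gpP0 (negPf a0).
  have [ia|/(supp_P j hv) ->] := boolP (inbox N a); last by rewrite zero_lfunE.
  rewrite -(jetcoef_jet _ ia); apply: (@subsp_jetcoef _ (fun A : 'End(gpcar U) => S (A v))); first exact: ev_subsp.
  by move=> s; rewrite -jetDE; exact: (So (inl (j, s))).
have [ib|/(supp_Q x hv) ->] := boolP (inbox N b); last by rewrite zero_lfunE.
rewrite -(@jetcoef_jet n _ N (fun b => gpQ U b x) b ib).
apply: (@subsp_jetcoef _ (fun A : 'End(gpcar U) => S (A v))); first exact: ev_subsp.
by move=> s; exact: (So (inr (s, x))).
Qed.

Lemma jetD0 j : jetD U N j 0 = 0.
Proof. by rewrite /jetD big1 // => b b0; rewrite coefsb_0 // scale0r. Qed.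

Lemma gp_indecP lam : gp_indec U <-> g_indec (Jjet lam U N).
Proof.
split=> h.
  by apply: tens_indec; [exact: jetD0|apply/(eq_indecomposable gpops_invariant)].
by apply/(eq_indecomposable gpops_invariant); apply: indec_tens h.
Qed.

Lemma gp_irrP lam : irreducible (gpops U) <-> g_irr (Jjet lam U N).
Proof.
split=> h.
  by apply: tens_irr; [exact: jetD0|apply/(eq_irreducible gpops_invariant)].
by apply/(eq_irreducible gpops_invariant); apply: irr_tens h.
Qed.

Lemma Jjet_catJ br lam : is_gpmod br U -> catJ br (Jjet lam U N).
Proof. by move=> /(gp_jetrelP br hv); apply: tmodel_catJ; exact: jetD0. Qed.

End GpInvariant.

(** * Modules in category J *)

Section Span.
Variable X : lmodType C.
Implicit Types (ys : seq X).

Definition spanned ys x := forall S : X -> Prop, subsp S -> (forall y, y \in ys -> S y) -> S x.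

Lemma spanned_subsp ys : subsp (spanned ys).
Proof.
split=> [S [S0 _] //|k x y hx hy S hS h].
by apply: (proj2 hS); [apply: hx|apply: hy].
Qed.

Lemma spanned_mem ys y : y \in ys -> spanned ys y.
Proof. by move=> h S _; apply. Qed.

Lemma spanned_sub ys ys' x : {subset ys <= ys'} -> spanned ys x -> spanned ys' x.
Proof. by move=> h hx S hS hy; apply: hx => // y /h; apply: hy. Qed.

(** Coordinates for a finitely generated subspace of an arbitrary space, so that ['rV[C]_d] can
    replace it. A generator already in the image is dropped, any other one adds a coordinate. *)
Lemma spanned_basis ys : exists d (iota : 'rV[C]_d -> X),
  [/\ lin iota, (forall u, iota u = 0 -> u = 0) & forall x, (exists u, x = iota u) <-> spanned ys x].
Proof.
elim: ys => [|y ys [d [f [fl fi fs]]]].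
  exists 0%N, (fun=> 0); split.
  - by move=> k x y; rewrite scaler0 addr0.
  - by move=> u _; apply/rowP => -[].
  - move=> x; split=> [[_ ->]|h]; first by case: (spanned_subsp [::]).
    by exists 0; apply: (h _ (@subsp_zero X)).
have [[u0 hu0]|hy] := pselect (exists u, y = f u).
  exists d, f; split=> // x; rewrite fs; split.
    by apply: spanned_sub => z zy; rewrite in_cons zy orbT.
  move=> hx S hS h; apply: hx => // z; rewrite in_cons => /predU1P[->|]; last exact: h.
  by have [+ _] := fs y; apply=> //; exists u0.
pose g (u : 'rV[C]_(1 + d)) := lsubmx u 0 0 *: y + f (rsubmx u).
have gl : lin g.
  move=> k u v; rewrite /g !linearD !linearZ /= !mxE fl; lmod_over C.
exists (1 + d)%N, g; split=> // [u hu|x].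
  have l0 : lsubmx u 0 0 = 0.
    (* A relation with nonzero coefficient at y would put y in the image of f. *)
    apply: contrapT => /eqP nz; apply: hy; exists (- (lsubmx u 0 0)^-1 *: rsubmx u).
    rewrite (linZ fl); have -> : f (rsubmx u) = - (lsubmx u 0 0 *: y).
      by apply/eqP; rewrite -addr_eq0 addrC; apply/eqP.
    by rewrite scalerN scaleNr opprK scalerA mulVf // scale1r.
  have r0 : rsubmx u = 0 by apply: fi; move: hu; rewrite /g l0 scale0r add0r.
  rewrite -[u]hsubmxK r0; suff -> : lsubmx u = 0 by rewrite row_mx0.
  by apply/rowP => i; rewrite ord1 [RHS]mxE.
split=> [[u ->]|].
  apply: (subspD (spanned_subsp (y :: ys))).
    by apply: (subspZ _ (spanned_subsp (y :: ys))); apply: spanned_mem; rewrite mem_head.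
  apply: (@spanned_sub ys); first by move=> z zy; rewrite in_cons zy orbT.
  by apply/fs; exists (rsubmx u).
move=> /(_ (fun x => exists u, x = g u)); apply.
  split; first by exists 0; rewrite (lin0 gl).
  by move=> k _ _ [u ->] [v ->]; exists (k *: u + v); rewrite gl.
move=> z; rewrite in_cons => /predU1P[->|zy].
  by exists (row_mx 1%:M 0); rewrite /g row_mxKl row_mxKr (lin0 fl) mxE eqxx scale1r addr0.
have [_ /(_ (spanned_mem zy))[u ->]] := fs z.
by exists (row_mx 0 u); rewrite /g row_mxKl row_mxKr mxE scale0r add0r.
Qed.

End Span.

(** * Linear maps out of F(T^n) (x) U *)

Section TensMap.
Variables (n : nat) (U : lmodType C) (Y : lmodType C) (h : Zn n -> U -> Y).
Hypothesis hl : forall m, lin (h m).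

Lemma big_support (I : eqType) (F : I -> Y) (s s' : seq I) : uniq s -> uniq s' ->
  (forall x, x \notin s -> F x = 0) -> (forall x, x \notin s' -> F x = 0) ->
  \sum_(x <- s) F x = \sum_(x <- s') F x.
Proof.
move=> us us' h1 h2.
rewrite (bigID (fun x => F x != 0)) /= [X in _ + X]big1 ?addr0; last first.
  by move=> x; rewrite negbK => /eqP.
rewrite [RHS](bigID (fun x => F x != 0)) /= [X in _ = _ + X]big1 ?addr0; last first.
  by move=> x; rewrite negbK => /eqP.
have hp : perm_eq [seq x <- s | F x != 0] [seq x <- s' | F x != 0].
  apply: uniq_perm; rewrite ?filter_uniq // => x; rewrite !mem_filter; case: eqVneq => //= nz.
  apply/idP/idP => H; apply: contraT.
    by move=> /h2 e; rewrite e eqxx in nz.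
  by move=> /h1 e; rewrite e eqxx in nz.
by rewrite -big_filter (perm_big _ hp) big_filter.
Qed.

Lemma tens_supp (f : tens n U) : exists s : seq (Zn n), uniq s /\ forall m, m \notin s -> tval f m = 0.
Proof.
have /asboolP[s hs] := tvalP f; exists (undup s); split; first exact: undup_uniq.
by move=> m; rewrite mem_undup; apply: hs.
Qed.

(** The linear map sending e_m (x) v to [h m v]. Only the existence of a finite support is known, so
    one is chosen; [tens_mapE] frees the value from the choice. *)
Definition tens_map (f : tens n U) : Y := \sum_(m <- projT1 (cid (tens_supp f))) h m (tval f m).

Lemma tens_mapE f s : uniq s -> (forall m, m \notin s -> tval f m = 0) ->
  tens_map f = \sum_(m <- s) h m (tval f m).
Proof.
move=> us hs; rewrite /tens_map; case: (cid _) => s' [us' hs'] /=.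
apply: big_support => // m; [move/hs'|move/hs] => ->; exact: lin0.
Qed.

Lemma tens_map_lin : lin tens_map.
Proof.
move=> k f g.
have [s [us hs]] := tens_supp f; have [s' [us' hs']] := tens_supp g.
pose r := undup (s ++ s').
have hr m : m \notin r -> tval f m = 0 /\ tval g m = 0.
  by rewrite mem_undup mem_cat negb_or => /andP[/hs ? /hs' ?].
have ur : uniq r := undup_uniq _.
have hf m : m \notin r -> tval f m = 0 by case/hr.
have hg m : m \notin r -> tval g m = 0 by case/hr.
have hfg m : m \notin r -> tval (k *: f + g) m = 0.
  by case/hr => e1 e2; rewrite tvalD tvalZ e1 e2 scaler0 addr0.
rewrite (tens_mapE ur hf) (tens_mapE ur hg) (tens_mapE ur hfg).
rewrite scaler_sumr -big_split; apply: eq_bigr => m _ /=.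
exact: (hl m k (tval f m) (tval g m)).
Qed.

Lemma tens_map_single m v : tens_map (single m v) = h m v.
Proof.
rewrite (@tens_mapE _ [:: m]) //; first by rewrite big_seq1 tval_single eqxx.
by move=> k; rewrite inE tval_single => /negPf ->.
Qed.

End TensMap.

Lemma lin_tens_eq n (U Y : lmodType C) (f g : tens n U -> Y) : lin f -> lin g ->
  (forall m v, f (single m v) = g (single m v)) -> forall x, f x = g x.
Proof.
move=> fl gl h x; have [s _ ->] := tens_sum x.
by rewrite (lin_sum fl) (lin_sum gl); apply: eq_bigr.
Qed.

Lemma lin_comp (X Y Z : lmodType C) (f : Y -> Z) (g : X -> Y) : lin f -> lin g -> lin (fun x => f (g x)).
Proof. by move=> fl gl k x y; rewrite gl fl. Qed.

Lemma bij_of_inj_surj (X Y : lmodType C) (f : X -> Y) : lin f ->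
  (forall x, f x = 0 -> x = 0) -> (forall y, exists x, f x = y) -> bijective f.
Proof.
move=> fl fi fs; have [g hg] := choice fs.
exists g => // x; apply/eqP; rewrite -subr_eq0; apply/eqP; apply: fi.
by rewrite (linB fl) hg subrr.
Qed.

(** * Representatives of weights modulo Z^n *)

Section Coset.
Variable n : nat.
Implicit Types (mu nu : 'rV[C]_n) (m k : Zn n).

Definition zrow k : 'rV[C]_n := \row_j zc k j.

Lemma zrowD m k : zrow (m + k) = zrow m + zrow k.
Proof. by apply/rowP => j; rewrite !mxE zcD. Qed.
Lemma zrow0 : zrow 0 = 0.
Proof. by apply/rowP => j; rewrite !mxE zc0. Qed.
Lemma zrowN m : zrow (- m) = - zrow m.
Proof. by apply/rowP => j; rewrite !mxE zcN. Qed.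
Lemma zrow_inj : injective zrow.
Proof. by move=> m k /rowP h; apply: zc_inj => j; have := h j; rewrite !mxE. Qed.

Definition coset mu : pred 'rV[C]_n := fun nu => `[< exists k, nu = mu + zrow k >].
(** Constant on cosets, because [choose] depends only on the extension of the predicate. *)
Definition rep mu := choose (coset mu) mu.

Lemma coset_refl mu : coset mu mu.
Proof. by apply/asboolP; exists 0; rewrite zrow0 addr0. Qed.

Lemma coset_add mu k : coset (mu + zrow k) =1 coset mu.
Proof.
move=> nu; apply/asboolP/asboolP => -[l ->].
  by exists (k + l); rewrite zrowD addrA.
by exists (l - k); rewrite zrowD zrowN [zrow l - _]addrC addrA addrK.
Qed.

Lemma repE mu : exists k, rep mu = mu + zrow k.
Proof. by have /asboolP := chooseP (coset_refl mu). Qed.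

Lemma rep_add mu k : rep (mu + zrow k) = rep mu.
Proof.
rewrite /rep (eq_choose (coset_add mu k)); apply: choose_id; last exact: coset_refl.
by apply/asboolP; exists k.
Qed.

Lemma rep_rep mu : rep (rep mu) = rep mu.
Proof. by have [k e] := repE mu; rewrite {1}e rep_add. Qed.

(** The integral part of a weight relative to its representative is unique, which keeps the
    translates e_m U apart. *)
Lemma rep_shift mu nu m k : rep mu = mu -> rep nu = nu -> mu + zrow m = nu + zrow k -> m = k.
Proof.
move=> hm hn e; have := congr1 rep e; rewrite !rep_add hm hn => e'.
by apply: zrow_inj; move: e; rewrite e' => /addrI.
Qed.

End Coset.

(** * Every module in the category is isomorphic to a model *)

Section Structure.
Variables (n : nat) (L : vectType C) (br : L -> L -> L) (M : gmod n L).
Hypothesis J : catJ br M.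
Local Notation X := (gcar M).
Local Notation E := (gE M).
Local Notation D := (gD M).
Local Notation G := (gG M).
Local Notation T := (fun j => gD M j 0).

Let El m : lin (E m). Proof. by case: J => -[h]. Qed.
Let Dl j s : lin (D j s). Proof. by case: J => -[_ [h]]. Qed.
Let Gl s a : lin (G s a). Proof. by case: J => -[_ [_ [h]]]. Qed.
Let Glin s (k : C) a b w : G s (k *: a + b) w = k *: G s a w + G s b w.
Proof. by case: J => -[_ [_ [_ [h _]]]] _; apply: h. Qed.
Let E0 w : E 0 w = w.
Proof. by case: J => -[_ [_ [_ [_ [h _]]]]] _; apply: h. Qed.
Let EE m k w : E m (E k w) = E (m + k) w.
Proof. by case: J => -[_ [_ [_ [_ [_ [h _]]]]]] _; apply: h. Qed.
Let DD j k s m w : D j s (D k m w) - D k m (D j s w)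
                     = zc m j *: D k (s + m) w - zc s k *: D j (s + m) w.
Proof. by case: J => -[_ [_ [_ [_ [_ [_ [h _]]]]]]] _; apply: h. Qed.
Let DG j s m a w : D j s (G m a w) - G m a (D j s w) = zc m j *: G (s + m) a w.
Proof. by case: J => -[_ [_ [_ [_ [_ [_ [_ [h _]]]]]]]] _; apply: h. Qed.
Let GG s m a b w : G s a (G m b w) - G m b (G s a w) = G (s + m) (br a b) w.
Proof. by case: J => -[_ [_ [_ [_ [_ [_ [_ [_ h]]]]]]]] _; apply: h. Qed.
Let J3 j s m w : D j s (E m w) = zc m j *: E (m + s) w + E m (D j s w).
Proof. by case: J => _ [_ [_ [h _]]]; apply: h. Qed.
Let J4 s a m w : G s a (E m w) = E m (G s a w).
Proof. by case: J => _ [_ [_ [_ h]]]; apply: h. Qed.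
Let Tl j : lin (T j). Proof. exact: Dl. Qed.

Lemma catJ_weights w : weights_in T (fun=> True) w.
Proof.
apply: (joint_diag Tl) => [j k x|j x].
  by apply/eqP; rewrite -subr_eq0 DD !zc0 !scale0r subrr.
by case: J => _ [h _]; apply: h.
Qed.

Lemma weight_E mu m x : weight T mu x -> weight T (mu + zrow m) (E m x).
Proof.
by move=> h j; rewrite J3 addr0 h (linZ (El m)) !mxE addrC scalerDl.
Qed.

Lemma weight_D mu j s x : weight T mu x -> weight T (mu + zrow s) (D j s x).
Proof.
move=> h k; have := DD k j 0 s x; rewrite add0r zc0 scale0r subr0 => /eqP.
by rewrite subr_eq => /eqP ->; rewrite h (linZ (Dl j s)) !mxE addrC scalerDl.
Qed.

Lemma weight_G mu s a x : weight T mu x -> weight T (mu + zrow s) (G s a x).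
Proof.
move=> h k; have := DG k 0 s a x; rewrite add0r => /eqP.
by rewrite subr_eq => /eqP ->; rewrite h (linZ (Gl s a)) !mxE addrC scalerDl.
Qed.

(** The space U: one weight is kept from each coset of Z^n, and every weight vector has a translate
    in it. *)
Definition reps : X -> Prop := weights_in T (fun mu => rep mu = mu).

Lemma weights_inE A B m x : (forall mu, A mu -> B (mu + zrow m)) -> weights_in T A x -> weights_in T B (E m x).
Proof.
move=> h [s [hs ->]]; rewrite (lin_sum (El m)); apply: subsp_sum (weights_in_subsp Tl _) _ => t ts _.
by have [w At] := hs t ts; apply: (weight_in (h _ At)); apply: weight_E.
Qed.

Lemma reps_shift (F : X -> X) s x : lin F -> (forall mu y, weight T mu y -> weight T (mu + zrow s) (F y)) ->
  reps x -> reps (E (- s) (F x)).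
Proof.
move=> Fl hF [t [ht ->]]; rewrite (lin_sum Fl) (lin_sum (El _)).
apply: subsp_sum (weights_in_subsp Tl _) _ => u us _; have [w Au] := ht u us.
apply: (weight_in Au); have := weight_E (- s) (hF _ _ w).
by rewrite zrowN addrK.
Qed.

(** A weight vector t has exactly one translate e_k t of representative weight. The basis vectors of
    J are sums of finitely many weight vectors, so finitely many such translates span the
    representative part of everything the basis generates. *)
Lemma reps_finite : exists ys : seq X, forall x, reps x <-> spanned ys x.
Proof.
(* The part of w with representative weights lies in the span of ys. *)
pose S ys w := exists w1 w2, [/\ spanned ys w1, weights_in T (fun mu => ~ rep mu = mu) w2 & w = w1 + w2].
have S_subsp ys : subsp (S ys).
  split.
    exists 0, 0; split; [by case: (spanned_subsp ys)|by case: (weights_in_subsp Tl (fun mu => ~ rep mu = mu))|].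
    by rewrite addr0.
  move=> k _ _ [a [b [h1 h2 ->]]] [a' [b' [h1' h2' ->]]].
  exists (k *: a + a'), (k *: b + b'); split.
  - exact: (proj2 (spanned_subsp ys)).
  - exact: (proj2 (weights_in_subsp Tl _)).
  - by rewrite scalerDr addrACA.
have S_sub ys ys' w : {subset ys <= ys'} -> S ys w -> S ys' w.
  by move=> h [a [b [h1 h2 ->]]]; exists a, b; split=> //; apply: spanned_sub h1.
have gen w : exists ys : seq X, (forall y, y \in ys -> reps y) /\ forall m, S ys (E m w).
  have [s [hs ->]] := catJ_weights w; rewrite big_seq.
  elim/big_rec: _ => [|t x ts [ys [h1 h2]]].
    by exists [::]; split=> // m; rewrite (lin0 (El m)); case: (S_subsp [::]).
  have [wt1 _] := hs t ts; have [k ek] := repE t.1.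
  have wk : weight T (rep t.1) (E k t.2) by rewrite ek; apply: weight_E.
  exists (E k t.2 :: ys); split.
    move=> y; rewrite in_cons => /predU1P[->|]; last exact: h1.
    by apply: weight_in wk; apply: rep_rep.
  move=> m; rewrite (linD (El m)); apply: subspD => //; last first.
    by apply: S_sub (h2 m) => z zy; rewrite in_cons zy orbT.
  have [<-|ne] := eqVneq k m.
    exists (E k t.2), 0; split; [by apply: spanned_mem; rewrite mem_head| |by rewrite addr0].
    by case: (weights_in_subsp Tl (fun mu => ~ rep mu = mu)).
  exists 0, (E m t.2); split; [by case: (spanned_subsp (E k t.2 :: ys))| |by rewrite add0r].
  apply: (weight_in _ (weight_E m wt1)); rewrite rep_add ek => /addrI /zrow_inj e.
  by rewrite e eqxx in ne.
have [_ [[k [v [vs _]]] _]] := proj2 J.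
have [ysf hys] := choice (fun i => gen (v i)).
exists (flatten [seq ysf i | i <- enum 'I_k]).
set ys := flatten _.
have ys_sub i : {subset ysf i <= ys}.
  by move=> y yi; apply/flattenP; exists (ysf i) => //; apply: map_f; rewrite mem_enum.
have ysR y : y \in ys -> reps y.
  by case/flattenP => _ /mapP[i _ ->]; have [h _] := hys i; apply: h.
have spR x : spanned ys x -> reps x by move=> h; apply: (h reps (weights_in_subsp Tl _) ysR).
move=> x; split; last exact: spR.
move=> xR; have [a [b [h1 h2 e]]] : S ys x.
  have [s ->] := vs x; apply: subsp_sum => // t _ _; apply: subspZ => //.
  by have [_ h] := hys t.1.2; apply: S_sub (h _); apply: ys_sub.
(* b = x - a is a sum of vectors of representative weights and also of vectors of other weights. *)
have b0 : b = 0.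
  apply: (@weights_in_disjoint _ _ _ Tl (fun mu => rep mu = mu) b) => //.
  have -> : b = x - a by rewrite e addrC addKr.
  by apply: (subspB (weights_in_subsp Tl _)) => //; apply: spR.
by rewrite e b0 addr0.
Qed.

(** The parameter lam is 0 here: the weights on U are recorded by the operators [Dc j 0], which need
    not be scalar. *)
Lemma catJ_structure : exists d (Dc : 'I_n -> Zn n -> 'End('rV[C]_d)) (Gc : Zn n -> L -> 'End('rV[C]_d)),
  jetrel br Dc Gc /\ g_iso (tmodel 0 Dc Gc) M.
Proof.
have [ys hys] := reps_finite.
have [d [io [iol ioi ios]]] := spanned_basis ys.
have ioR u : reps (io u) by apply/hys/ios; exists u.
have ioS x : reps x -> exists u, x = io u by move=> /hys/ios.
have io_inj : injective io.
  move=> u v e; apply/eqP; rewrite -subr_eq0; apply/eqP; apply: ioi.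
  by rewrite (linB iol) e subrr.
have op (F : X -> X) s : lin F -> (forall mu y, weight T mu y -> weight T (mu + zrow s) (F y)) ->
    exists A : 'End('rV[C]_d), forall u, io (A u) = E (- s) (F (io u)).
  move=> Fl hF.
  have [g hg] := choice (fun u => ioS _ (reps_shift Fl hF (ioR u))).
  have gl : lin g by move=> k u v; apply: io_inj; rewrite iol -!hg iol Fl El.
  by exists (linfun (mklin gl)) => u; rewrite lfunE /= -hg.
have [Dc0 hD0] := choice (fun p : 'I_n * Zn n => op _ p.2 (Dl p.1 p.2) (fun mu y => @weight_D mu p.1 p.2 y)).
have [Gc0 hG0] := choice (fun p : Zn n * L => op _ p.1 (Gl p.1 p.2) (fun mu y => @weight_G mu p.1 p.2 y)).
pose Dc j s := Dc0 (j, s); pose Gc s a := Gc0 (s, a).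
have hD j s u : io (Dc j s u) = E (- s) (D j s (io u)) := hD0 (j, s) u.
have hG s a u : io (Gc s a u) = E (- s) (G s a (io u)) := hG0 (s, a) u.
have JR : jetrel br Dc Gc.
  split.
  - move=> s k a b; apply/lfunP => u; apply: io_inj.
    by rewrite add_lfunE scale_lfunE iol !hG Glin El.
  - move=> j k s m; apply/lfunP => u; apply: io_inj.
    rewrite comE !(add_lfunE, opp_lfunE, scale_lfunE).
    rewrite !(linB iol, linZ iol, linD iol, linN iol) !hD.
    (* Moving e_(-m) and e_(-s) across by (J3) produces the terms that [jetrel] subtracts; the rest
       is the bracket relation multiplied by e_(-(s+m)). *)
    move: (io u) => x; rewrite !J3 !(linD (El _), linZ (El _)) !EE.
    have e := congr1 (E (- (s + m))) (DD j k s m x).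
    rewrite !(linB (El _), linZ (El _)) in e.
    have s1 : - s + (- m + s) = - m by rewrite addrCA addNr addr0.
    have s2 : - m + (- s + m) = - s by rewrite addrCA addNr addr0.
    have s3 : - s - m = - (s + m) by rewrite opprD.
    have s4 : - m - s = - (s + m) by rewrite opprD addrC.
    rewrite s1 s2 s3 s4 !zcN.
    rewrite -[E (- (s + m)) (D j s _)](subrK (E (- (s + m)) (D k m (D j s x)))) e.
    by lmod_over C.
  - move=> j s m a; apply/lfunP => u; apply: io_inj.
    rewrite comE !(add_lfunE, opp_lfunE, scale_lfunE).
    rewrite !(linB iol, linZ iol, linD iol, linN iol) !(hD, hG).
    move: (io u) => x; rewrite J3 J4 !(linD (El _), linZ (El _)) !EE.
    have e := congr1 (E (- (s + m))) (DG j s m a x).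
    rewrite !(linB (El _), linZ (El _)) in e.
    have s1 : - s + (- m + s) = - m by rewrite addrCA addNr addr0.
    have s3 : - s - m = - (s + m) by rewrite opprD.
    have s4 : - m - s = - (s + m) by rewrite opprD addrC.
    rewrite s1 s3 s4 !zcN.
    rewrite -[E (- (s + m)) (D j s _)](subrK (E (- (s + m)) (G m a (D j s x)))) e.
    by lmod_over C.
  - move=> s m a b; apply/lfunP => u; apply: io_inj.
    rewrite comE (linB iol) !hG.
    move: (io u) => x; rewrite !J4 !EE.
    have s3 : - s - m = - (s + m) by rewrite opprD.
    have s4 : - m - s = - (s + m) by rewrite opprD addrC.
    by rewrite s3 s4 -(linB (El _)) GG.
exists d, Dc, Gc; split=> //.
pose psi := tens_map (fun m u => E m (io u)).
have hl m : lin (fun u => E m (io u)) by apply: lin_comp.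
have psil : lin psi := tens_map_lin hl.
have psi_sg m u : psi (single m u) = E m (io u) := tens_map_single hl m u.
exists psi; split=> //.
  apply: bij_of_inj_surj => // [f f0|w]; last first.
    have [s [hs ->]] := catJ_weights w.
    apply: (@subsp_sum X (fun y => exists x, psi x = y)).
      split; first by exists 0; rewrite (lin0 psil).
      by move=> k _ _ [a <-] [b <-]; exists (k *: a + b); rewrite psil.
    move=> t ts _; have [w1 _] := hs t ts; have [k ek] := repE t.1.
    (* The translation that takes the weight of t to its representative moves t into U. *)
    have [u hu] : exists u, E k t.2 = io u.
      apply: ioS; apply: (@weight_in _ _ _ _ (rep t.1)); first exact: rep_rep.
      by rewrite ek; apply: weight_E.
    by exists (single (- k) u); rewrite psi_sg -hu EE addNr E0.
  apply: tens_eq => m0; rewrite tval0; apply: ioi.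
  have [s us e] := tens_sum f.
  have [m0s|m0s] := boolP (m0 \in s); last first.
    rewrite e tval_sum big1_seq ?(lin0 iol) // => k /andP[_ ks]; rewrite tval_single; case: eqP => // mk.
    by rewrite mk ks in m0s.
  suff h0 : E m0 (io (tval f m0)) = 0.
    by have := congr1 (E (- m0)) h0; rewrite EE addNr E0 (lin0 (El _)).
  (* The weights of e_m0 U. By [rep_shift] those of the other summands lie outside A, so the summand
     at m0, being minus the sum of the others, is zero. *)
  pose A mu := exists2 nu, rep nu = nu & mu = nu + zrow m0.
  apply: (@weights_in_disjoint _ _ _ Tl A).
    by apply: weights_inE (ioR _) => mu hmu; exists mu.
  move: f0; rewrite {1}e (lin_sum psil) (bigD1_seq m0) //= psi_sg => /eqP.
  rewrite addr_eq0 => /eqP ->; rewrite -scaleN1r; apply: subspZ (weights_in_subsp Tl _) _.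
  apply: subsp_sum (weights_in_subsp Tl _) _ => k ks km; rewrite psi_sg.
  apply: weights_inE (ioR _) => mu hmu [nu hnu enu].
  by move: km; rewrite (rep_shift hmu hnu enu) eqxx.
case=> [[k|[j s]]|[s a]].
- apply: lin_tens_eq.
  + by apply: lin_comp => //; exact: tE_lin.
  + by apply: lin_comp => //; exact: El.
  + by move=> m v; rewrite -[gops _ _ _]/(gE (tmodel 0 Dc Gc) k _) -[gops _ _ _]/(E k _) tE_single !psi_sg EE addrC.
- apply: lin_tens_eq.
  + by apply: lin_comp => //; exact: tD_lin.
  + by apply: lin_comp => //; exact: Dl.
  + move=> m v; rewrite -[gops _ _ _]/(gD (tmodel 0 Dc Gc) j s _) -[gops _ _ _]/(D j s _).
    rewrite tD_single !psi_sg mxE addr0 iol El J3 hD EE.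
    by rewrite addrK.
- apply: lin_tens_eq.
  + by apply: lin_comp => //; exact: tG_lin.
  + by apply: lin_comp => //; exact: Gl.
  + move=> m v; rewrite -[gops _ _ _]/(gG (tmodel 0 Dc Gc) s a _) -[gops _ _ _]/(G s a _).
    by rewrite tG_single !psi_sg J4 hG EE addrK.
Qed.

End Structure.

(** * Polynomial modules, nilpotency and isomorphisms *)

Section PolyFun.
Variable n : nat.
Implicit Types f g : Zn n -> Zn n -> C.

Lemma poly_fun_eq f g : (forall s m, f s m = g s m) -> poly_fun f -> poly_fun g.
Proof. by move=> h [c hc]; exists c => s m; rewrite -h. Qed.

Lemma poly_funD f g : poly_fun f -> poly_fun g -> poly_fun (fun s m => f s m + g s m).
Proof. by move=> [c hc] [d hd]; exists (c ++ d) => s m; rewrite big_cat hc hd. Qed.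

Lemma poly_fun_sum (I : finType) (F : I -> Zn n -> Zn n -> C) :
  (forall i, poly_fun (F i)) -> poly_fun (fun s m => \sum_i F i s m).
Proof.
move=> h; suff H (r : seq I) : poly_fun (fun s m => \sum_(i <- r) F i s m) by exact: H.
elim: r => [|i r IH]; first by exists [::] => s m; rewrite !big_nil.
apply: poly_fun_eq (poly_funD (h i) IH) => s m; by rewrite big_cons.
Qed.

Lemma mono0 (s : Zn n) : mono s 0 = 1.
Proof. by rewrite /mono big1 // => i _; rewrite mxE expr0. Qed.

Definition eps (p : 'I_n) : mi n := \row_i (i == p : nat).

Lemma mono_eps (s : Zn n) p : mono s (eps p) = zc s p.
Proof.
rewrite /mono (bigD1 p) //= mxE eqxx expr1 big1 ?mulr1 // => i /negPf h.
by rewrite mxE h expr0.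
Qed.

Lemma poly_fun_coefsb b (k : C) : poly_fun (fun s _ : Zn n => coefsb s b * k).
Proof.
exists [:: ((b, 0), k / \prod_(i < n) ((b 0 i)`!)%:R)] => s m.
by rewrite big_seq1 /= mono0 mulr1 /coefsb [RHS]mulrC mulrA mulrAC.
Qed.

Lemma poly_fun_zc j (k : C) : poly_fun (fun _ m : Zn n => zc m j * k).
Proof. by exists [:: ((0, eps j), k)] => s m; rewrite big_seq1 /= mono0 mono_eps mulr1 mulrC. Qed.

Lemma poly_fun_jet (V : vectType C) N (Y : mi n -> 'End(V)) u l :
  poly_fun (fun s _ : Zn n => v2r (jet N Y s u) 0 l).
Proof.
have e s (m : Zn n) : \sum_(b : {ffun 'I_n -> 'I_N}) coefsb s (bx b) * v2r (Y (bx b) u) 0 l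
    = v2r (jet N Y s u) 0 l.
  rewrite /jet sum_lfunE linear_sum summxE; apply: eq_bigr => b _.
  by rewrite scale_lfunE linearZ mxE.
by apply: (poly_fun_eq e); apply: poly_fun_sum => b; apply: poly_fun_coefsb.
Qed.

End PolyFun.

Section PartA.
Variables (n : nat) (L : vectType C) (br : L -> L -> L).

(** In the basis e_0 (x) u_i the structure constants are matrix entries of m_j + lam_j + [Dc j s]
    and of [Gc s a], and [Dc] and [Gc] are jets by interpolation. *)
Lemma polynomial_tmodel (U : vectType C) lam (Dc : 'I_n -> Zn n -> 'End(U)) (Gc : Zn n -> L -> 'End(U)) :
  jetrel br Dc Gc -> polynomial_module (tmodel lam Dc Gc).
Proof.
move=> JR; have [N N0 [oD oG]] := jetrel_finite_order JR.
exists (dim U), (fun i => single 0 (ubase i)),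
  (* The constant lam_j is carried by [coefsb s 0], which is 1, to fit [poly_fun_coefsb]. *)
  (fun j r l s m => zc m j * (l == r)%:R + coefsb s (0 : mi n) * (lam 0 j * (l == r)%:R)
     + v2r (Dc j s (ubase r)) 0 l),
  (fun a r l s m => v2r (Gc s a (ubase r)) 0 l).
split.
- exact: tmodel_Fbasis.
- move=> j r l; apply: poly_funD; first by apply: poly_funD; [exact: poly_fun_zc|exact: poly_fun_coefsb].
  apply: poly_fun_eq (poly_fun_jet N (jetcoef N (Dc j)) (ubase r) l) => s m.
  by rewrite -(jet_jetcoef (oD j)).
- move=> a r l.
  apply: poly_fun_eq (poly_fun_jet N (jetcoef N (Gc^~ a)) (ubase r) l) => s m.
  by rewrite -(jet_jetcoef (oG a)).
- move=> j s m r.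
  rewrite tE_single add0r tD_single {1}[_ *: _ + _]ubase_sum (lin_sum (single_lin _)).
  apply: eq_bigr => l _; rewrite tE_single add0r (linZ (single_lin _)); congr (_ *: _).
  by rewrite linearD linearZ /= !mxE v2r_ubase coefsb0 mul1r mulrDl.
- move=> a s m r.
  rewrite tE_single add0r tG_single {1}[Gc s a _]ubase_sum (lin_sum (single_lin _)).
  by apply: eq_bigr => l _; rewrite tE_single add0r (linZ (single_lin _)).
Qed.

Lemma polynomial_iso (M M' : gmod n L) : g_iso M M' -> polynomial_module M -> polynomial_module M'.
Proof.
case=> phi [pl pb pi] [k [v [f [h [[vs vi] pf ph hD hG]]]]].
have piE m x : phi (gE M m x) = gE M' m (phi x) := pi (inl (inl m)) x.
have piD j s x : phi (gD M j s x) = gD M' j s (phi x) := pi (inl (inr (j, s))) x.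
have piG s a x : phi (gG M s a x) = gG M' s a (phi x) := pi (inr (s, a)) x.
have [psi k1 k2] := pb.
exists k, (fun i => phi (v i)), f, h; split=> //.
- split=> [w|s us].
    have [s e] := vs (psi w); exists s; rewrite -[w]k2 e (lin_sum pl).
    by apply: eq_bigr => t _; rewrite (linZ pl) piE.
  move=> e; apply: vi => //; apply: (can_inj k1); rewrite (lin0 pl) -e (lin_sum pl).
  by apply: eq_bigr => t _; rewrite (linZ pl) piE.
- move=> j s m r; rewrite -piE -piD hD (lin_sum pl).
  by apply: eq_bigr => l _; rewrite (linZ pl) piE.
- move=> a s m r; rewrite -piE -piG hG (lin_sum pl).
  by apply: eq_bigr => l _; rewrite (linZ pl) piE.
Qed.

Lemma catJ_polynomial (M : gmod n L) : catJ br M -> polynomial_module M.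
Proof.
move=> /catJ_structure[d [Dc [Gc [JR iso]]]].
exact: polynomial_iso iso (polynomial_tmodel 0 JR).
Qed.

End PartA.

(** * Degrees of multi-indices *)

Section MIndex.
Variable n : nat.
Implicit Types (a b : mi n) (i j p q : 'I_n).

Lemma eps_neq0 p : eps p != 0.
Proof. by apply/eqP => /rowP /(_ p); rewrite !mxE eqxx. Qed.

Lemma eps_inj : injective (@eps n).
Proof. by move=> p q /rowP /(_ p); rewrite !mxE eqxx; case: eqP. Qed.

Lemma mshift_eps i a : mshift (eps i) a i = a.
Proof. by apply/rowP => l; rewrite !mxE addnC addnK. Qed.

Lemma mshift_eps_r i a : mshift a (eps i) i = a.
Proof. by apply/rowP => l; rewrite !mxE addnK. Qed.

Definition mdeg a : nat := (\sum_i a ord0 i)%N.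

Lemma mdeg_gt0 a : (0 < mdeg a)%N = (a != 0).
Proof.
rewrite lt0n sum_nat_eq0; congr (~~ _); apply/forallP/eqP => [h|-> i].
  by apply/rowP => i; rewrite mxE; have /eqP := h i.
by rewrite mxE.
Qed.

Lemma mdeg_ge a i : (a ord0 i <= mdeg a)%N.
Proof. by rewrite /mdeg (bigD1 i) //= leq_addr. Qed.

Lemma mdegD a b : mdeg (a + b) = (mdeg a + mdeg b)%N.
Proof. by rewrite /mdeg -big_split; apply: eq_bigr => i _; rewrite mxE. Qed.

Lemma mdeg_pred (c : mi n) j : c 0 j != 0%N -> (mdeg (mpred c j)).+1 = mdeg c.
Proof.
move=> cj; rewrite /mdeg [in RHS](bigD1 j) //= (bigD1 j) //= !mxE eqxx subn1 -addSn prednK ?lt0n //.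
by congr (_ + _)%N; apply: eq_bigr => i /negPf h; rewrite mxE h subn0.
Qed.

Lemma mdeg_mshift a b j : (a 0 j != 0%N) || (b 0 j != 0%N) ->
  (mdeg (mshift a b j)).+1 = (mdeg a + mdeg b)%N.
Proof.
move=> h; rewrite mshiftE mdeg_pred ?mdegD // mxE.
by rewrite -[(_ + _)%R]/(a ord0 j + b ord0 j)%N addn_eq0 negb_and.
Qed.

Lemma mdeg_eps p : mdeg (eps p) = 1%N.
Proof.
by rewrite /mdeg (bigD1 p) //= mxE eqxx big1 // => i /negPf h; rewrite mxE h.
Qed.

Lemma mdeg1 a : mdeg a = 1%N -> exists p, a = eps p.
Proof.
move=> h; have [p hp] : exists p, a 0 p != 0%N.
  apply/existsP; rewrite -negb_forall; apply/negP => /forallP z.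
  by move: h; rewrite /mdeg big1 // => i _; apply/eqP.
exists p; apply/rowP => i; rewrite mxE.
have e := mdeg_pred hp; rewrite h in e; case: e => /eqP.
rewrite sum_nat_eq0 => /forallP /(_ i) /=; rewrite mxE.
have [->|_] := eqVneq i p; last by rewrite subn0 => /eqP.
by rewrite subn_eq0 => le; apply/eqP; rewrite eqn_leq le lt0n.
Qed.

End MIndex.

(** * Vanishing of the operators of g^+ of high order *)

Section GpFacts.
Variables (n : nat) (L : vectType C) (br : L -> L -> L).
Implicit Types U : gpmod n L.

(** The adjoint action of z_i d/dz_i is diagonal in the monomial basis. This gives the finiteness of
    the sums and, summed over i, the grading by the Euler field. *)
Lemma com_EP U i a j : is_gpmod br U -> a != 0 ->
  com (gpP U (eps i) i) (gpP U a j) = ((a 0 i)%:R - (j == i)%:R) *: gpP U a j.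
Proof.
case=> _ hP _ _ a0; apply/lfunP => v; rewrite comE hP ?eps_neq0 // mshift_eps scale_lfunE mxE.
case: eqVneq => [->|_]; last by rewrite scale0r !subr0.
by rewrite mshift_eps scalerBl.
Qed.

Lemma com_EQ U i b x : is_gpmod br U ->
  com (gpP U (eps i) i) (gpQ U b x) = (b 0 i)%:R *: gpQ U b x.
Proof.
case=> _ _ hQ _; apply/lfunP => v; rewrite comE hQ ?eps_neq0 // mshift_eps scale_lfunE.
by [].
Qed.

(** A nonzero operator of z^a d/dz_j would be an eigenvector in End(U) of eigenvalue a_i - 1 or a_i,
    according as j = i or not, and z^b x one of eigenvalue b_i; the spectrum is finite. Hence the
    two bounds for the offsets -1 and 0. *)
Lemma gp_vanish_exists U : is_gpmod br U -> exists N, gp_vanish U N.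
Proof.
move=> hU.
have Hi (i : 'I_n) : exists N, (forall (a : mi n) j, a != 0 -> (N <= a ord0 i)%N -> gpP U a j = 0) /\
   (forall (b : mi n) x, (N <= b ord0 i)%N -> gpQ U b x = 0).
  have [N1 h1] := fin_eig (-1) (com_linr (gpP U (eps i) i)).
  have [N2 h2] := fin_eig 0 (com_linr (gpP U (eps i) i)).
  exists (maxn N1 N2); split=> [a j a0|b x]; rewrite geq_max => /andP[l1 l2].
    have e := com_EP i j hU a0; move: e; case: eqVneq => _ e.
      by apply: (h1 _ l1); rewrite e addrC.
    by apply: (h2 _ l2); rewrite e subr0 add0r.
  by apply: (h2 _ l2); rewrite com_EQ // add0r.
have [f hf] := fin_all_exists Hi.
have big i (a : mi n) : ((\max_i f i).+1 <= a ord0 i)%N -> (f i <= a ord0 i)%N.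
  by move=> h; apply: leq_trans (ltnW h); apply: leq_bigmax.
exists (\max_i f i).+1; split=> [a j [i hi]|b x [i hi]].
  have [h _] := hf i; apply: h; last exact: big.
  by apply: contraTneq hi => ->; rewrite mxE.
by have [_ h] := hf i; apply: h; apply: big.
Qed.

Lemma gp_vanish_le U N K : (N <= K)%N -> gp_vanish U N -> gp_vanish U K.
Proof.
move=> le [h1 h2]; split=> [a j [i hi]|b x [i hi]]; [apply: h1|apply: h2]; exists i; exact: leq_trans le hi.
Qed.

Lemma Jjet_widen lam U N K : (N <= K)%N -> gp_vanish U N -> Jjet lam U K = Jjet lam U N.
Proof.
move=> le hv; rewrite /Jjet.
have -> : jetD U K = jetD U N.
  by apply/funext => j; apply/funext => s; rewrite !jetDE (jet_widen _ le (supp_P j hv)).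
have -> // : jetG U K = jetG U N.
by apply/funext => s; apply/funext => x; rewrite !jetGE (jet_widen _ le (supp_Q x hv)).
Qed.

End GpFacts.

(** * Isomorphisms between models *)

Section ModelIso.
Variables (n : nat) (L : vectType C) (U U' : vectType C) (lam lam' : 'rV[C]_n).
Variables (Dc : 'I_n -> Zn n -> 'End(U)) (Gc : Zn n -> L -> 'End(U)).
Variables (Dc' : 'I_n -> Zn n -> 'End(U')) (Gc' : Zn n -> L -> 'End(U')).
Hypotheses (D0 : forall j, Dc j 0 = 0) (D0' : forall j, Dc' j 0 = 0).
Local Notation M := (tmodel lam Dc Gc).
Local Notation M' := (tmodel lam' Dc' Gc').

(** An isomorphism preserves weights, and in either model distinct fibres have distinct weights.
    Hence e_0 (x) U is mapped onto one fibre e_m0 (x) U', with m0 = lam - lam', and the operators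
    e_(-s) d_j(s) and e_(-s) (e_s a) carry over to it. *)
Lemma tmodel_iso_fwd : nonzero U -> g_iso M M' ->
  lam_equiv lam lam' /\ isomorphic (uops Dc Gc) (uops Dc' Gc').
Proof.
move=> [u u0] [phi [pl [psi k1 k2] pi]].
have piE m x : phi (gE M m x) = gE M' m (phi x) := pi (inl (inl m)) x.
have piD j s x : phi (gD M j s x) = gD M' j s (phi x) := pi (inl (inr (j, s))) x.
have piG s a x : phi (gG M s a x) = gG M' s a (phi x) := pi (inr (s, a)) x.
have phi0 x : phi x = 0 -> x = 0 by move=> e; apply: (can_inj k1); rewrite e (lin0 pl).
have sg0 v : single 0 v = 0 :> tens n U -> v = 0.
  by move=> /(congr1 (fun f => tval f 0)); rewrite tval_single eqxx.
have wt' v m j : (zc m j + lam' 0 j) *: tval (phi (single 0 v)) m = lam 0 j *: tval (phi (single 0 v)) m.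
  have := piD j 0 (single 0 v); rewrite tD_single addr0 zc0 add0r D0 zero_lfunE addr0.
  rewrite (linZ (single_lin _)) (linZ pl) => /(congr1 (fun f : tens n U' => tval f m)).
  by rewrite tvalZ tval_tD subr0 D0' zero_lfunE addr0.
have [m0 hm0] : exists m, tval (phi (single 0 u)) m <> 0.
  apply: contrapT => h; apply: u0; apply: sg0; apply: phi0; apply: tens_eq => m.
  by apply: contrapT => hm; apply: h; exists m.
have eqm v m : tval (phi (single 0 v)) m <> 0 -> forall j, zc m j + lam' 0 j = lam 0 j.
  move=> hm j; have /eqP := wt' v m j; rewrite -subr_eq0 -scalerBl scaler_eq0.
  by case/orP => /eqP // /eqP; rewrite subr_eq0 => /eqP.
have e0 := eqm u m0 hm0.
have [f hphi] : exists f : U -> U', forall v, phi (single 0 v) = single m0 (f v).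
  exists (fun v => tval (phi (single 0 v)) m0) => v.
  apply: tens_eq => m; rewrite tval_single; case: eqVneq => [->//|ne].
  apply: contrapT => hm; case/eqP: ne; apply: zc_inj => j.
  by apply: (addIr (lam' 0 j)); rewrite (eqm v m hm) e0.
split; first by exists m0 => j; rewrite -e0 addrK.
have sg_inj (W : lmodType C) m (x y : W) : single m x = single m y -> x = y.
  by move=> /(congr1 (fun f => tval f m)); rewrite !tval_single eqxx.
have fl : lin f by move=> k x y; apply: (@sg_inj _ _ m0); rewrite single_lin -!hphi single_lin pl.
exists f; split=> //.
  apply: bij_of_inj_surj => // [v fv0|v'].
    by apply: sg0; apply: phi0; rewrite hphi fv0 (lin0 (single_lin _)).
  (* The preimage of e_m0 (x) v' has weight lam, so it lies in the fibre at 0. *)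
  exists (tval (psi (single m0 v')) 0); apply: (@sg_inj _ _ m0); rewrite -hphi.
  have -> : single 0 (tval (psi (single m0 v')) 0) = psi (single m0 v'); last by rewrite k2.
  have wp m j : (zc m j + lam 0 j) *: tval (psi (single m0 v')) m = lam 0 j *: tval (psi (single m0 v')) m.
    have : gD M j 0 (psi (single m0 v')) = lam 0 j *: psi (single m0 v').
      apply: (can_inj k1); rewrite piD k2 (linZ pl) k2 tD_single addr0 D0' zero_lfunE addr0 e0.
      by rewrite (linZ (single_lin _)).
    move=> /(congr1 (fun f : tens n U => tval f m)).
    by rewrite tvalZ tval_tD subr0 D0 zero_lfunE addr0.
  apply: tens_eq => m; rewrite tval_single; case: eqVneq => [->//|ne].
  apply: contrapT => hm; case/eqP: ne; apply: zc_inj => j; rewrite zc0.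
  have /eqP := wp m j; rewrite -subr_eq0 -scalerBl scaler_eq0 addrK => /orP[/eqP //|/eqP z].
  by case: hm.
case=> [[j s]|[s a]] v; rewrite /uops; apply: (@sg_inj _ _ m0); rewrite -hphi.
  have := piE (- s) (gD M j s (single 0 v)); rewrite piD tD_single tE_single add0r subrr zc0 add0r.
  rewrite (linD (single_lin _)) (linZ (single_lin _)) (linD pl) (linZ pl).
  rewrite [phi (single 0 v)]hphi tD_single tE_single addrK.
  by rewrite (linD (single_lin _)) (linZ (single_lin _)) e0 => /addrI.
have := piE (- s) (gG M s a (single 0 v)).
by rewrite piG tG_single tE_single add0r subrr [phi (single 0 v)]hphi tG_single tE_single addrK.
Qed.

(** With lam = lam' + k, sending e_m (x) u to e_(m+k) (x) f u matches the weights. *)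
Lemma tmodel_iso_bwd : lam_equiv lam lam' -> isomorphic (uops Dc Gc) (uops Dc' Gc') -> g_iso M M'.
Proof.
move=> [k hk] [f [fl [g k1 k2] fi]].
have hl m : lin (fun u => single (m + k) (f u) : tens n U') by apply: lin_comp => //; exact: single_lin.
pose phi := tens_map (fun m u => single (m + k) (f u) : tens n U').
have pl : lin phi := tens_map_lin hl.
have psg m u : phi (single m u) = single (m + k) (f u) := tens_map_single hl m u.
have fD j s u : f (Dc j s u) = Dc' j s (f u) := fi (inl (j, s)) u.
have fG s a u : f (Gc s a u) = Gc' s a (f u) := fi (inr (s, a)) u.
exists phi; split=> //.
  have gl : lin g by move=> c x y; apply: (can_inj k1); rewrite fl !k2.
  have hl' m : lin (fun u => single (m - k) (g u) : tens n U) by apply: lin_comp => //; exact: single_lin.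
  pose psi := tens_map (fun m u => single (m - k) (g u) : tens n U).
  have psl : lin psi := tens_map_lin hl'.
  have pssg m u : psi (single m u) = single (m - k) (g u) := tens_map_single hl' m u.
  exists psi.
    by apply: (lin_tens_eq (g := id)) => //; [exact: lin_comp|move=> m v; rewrite psg pssg addrK k1].
  by apply: (lin_tens_eq (g := id)) => //; [exact: lin_comp|move=> m v; rewrite pssg psg subrK k2].
case=> [[m'|[j s]]|[s a]].
- apply: lin_tens_eq; [by apply: lin_comp => //; exact: tE_lin|by apply: lin_comp => //; exact: tE_lin|].
  by move=> m v; rewrite !gopsE tE_single !psg tE_single addrAC.
- apply: lin_tens_eq; [by apply: lin_comp => //; exact: tD_lin|by apply: lin_comp => //; exact: tD_lin|].
  move=> m v; rewrite !gopsD tD_single !psg tD_single addrAC; congr single.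
  by rewrite fl fD zcD -[zc k j]hk; congr (_ *: _ + _); ring.
- apply: lin_tens_eq; [by apply: lin_comp => //; exact: tG_lin|by apply: lin_comp => //; exact: tG_lin|].
  by move=> m v; rewrite !gopsG tG_single !psg tG_single addrAC fG.
Qed.

End ModelIso.

(** * The correspondences *)

Section PartB.
Variables (n : nat) (L : vectType C) (br : L -> L -> L).
Implicit Types U : gpmod n L.

(** An intertwiner passes through jets by linearity; the converse compares coefficients, both
    operators being zero at indices outside the box. *)
Lemma gp_iso_uops U U' K : gp_vanish U K -> gp_vanish U' K ->
  gp_iso U U' <-> isomorphic (uops (jetD U K) (jetG U K)) (uops (jetD U' K) (jetG U' K)).
Proof.
move=> hv hv'.
have jet_ev (W : vectType C) (Y : mi n -> 'End(W)) s u : jet K Y s u = jet K (fun b => Y b u) s.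
  by rewrite /jet sum_lfunE; apply: eq_bigr => b _; rewrite scale_lfunE.
have jet_lin (V W : lmodType C) (f : V -> W) Y (s : Zn n) : lin f -> f (jet K Y s) = jet K (fun b => f (Y b)) s.
  by move=> fl; rewrite /jet (lin_sum fl); apply: eq_bigr => b _; rewrite (linZ fl).
split=> -[f [fl fb fi]]; exists f; split=> //.
  have fP a j v (a0 : a != 0) : f (gpP U a j v) = gpP U' a j (f v) := fi (inl (Sub a a0, j)) v.
  have fQ b x v : f (gpQ U b x v) = gpQ U' b x (f v) := fi (inr (b, x)) v.
  case=> [[j s]|[s x]] v /=.
    rewrite !jetDE !jet_ev jet_lin //; apply: eq_jet => b _; rewrite /gpP0.
    by case: eqVneq => [_|b0]; rewrite ?zero_lfunE ?(lin0 fl) // fP.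
  by rewrite !jetGE !jet_ev jet_lin //; apply: eq_jet => b _; rewrite fQ.
have fD j s v : f (jetD U K j s v) = jetD U' K j s (f v) := fi (inl (j, s)) v.
have fG s x v : f (jetG U K s x v) = jetG U' K s x (f v) := fi (inr (s, x)) v.
case=> [[[a a0] j]|[b x]] v /=.
  have -> : gpP U a j = gpP0 U j a by rewrite /gpP0 (negPf a0).
  have -> : gpP U' a j = gpP0 U' j a by rewrite /gpP0 (negPf a0).
  have [ia|ia] := boolP (inbox K a); last first.
    by rewrite (supp_P j hv ia) (supp_P j hv' ia) !zero_lfunE (lin0 fl).
  apply/eqP; rewrite -subr_eq0; apply/eqP.
  apply: (@jet_inj _ _ K (fun a => f (gpP0 U j a v) - gpP0 U' j a (f v)) _ a ia) => s.
  by rewrite jetB -(jet_lin _ _ f (fun a => gpP0 U j a v)) // -!jet_ev -!jetDE fD subrr.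
have [ib|ib] := boolP (inbox K b); last first.
  by rewrite (supp_Q x hv ib) (supp_Q x hv' ib) !zero_lfunE (lin0 fl).
apply/eqP; rewrite -subr_eq0; apply/eqP.
apply: (@jet_inj _ _ K (fun b => f (gpQ U b x v) - gpQ U' b x (f v)) _ b ib) => s.
rewrite jetB -(jet_lin _ _ f (fun b => gpQ U b x v)) // -(jet_ev _ (fun b => gpQ U b x)).
by rewrite -(jet_ev _ (fun b => gpQ U' b x)) -!jetGE fG subrr.
Qed.

Lemma Jjet_isoP lam lam' U U' N N' : nonzero (gpcar U) -> gp_vanish U N -> gp_vanish U' N' ->
  g_iso (Jjet lam U N) (Jjet lam' U' N') <-> lam_equiv lam lam' /\ gp_iso U U'.
Proof.
move=> nz hv hv'.
(* Both modules are rewritten with the common bound max(N, N'). *)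
have w := gp_vanish_le (leq_maxl N N') hv; have w' := gp_vanish_le (leq_maxr N N') hv'.
rewrite -(Jjet_widen _ (leq_maxl N N') hv) -(Jjet_widen _ (leq_maxr N N') hv').
have P := gp_iso_uops w w'; split.
  by move/(tmodel_iso_fwd (jetD0 U _) (jetD0 U' _) nz) => [h1 h2]; split=> //; apply/P.
by case=> h1 /P h2; apply: tmodel_iso_bwd.
Qed.

(** By [jetrel] at s = 0 the operators [Dc j 0] commute with all others, so sums of their joint
    eigenspaces are invariant and indecomposability leaves one joint eigenspace. *)
Lemma indec_scalar (U : vectType C) (Dc : 'I_n -> Zn n -> 'End(U)) (Gc : Zn n -> L -> 'End(U)) :
  jetrel br Dc Gc -> (forall u, weights_in (fun j => Dc j 0 : U -> U) (fun=> True) u) ->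
  indecomposable (uops Dc Gc) -> exists lam : 'rV[C]_n, forall j, Dc j 0 = lam 0 j *: \1%VF.
Proof.
move=> [_ R1 R2 _] hw [[u u0] hi].
pose T := fun j => Dc j 0 : U -> U.
have Tl j : lin (T j) by exact: lfun_lin.
have [lam [v wv v0]] : exists lam, exists2 v, weight T lam v & v <> 0.
  apply: contrapT => h; apply: u0; have [s [hs ->]] := hw u.
  rewrite big1_seq // => t /andP[_ ts]; apply: contrapT => t0; apply: h.
  by exists t.1, t.2 => //; have [] := hs t ts.
have cD k j s x : Dc k 0 (Dc j s x) = Dc j s (Dc k 0 x).
  by apply/eqP; rewrite -subr_eq0 -comE R1 add0r zc0 scale0r subrr scaler0 subr0 zero_lfunE.
have cG k s a x : Dc k 0 (Gc s a x) = Gc s a (Dc k 0 x).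
  by apply/eqP; rewrite -subr_eq0 -comE R2 add0r subrr scaler0 zero_lfunE.
have inv A : Defs.invariant (uops Dc Gc) (weights_in T A).
  have sA := weights_in_subsp Tl A; split; [by case: sA|by case: sA|].
  have key (F : 'End(U)) x : (forall k y, Dc k 0 (F y) = F (Dc k 0 y)) -> weights_in T A x -> weights_in T A (F x).
    move=> cF [s [hs ->]]; rewrite linear_sum; apply: subsp_sum => // t ts _.
    have [w At] := hs t ts; apply: (weight_in At) => j; rewrite /T cF.
    by rewrite -[Dc j 0 _]/(T j _) w linearZ.
  by case=> [[j s]|[s a]] x hx /=; apply: key => // k y; rewrite ?cD ?cG.
exists lam => j; apply/lfunP => x; rewrite scale_lfunE id_lfunE.
(* Weight lam against all other weights: two complementary invariant subspaces, the first of which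
   contains v. *)
have [] := hi _ _ (inv (fun mu => mu = lam)) (inv (fun mu => mu <> lam)).
- by move=> y; exact: (weights_in_cases Tl (fun mu => mu = lam) (hw y)).
- by move=> y; apply: (weights_in_disjoint Tl (A := fun mu => mu = lam)).
- by move=> z; case: v0; apply: z; apply: (weight_in _ wv).
move=> z; have [a [b [ha hb ->]]] := weights_in_cases Tl (fun mu => mu = lam) (hw x).
rewrite (z b hb) addr0; have [s [hs ->]] := ha.
rewrite linear_sum scaler_sumr; apply: eq_big_seq => t ts.
by have [w e] := hs t ts; rewrite -e; apply: w.
Qed.

(** With lam = 0, d_j(0) acts on the fibre at 0 as [Dc j 0]; the components at 0 of weight vectors
    are thus again weight vectors. *)
Lemma weights_pull (U : vectType C) (Dc : 'I_n -> Zn n -> 'End(U)) (Gc : Zn n -> L -> 'End(U)) (M : gmod n L) :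
  catJ br M -> g_iso (tmodel 0 Dc Gc) M -> forall u, weights_in (fun j => Dc j 0 : U -> U) (fun=> True) u.
Proof.
move=> J [phi [pl [psi k1 k2] pi]] u.
have piD j s x : phi (gD (tmodel 0 Dc Gc) j s x) = gD M j s (phi x) := pi (inl (inr (j, s))) x.
have psl : lin psi by move=> c x y; apply: (can_inj k1); rewrite pl !k2.
have [s [hs e]] := catJ_weights J (phi (single 0 u)).
exists [seq (t.1, tval (psi t.2) 0) | t <- s]; rewrite big_map; split; last first.
  by rewrite -tval_sum -(lin_sum psl) -e k1 tval_single eqxx.
move=> _ /mapP[t ts ->]; split=> // j /=; have [w _] := hs t ts.
have : gD (tmodel 0 Dc Gc) j 0 (psi t.2) = t.1 0 j *: psi t.2.
  by apply: (can_inj k1); rewrite piD (linZ pl) !k2 w.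
move=> /(congr1 (fun f : tens n U => tval f 0)).
by rewrite tvalZ tval_tD subr0 zc0 mxE addr0 scale0r add0r.
Qed.

Lemma catJ_jet (M : gmod n L) : catJ br M -> g_indec M ->
  exists (lam : 'rV[C]_n) (U : gpmod n L) (N : nat),
    [/\ is_gpmod br U, gp_indec U, gp_vanish U N & g_iso M (Jjet lam U N)].
Proof.
move=> J indM; have [d [Dc [Gc [JR iso]]]] := catJ_structure J.
have ind0 : indecomposable (gops (tmodel 0 Dc Gc)).
  by apply: iso_indecomposable indM; apply: iso_sym.
have [lam hlam] := indec_scalar JR (weights_pull J iso) (indec_tens ind0).
(* Scalars are central and cancel in the differences, so [jetrel] survives the subtraction. *)
pose Dl j s := Dc j s - lam 0 j *: \1%VF.
have Dl0 j : Dl j 0 = 0 by rewrite /Dl hlam subrr.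
have com1 A k : com A (k *: \1%VF) = 0.
  by apply/lfunP => v; rewrite comE !scale_lfunE !id_lfunE zero_lfunE linearZ subrr.
have com1' A k : com (k *: \1%VF) A = 0.
  by apply/lfunP => v; rewrite comE !scale_lfunE !id_lfunE zero_lfunE linearZ subrr.
have JRl : jetrel br Dl Gc.
  case: JR => R4 R1 R2 R3; split; [exact: R4| | |exact: R3].
  - move=> j k s m; rewrite /Dl (linB (com_linr _)) com1 subr0 (linB (com_linl _)) com1' subr0 R1.
    by lmod_over C.
  - by move=> j s m a; rewrite /Dl (linB (com_linl _)) com1' subr0 R2.
have [N N0 [oD oG]] := jetrel_finite_order JRl.
(* The module is read off by interpolation; [jetcoef] is zero outside the box, which gives
   [gp_vanish]. *)
pose U := GPMod (fun b j => jetcoef N (Dl j) b) (fun b x => jetcoef N (Gc^~ x) b).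
have hv : gp_vanish U N.
  split=> [a j|b x] [i hi]; apply: jetcoef_out; apply/negP => /inboxP /(_ i); by rewrite ltnNge hi.
have eD : jetD U N = Dl.
  apply/funext => j; apply/funext => s; rewrite jetDE [RHS](jet_jetcoef (oD j)).
  (* At b = 0 [gpP0] is zero by convention; the interpolated coefficient there is the value at s =
     0, which [Dl0] makes zero. *)
  apply: eq_jet => b _; rewrite /gpP0; case: eqP => // -> /=.
  by rewrite -(jet_at0 (jetcoef N (Dl j)) N0) -(jet_jetcoef (oD j)) Dl0.
have eG : jetG U N = Gc.
  by apply/funext => s; apply/funext => x; rewrite jetGE [RHS](jet_jetcoef (oG x)).
have iso1 : g_iso (tmodel 0 Dc Gc) (Jjet lam U N).
  rewrite /Jjet eD eG; exists id; split=> //; first by exists id.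
  case=> [[k|[j s]]|[s a]] f //; apply: tens_eq => m.
  rewrite -[gops _ _ _]/(gD (tmodel 0 Dc Gc) j s f) -[id f]/f gopsD !tval_tD mxE /Dl.
  rewrite add_lfunE opp_lfunE scale_lfunE id_lfunE; lmod_over C.
have hU : is_gpmod br U by apply/(gp_jetrelP br hv); rewrite eD eG.
have isoM : g_iso M (Jjet lam U N) := iso_trans (iso_sym iso) iso1.
exists lam, U, N; split=> //; apply/(gp_indecP hv lam).
exact: iso_indecomposable isoM indM.
Qed.

End PartB.

(** * Irreducible modules: from g^+ to gl_n and gdot *)

Section PartC.
Variables (n : nat) (L : vectType C) (br : L -> L -> L).
Implicit Types U : gpmod n L.

(** As b_j is nonzero, the degree of a + b drops by exactly one, so degrees above 1 and at least 1
    give a degree above 1. *)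
Lemma mshift_gt1 (a b : mi n) j : (1 < mdeg a)%N -> b != 0 -> (b 0 j)%:R != 0 :> C ->
  (1 < mdeg (mshift a b j))%N.
Proof.
rewrite pnatr_eq0 -mdeg_gt0 => ha hb bj.
have e : (mdeg (mshift a b j)).+1 = (mdeg a + mdeg b)%N by rewrite mdeg_mshift // bj orbT.
by rewrite -ltnS e -(addn1 2) leq_add.
Qed.

Lemma mshift_gt1l (a b : mi n) j : a != 0 -> (1 < mdeg b)%N -> (b 0 j)%:R != 0 :> C ->
  (1 < mdeg (mshift a b j))%N.
Proof.
rewrite pnatr_eq0 -mdeg_gt0 => ha hb bj.
have e : (mdeg (mshift a b j)).+1 = (mdeg a + mdeg b)%N by rewrite mdeg_mshift // bj orbT.
by rewrite -ltnS e addnC -(addn1 2) leq_add.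
Qed.

Lemma mshiftC (a b : mi n) j : mshift a b j = mshift b a j.
Proof. by rewrite !mshiftE addrC. Qed.

(* The Euler field acts with a top eigenvalue, and its eigenvectors are killed by everything of
   positive degree. *)
Lemma irr_positive U : is_gpmod br U -> irreducible (gpops U) ->
  (forall a j, (1 < mdeg a)%N -> gpP U a j = 0) /\ (forall b x, b != 0 -> gpQ U b x = 0).
Proof.
move=> hU [nz hirr]; have [_ hP hQ hG] := hU.
pose Eu := \sum_i gpP U (eps i) i.
have natS (a : mi n) : \sum_i (a 0 i)%:R = (mdeg a)%:R :> C by rewrite natr_sum.
have euP a j v : a != 0 -> Eu (gpP U a j v) = gpP U a j (Eu v) + ((mdeg a)%:R - 1) *: gpP U a j v.
  move=> a0; rewrite /Eu !sum_lfunE linear_sum.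
  have e i : gpP U (eps i) i (gpP U a j v) = gpP U a j (gpP U (eps i) i v) + ((a 0 i)%:R - (j == i)%:R) *: gpP U a j v.
    by rewrite -scale_lfunE -(com_EP i j hU a0) comE addrC subrK.
  rewrite (eq_bigr _ (fun i _ => e i)) big_split /= -scaler_suml sumrB natS; congr (_ + (_ - _) *: _).
  by rewrite (bigD1 j) //= eqxx big1 ?addr0 // => i; rewrite eq_sym => /negPf ->.
have euQ b x v : Eu (gpQ U b x v) = gpQ U b x (Eu v) + (mdeg b)%:R *: gpQ U b x v.
  rewrite /Eu !sum_lfunE linear_sum.
  have e i : gpP U (eps i) i (gpQ U b x v) = gpQ U b x (gpP U (eps i) i v) + (b 0 i)%:R *: gpQ U b x v.
    by rewrite -scale_lfunE -(com_EQ i b x hU) comE addrC subrK.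
  by rewrite (eq_bigr _ (fun i _ => e i)) big_split /= -scaler_suml natS.
have [r [r1 [r2 r3]]] := eig_exists (lfun_lin Eu).
have [mu0 mu0r] : exists mu0, mu0 \in r.
  by move: (r3 nz); case: r {r1 r2 r3} => // mu0 r _; exists mu0; rewrite mem_head.
have [N hN] := natr_shift_notin r mu0.
(* k is taken largest with mu0 + k an eigenvalue; only eigenvalues in mu0 + Z matter, because
   degrees are integers. *)
have ex0 : exists k, mu0 + k%:R \in r by exists 0%N; rewrite addr0.
have bd k : mu0 + k%:R \in r -> (k <= N)%N.
  by move=> h; rewrite leqNgt; apply/negP => /ltnW /hN; rewrite h.
case: (ex_maxnP ex0 bd) => k kr kmax.
have [v v0 ev] := r2 _ kr.
have top d w : (0 < d)%N -> Eu w = (mu0 + k%:R + d%:R) *: w -> w = 0.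
  move=> d0 ew; apply/eqP; apply: contraT => w0; have := r1 _ _ w0 ew.
  by rewrite -addrA -natrD => /kmax; rewrite -[X in (_ <= X)%N]addn0 leq_add2l leqNgt d0.
pose S v := (forall a j, (1 < mdeg a)%N -> gpP U a j v = 0) /\ (forall b x, b != 0 -> gpQ U b x v = 0).
have Sv : S v.
  split=> [a j ha|b x hb].
    have a0 : a != 0 by rewrite -mdeg_gt0 ltnW.
    apply: (top (mdeg a).-1); first by rewrite -subn1 subn_gt0.
    rewrite euP // ev linearZ /= -scalerDl; congr ((_ + _) *: _).
    by rewrite -subn1 natrB // ltnW.
  apply: (top (mdeg b)); first by rewrite mdeg_gt0.
  by rewrite euQ ev linearZ /= -scalerDl.
(* An element of positive degree moved past any operator leaves a commutator of positive degree,
   which kills w as well. *)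
have invS : Defs.invariant (gpops U) S.
  (* A bracket term either has coefficient zero or comes from lowering a nonzero exponent, and then
     its degree is the expected one. *)
  have kill (c : C) (F : 'End(gpcar U)) w : (c != 0 -> F w = 0) -> c *: F w = 0.
    by have [->|c0 ->//] := eqVneq c 0; rewrite ?scale0r ?scaler0.
  split.
  - by split=> *; rewrite linear0.
  - move=> c x y [x1 x2] [y1 y2]; split=> [a j h|b z h].
      by rewrite lfun_lin x1 // y1 // scaler0 addr0.
    by rewrite lfun_lin x2 // y2 // scaler0 addr0.
  case=> [[[c c0] j]|[c y]] w [w1 w2] /=; split=> [a l ha|b x hb].
  - have a0 : a != 0 by rewrite -mdeg_gt0 ltnW.
    have := hP a c l j w a0 c0; rewrite (w1 a l ha) linear0 subr0 => ->.
    rewrite !kill ?subrr // => nz0; apply: w1.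
      by rewrite mshiftC; apply: mshift_gt1l.
    exact: mshift_gt1.
  - have /eqP := hQ c b j x w c0; rewrite w2 // linear0 sub0r.
    rewrite kill; first by rewrite oppr_eq0 => /eqP.
    by move=> _; apply: w2; rewrite mshiftE; apply: mshift_neq0.
  - have a0 : a != 0 by rewrite -mdeg_gt0 ltnW.
    have := hQ a c l y w a0; rewrite (w1 a l ha) linear0 subr0 => ->.
    rewrite kill // => cl; apply: w2.
    have c0 : c != 0 by apply: contraNneq cl => ->; rewrite mxE.
    by rewrite mshiftE; apply: mshift_neq0.
  - have := hG b c x y w; rewrite (w2 b x hb) linear0 subr0 => ->.
    by apply: w2; rewrite -mdeg_gt0 mdegD ltn_addr // mdeg_gt0.
have [z|h] := hirr S invS; first by rewrite (z v Sv) eqxx in v0.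
split=> [a j ha|b x hb]; apply/lfunP => w; rewrite zero_lfunE; have [h1 h2] := h w.
  exact: h1.
exact: h2.
Qed.

(** Restriction to the part of degree zero, where z_p d/dz_q is E^p_q. *)
Definition gl_of_gp U : glmod n L := GLMod (fun p q => gpP U (eps p) q) (fun x => gpQ U 0 x).

Lemma gl_of_gp_is_glmod U : is_gpmod br U -> is_glmod br (gl_of_gp U).
Proof.
case=> h1 h2 h3 h4; split=> [k x y|p q r t v|p q x v|x y v] /=.
- exact: h1.
- rewrite h2 ?eps_neq0 // !mxE; congr (_ - _).
    by case: eqVneq => [->|_]; rewrite ?scale0r // mshift_eps_r.
  by case: eqVneq => [->|_]; rewrite ?scale0r // mshift_eps.
- by rewrite h3 ?eps_neq0 // mxE scale0r.
- by rewrite h4 addr0.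
Qed.

(** Inflation along the quotient of g^+ by its elements of positive degree. *)
Definition gp_of_gl (V : glmod n L) : gpmod n L :=
  GPMod (fun b j => \sum_p (b == eps p)%:R *: glA V p j) (fun b x => (b == 0)%:R *: glB V x).

Section GpOfGl.
Variable V : glmod n L.
Local Notation U := (gp_of_gl V).

Lemma gp_of_glP p j : gpP U (eps p) j = glA V p j.
Proof.
rewrite /= (bigD1 p) //= eqxx scale1r big1 ?addr0 // => q.
by rewrite (inj_eq (@eps_inj n)) eq_sym => /negPf ->; rewrite scale0r.
Qed.

Lemma gp_of_glP0 a j : (1 < mdeg a)%N -> gpP U a j = 0.
Proof.
move=> h; rewrite /= big1 // => p _; case: eqP => [e|_]; last by rewrite scale0r.
by rewrite e mdeg_eps in h.
Qed.

Lemma gp_of_glQ x : gpQ U 0 x = glB V x.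
Proof. by rewrite /= eqxx scale1r. Qed.

Lemma gp_of_glQ0 b x : b != 0 -> gpQ U b x = 0.
Proof. by rewrite /= => /negPf ->; rewrite scale0r. Qed.

Lemma gp_of_gl_vanish : gp_vanish U 2.
Proof.
split=> [a j [i hi]|b x [i hi]].
  by apply: gp_of_glP0; apply: leq_trans hi (mdeg_ge a i).
by apply: gp_of_glQ0; apply: contraTneq hi => ->; rewrite mxE.
Qed.

Lemma mdeg_cases (a : mi n) : a != 0 -> (1 < mdeg a)%N \/ exists p, a = eps p.
Proof.
rewrite -mdeg_gt0 leq_eqVlt => /predU1P[e|]; last by left.
by right; apply: mdeg1.
Qed.

(** The elements of positive degree form an ideal: if one of them enters a bracket, the left side is
    zero, and each term on the right has a zero coefficient or positive degree. In degree zero the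
    relations are those of [is_glmod]. *)
Lemma gp_of_gl_is_gpmod : is_glmod br V -> is_gpmod br U.
Proof.
have kill (c : C) (F : 'End(glcar V)) w : (c != 0 -> F = 0) -> c *: F w = 0.
  by have [->|c0 ->//] := eqVneq c 0; rewrite ?scale0r ?zero_lfunE ?scaler0.
case=> h1 h2 h3 h4; split=> [b k x y|a b j k v a0 b0|a b j x v a0|a b x y v].
- by rewrite /= h1 scalerDr !scalerA mulrC.
- have [ha|[p ea]] := mdeg_cases a0.
    rewrite !(gp_of_glP0 _ ha) !zero_lfunE linear0 subrr !kill ?subrr // => nz; apply: gp_of_glP0.
      by rewrite mshiftC; apply: mshift_gt1l.
    exact: mshift_gt1.
  have [hb|[q eb]] := mdeg_cases b0.
    rewrite !(gp_of_glP0 _ hb) !zero_lfunE linear0 subrr !kill ?subrr // => nz; apply: gp_of_glP0.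
      by rewrite mshiftC; apply: mshift_gt1.
    exact: mshift_gt1l.
  rewrite ea eb !gp_of_glP h2 !mxE; congr (_ - _).
    by case: eqVneq => [->|_]; rewrite ?scale0r // mshift_eps_r gp_of_glP.
  by case: eqVneq => [->|_]; rewrite ?scale0r // mshift_eps gp_of_glP.
- have [->|b0] := eqVneq b 0.
    rewrite gp_of_glQ mxE scale0r; have [ha|[p ->]] := mdeg_cases a0.
      by rewrite !(gp_of_glP0 _ ha) !zero_lfunE linear0 subrr.
    by rewrite gp_of_glP h3.
  rewrite !(gp_of_glQ0 _ b0) !zero_lfunE linear0 subrr kill // => _.
  by apply: gp_of_glQ0; rewrite mshiftE; apply: mshift_neq0.
- have [->|a0] := eqVneq a 0; last first.
    rewrite !(gp_of_glQ0 _ a0) !zero_lfunE linear0 subrr gp_of_glQ0 ?zero_lfunE //.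
    by rewrite -mdeg_gt0 mdegD ltn_addr // mdeg_gt0.
  rewrite add0r; have [->|b0] := eqVneq b 0; first by rewrite !gp_of_glQ h4.
  by rewrite !(gp_of_glQ0 _ b0) !zero_lfunE linear0 subrr.
Qed.

Lemma gp_of_gl_invariant S : Defs.invariant (gpops U) S <-> Defs.invariant (glops V) S.
Proof.
split=> -[S0 SD So]; split=> //.
  case=> [[p q]|x] v Sv.
    suff : S (gpP U (eps p) q v) by rewrite gp_of_glP.
    exact: (So (inl (Sub (eps p) (eps_neq0 p), q))).
  suff : S (gpQ U 0 x v) by rewrite gp_of_glQ.
  exact: (So (inr (0, x))).
case=> [[[a a0] j]|[b x]] v Sv.
  rewrite -[gpops _ _ _]/(gpP U a j v); have [ha|[p ->]] := mdeg_cases a0.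
    by rewrite gp_of_glP0 // zero_lfunE.
  by rewrite gp_of_glP; exact: (So (inl (p, j))).
rewrite -[gpops _ _ _]/(gpQ U b x v); have [->|b0] := eqVneq b 0.
  by rewrite gp_of_glQ; exact: (So (inr x)).
by rewrite gp_of_glQ0 // zero_lfunE.
Qed.

Lemma coefsb_eps (s : Zn n) p : coefsb s (eps p) = zc s p.
Proof.
rewrite /coefsb mono_eps big1 ?divr1 // => i _; rewrite mxE.
by case: (i == p).
Qed.

(** In the box {0,1}^n only the indices epsilon_p, with coefficient s_p, and 0, with coefficient 1,
    contribute. *)
Lemma Jjet_of_gl lam : Jjet lam U 2 = Jgl lam V.
Proof.
rewrite /Jjet /Jgl; congr tmodel; apply/funext.
  move=> j; apply/funext => s; rewrite /glD /jetD.
  under eq_bigr => b _ do rewrite /= scaler_sumr.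
  rewrite exchange_big; apply: eq_bigr => p _ /=.
  rewrite -coefsb_eps -(@sum_bx n _ 2 (fun b => coefsb s b *: glA V p j) (eps p)); last first.
    by left; apply/inboxP => i; rewrite mxE; case: (i == p).
  rewrite big_mkcond [RHS]big_mkcond; apply: eq_bigr => b _ /=.
  have [->|_] := eqVneq (bx b) (eps p); first by rewrite eps_neq0 scale1r.
  by rewrite scale0r scaler0; case: ifP.
move=> s; apply/funext => x; rewrite jetGE /jet.
rewrite -[RHS]scale1r -(coefsb0 s) -(@sum_bx n _ 2 (fun b => coefsb s b *: glB V x) 0); last first.
  by left; apply/inboxP => i; rewrite mxE.
rewrite [RHS]big_mkcond; apply: eq_bigr => b _ /=.
by case: eqVneq => _; rewrite ?scale1r ?scale0r ?scaler0.
Qed.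

End GpOfGl.

Lemma gp_of_gl_irr V : gl_irr V <-> irreducible (gpops (gp_of_gl V)).
Proof. by apply: iff_sym; apply: eq_irreducible; apply: gp_of_gl_invariant. Qed.

Lemma gp_of_gl_iso V V' : gl_iso V V' <-> gp_iso (gp_of_gl V) (gp_of_gl V').
Proof.
split=> -[f [fl fb fi]]; exists f; split=> //.
  have fA p q v : f (glA V p q v) = glA V' p q (f v) := fi (inl (p, q)) v.
  have fB x v : f (glB V x v) = glB V' x (f v) := fi (inr x) v.
  case=> [[[a a0] j]|[b x]] v.
    change (f (gpP (gp_of_gl V) a j v) = gpP (gp_of_gl V') a j (f v)).
    have [ha|[p ->]] := mdeg_cases a0; last by rewrite !gp_of_glP fA.
    by rewrite !gp_of_glP0 // !zero_lfunE (lin0 fl).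
  change (f (gpQ (gp_of_gl V) b x v) = gpQ (gp_of_gl V') b x (f v)).
  have [->|b0] := eqVneq b 0; first by rewrite !gp_of_glQ fB.
  by rewrite !gp_of_glQ0 // !zero_lfunE (lin0 fl).
have fP a j v (a0 : a != 0) : f (gpP (gp_of_gl V) a j v) = gpP (gp_of_gl V') a j (f v) := fi (inl (Sub a a0, j)) v.
have fQ b x v : f (gpQ (gp_of_gl V) b x v) = gpQ (gp_of_gl V') b x (f v) := fi (inr (b, x)) v.
case=> [[p q]|x] v.
  change (f (glA V p q v) = glA V' p q (f v)).
  by rewrite -!gp_of_glP fP ?eps_neq0.
change (f (glB V x v) = glB V' x (f v)).
by rewrite -!gp_of_glQ fQ.
Qed.

(** On an irreducible U the positive part acts by zero, so restriction followed by inflation gives U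
    back on the same space. *)
Lemma gp_irr_iso U : is_gpmod br U -> irreducible (gpops U) -> gp_iso U (gp_of_gl (gl_of_gp U)).
Proof.
move=> hU irr; have [zP zQ] := irr_positive hU irr.
exists id; split=> //; first by exists id.
case=> [[[a a0] j]|[b x]] v.
  rewrite -[RHS]/(gpP (gp_of_gl (gl_of_gp U)) a j v) -[LHS]/(gpP U a j v).
  by have [ha|[p ->]] := mdeg_cases a0; [rewrite gp_of_glP0 // zP|rewrite gp_of_glP].
rewrite -[RHS]/(gpQ (gp_of_gl (gl_of_gp U)) b x v) -[LHS]/(gpQ U b x v).
by have [->|b0] := eqVneq b 0; [rewrite gp_of_glQ|rewrite gp_of_glQ0 // zQ].
Qed.

Lemma catJ_gl (M : gmod n L) : catJ br M -> g_irr M ->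
  exists (lam : 'rV[C]_n) (V : glmod n L), [/\ is_glmod br V, gl_irr V & g_iso M (Jgl lam V)].
Proof.
move=> J irrM.
have [lam [U [N [hU indU hv iso]]]] := catJ_jet J (irreducible_indecomposable irrM).
(* [catJ_jet] provides indecomposability of U only; irreducibility is carried over from M. *)
have irrU : irreducible (gpops U) by apply/(gp_irrP hv lam); exact: iso_irreducible iso irrM.
have isoU := gp_irr_iso hU irrU.
exists lam, (gl_of_gp U); split; first exact: gl_of_gp_is_glmod.
  by apply/gp_of_gl_irr; apply: iso_irreducible isoU irrU.
apply: iso_trans iso _; rewrite -Jjet_of_gl.
apply/(Jjet_isoP _ _ (proj1 irrU) hv (gp_of_gl_vanish _)); split=> //.
by exists 0 => i; rewrite subrr zc0.
Qed.

End PartC.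

Theorem theorem4 (n : nat) (L : vectType C) (br : L -> L -> L) :
  (0 < n)%N -> is_lie br ->
  (* (a) every module in category J is a polynomial module *)
  (forall M : gmod n L, catJ br M -> polynomial_module M) /\
  (* (b) indecomposables in J  <->  (lam mod Z^n, f.d. indecomposable g^+-module U) *)
  ((forall U : gpmod n L, is_gpmod br U -> gp_indec U ->
      exists N : nat, gp_vanish U N) /\
   (forall (lam : 'rV[C]_n) (U : gpmod n L) (N : nat),
      is_gpmod br U -> gp_indec U -> gp_vanish U N ->
      catJ br (Jjet lam U N) /\ g_indec (Jjet lam U N)) /\
   (forall M : gmod n L, catJ br M -> g_indec M ->
      exists (lam : 'rV[C]_n) (U : gpmod n L) (N : nat),
        [/\ is_gpmod br U, gp_indec U, gp_vanish U N & g_iso M (Jjet lam U N)]) /\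
   (forall (lam lam' : 'rV[C]_n) (U U' : gpmod n L) (N N' : nat),
      is_gpmod br U -> gp_indec U -> gp_vanish U N ->
      is_gpmod br U' -> gp_indec U' -> gp_vanish U' N' ->
      (g_iso (Jjet lam U N) (Jjet lam' U' N') <-> lam_equiv lam lam' /\ gp_iso U U'))) /\
  (* (c) irreducibles in J  <->  (lam mod Z^n, f.d. irreducible gl_n + gdot -module V) *)
  ((forall (lam : 'rV[C]_n) (V : glmod n L),
      is_glmod br V -> gl_irr V -> catJ br (Jgl lam V) /\ g_irr (Jgl lam V)) /\
   (forall M : gmod n L, catJ br M -> g_irr M ->
      exists (lam : 'rV[C]_n) (V : glmod n L),
        [/\ is_glmod br V, gl_irr V & g_iso M (Jgl lam V)]) /\
   (forall (lam lam' : 'rV[C]_n) (V V' : glmod n L),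
      is_glmod br V -> gl_irr V -> is_glmod br V' -> gl_irr V' ->
      (g_iso (Jgl lam V) (Jgl lam' V') <-> lam_equiv lam lam' /\ gl_iso V V'))).
Proof.
move=> _ _; split; [|split; [split; [|split; [|split]]|split; [|split]]].
- exact: catJ_polynomial.
- by move=> U hU _; apply: gp_vanish_exists hU.
- move=> lam U N hU indU hv; split; first exact: Jjet_catJ.
  exact/(gp_indecP hv).
- exact: catJ_jet.
- by move=> lam lam' U U' N N' hU [nz _] hv _ _ hv'; apply: Jjet_isoP.
- move=> lam V hV irrV; split; rewrite -Jjet_of_gl.
    exact: (Jjet_catJ (gp_of_gl_vanish V) lam (gp_of_gl_is_gpmod hV)).
  by apply/(gp_irrP (gp_of_gl_vanish V)); apply/gp_of_gl_irr.
- exact: catJ_gl.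
- move=> lam lam' V V' hV [nz _] hV' _; rewrite -!Jjet_of_gl gp_of_gl_iso.
  exact: (@Jjet_isoP n L lam lam' (gp_of_gl V) (gp_of_gl V') 2 2 nz (gp_of_gl_vanish V) (gp_of_gl_vanish V')).
Qed.
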